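(* Let $\varphi$ be an analytic self-map of $\mathbb{D}$. Then $\mathcal{M}(\varphi)=\mathcal{D}$ if and only if both of the following hold: (1) $\|\varphi\|_\infty<1$, and (2) $\varphi\in\mathcal{M}(\mathcal{D})$.
   Context: $\mathbb{D}$ is the open unit disc in $\mathbb{C}$ and $A$ is normalized Lebesgue area measure on $\mathbb{D}$. An analytic self-map of $\mathbb{D}$ is a holomorphic $\varphi$ on $\mathbb{D}$ with $\varphi(\mathbb{D})\subset\mathbb{D}$, and $\|\varphi\|_\infty=\sup_{z\in\mathbb{D}}|\varphi(z)|$. The Dirichlet space $\mathcal{D}$ is the space of holomorphic $f$ on $\mathbb{D}$ with $\|f\|_{\mathcal{D}}^2=|f(0)|^2+\int_{\mathbb{D}}|f'(z)|^2\,dA(z)<\infty$. $\mathcal{M}(\mathcal{D})$ is the algebra of multipliers of $\mathcal{D}$, i.e. the functions $u$ on $\mathbb{D}$ such that $uf\in\mathcal{D}$ for every $f\in\mathcal{D}$ (so $f\mapsto uf$ is automatically bounded). For $u\in\mathcal{D}$, the weighted composition operator is $(W_{u,\varphi}f)(z)=u(z)f(\varphi(z))$, and $\mathcal{M}(\varphi)=\{u\in\mathcal{D}: W_{u,\varphi}\text{ is bounded from }\mathcal{D}\text{ into }\mathcal{D}\}$. *)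

(* Defs.v *)
From HB Require Import structures.
From mathcomp Require Import all_boot all_order all_algebra.
From mathcomp Require Import complex.
From mathcomp Require Import all_classical all_reals all_analysis.

Set Implicit Arguments.
Unset Strict Implicit.
Unset Printing Implicit Defensive.

Import Order.TTheory GRing.Theory Num.Theory.
Import numFieldNormedType.Exports.

Local Open Scope classical_set_scope.
Local Open Scope complex_scope.
Local Open Scope ring_scope.

(* The generic norm `|z| on R[i] is R[i]-valued; the real-valued modulus is
   Normc.normc.  A function on the disc is represented by a total function
   R[i] -> R[i] of which only the values on the disc matter: the function sets
   below are stable under changing their members off the disc, so an equality
   of two of them says exactly that the corresponding sets of functions on the
   disc are equal. *)

Definition unit_disc {R : realType} : set R[i] := [set z | Normc.normc z < 1].

(* R[i]^o is R[i] as a normed space over the field R[i], so derivable and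
   derive1 are complex differentiability and the complex derivative. *)
Definition holomorphic_on_disc (R : realType) (f : R[i] -> R[i]) : Prop :=
  forall z : R[i], unit_disc z -> derivable (f : R[i]^o -> R[i]^o) z 1.

Definition cderiv (R : realType) (f : R[i] -> R[i]) (z : R[i]) : R[i] :=
  derive1 (f : R[i] -> R[i]^o) z.

Definition analytic_self_map (R : realType) (phi : R[i] -> R[i]) : Prop :=
  holomorphic_on_disc phi /\ forall z, unit_disc z -> unit_disc (phi z).

(* Extended-real-valued, since f may be unbounded on the disc. *)
Definition sup_norm (R : realType) (f : R[i] -> R[i]) : \bar R :=
  ereal_sup [set (Normc.normc (f z))%:E | z in unit_disc].

Lemma invr_pi_ge0 (R : realType) : 0 <= (pi : R)^-1.
Proof. by rewrite invr_ge0 pi_ge0. Qed.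

(* Area measure divided by pi, carried by R * R with (x, y) standing for
   x + iy; it gives the unit disc mass 1. *)
Definition area (R : realType) :
    {measure set (measurableTypeR R * measurableTypeR R) -> \bar R} :=
  mscale (NngNum (invr_pi_ge0 R))
    (@lebesgue_measure R \x @lebesgue_measure R)%E.

Definition dirichlet_normsq (R : realType) (f : R[i] -> R[i]) : \bar R :=
  ((Normc.normc (f 0) ^+ 2)%:E +
   \int[area R]_(p in [set p | unit_disc (p.1 +i* p.2)])
     (Normc.normc (cderiv f (p.1 +i* p.2)) ^+ 2)%:E)%E.

Definition dirichlet {R : realType} : set (R[i] -> R[i]) :=
  [set f | holomorphic_on_disc f /\ (dirichlet_normsq f < +oo)%E].

Definition dirichlet_norm (R : realType) (f : R[i] -> R[i]) : R :=
  Num.sqrt (fine (dirichlet_normsq f)).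

Definition multipliers {R : realType} : set (R[i] -> R[i]) :=
  [set u | forall f, dirichlet f -> dirichlet (fun z => u z * f z)].

Definition wcomp (R : realType) (u phi f : R[i] -> R[i]) : R[i] -> R[i] :=
  fun z => u z * f (phi z).

Definition bounded_on_dirichlet (R : realType)
    (T : (R[i] -> R[i]) -> (R[i] -> R[i])) : Prop :=
  exists K : R, forall f, dirichlet f ->
    dirichlet (T f) /\ dirichlet_norm (T f) <= K * dirichlet_norm f.

Definition multipliers_of (R : realType) (phi : R[i] -> R[i]) :
    set (R[i] -> R[i]) :=
  [set u | dirichlet u /\ bounded_on_dirichlet (wcomp u phi)].

(* Main.v *)
Require Import Defs.
From mathcomp Require Import all_boot all_order all_algebra.
From mathcomp Require Import complex ring lra.
From mathcomp Require Import all_classical all_reals all_analysis.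
From mathcomp Require Import measurable_realfun.

Set Implicit Arguments.
Unset Strict Implicit.
Unset Printing Implicit Defensive.

Import Order.TTheory GRing.Theory Num.Theory.
Import numFieldNormedType.Exports.

Local Open Scope classical_set_scope.
Local Open Scope complex_scope.
Local Open Scope ring_scope.


(** Write E(z) for the norm of the evaluation f |-> f(z) on the Dirichlet space.

    If |phi| <= r < 1 and phi is a multiplier, then for u and f in the space
    (u f(phi))' = u' f(phi) + f'(phi) (u phi'), and
    u phi' = (u phi)' - u' phi is square integrable.  On the disc |w| <= r both
    |f(w)| and |f'(w)| are at most a constant times the norm of f, so u f(phi)
    is in the space with norm at most a constant (depending on u) times the
    norm of f: this is [wcomp_bounded].

    Conversely suppose that every u in the space gives a bounded operator.
    Applied to f = id this says that phi is a multiplier.  For each u, the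
    inequality |u(z) f(phi(z))| <= K_u E(z), valid for f in the unit ball, gives
    |u(z)| E(phi(z)) <= K_u E(z) for all z.  If E(phi(z)) were unbounded, the
    gliding hump argument would build a single u contradicting all of these
    inequalities: u = sum of +- 16^-n v_n, where v_n is a unit vector that
    nearly attains E at a point z_n with E(phi(z_n)) very large, and where the
    signs prevent cancellation at z_n ([hump_ge], [eval_norm_comp_bounded]).
    Hence E(phi(z)) is bounded.  Since E tends to infinity at the boundary,
    witnessed by the polynomials sum of (xi z)^n / n ([unbounded_point_eval]),
    phi stays away from the unit circle.

    Both halves rest on the fact that E, and its analogue for f', is locally
    bounded, and the gliding hump also needs a geometric series of unit vectors
    to converge in the space ([dirichlet_series]).  These are consequences of
    elementary function theory, which is developed here from complex
    differentiability alone: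
    - Goursat's theorem for rectangles, by bisection, and its extension to an
      isolated puncture where z k(z) tends to 0 ([goursat],
      [rect_int_puncture]);
    - Cauchy's formulas for g(w) and f'(w) over rectangles, where only a lower
      bound for the integral of 1/(z - w) is used instead of the value 2 pi i;
      they give local Lipschitz bounds for f', a quadratic Taylor estimate and
      the holomorphy of f' ([taylor2_le], [cderiv_hol]);
    - the estimate of |g(w)|^2 by the area integral of |g|^2, obtained from
      Cauchy's formula over all rectangles in a family with four independent
      sides ([area_estimate]). *)

Local Notation nc := Normc.normc.
Local Notation Re := complex.Re.
Local Notation Im := complex.Im.

(** * The modulus on the complex field *)

Section Modulus.
Variable R : realType.
Implicit Types (z w : R[i]) (x y e : R).

Lemma normE z : `|z| = (nc z)%:C.
Proof. by []. Qed.

Lemma nc_ge0 z : 0 <= nc z.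
Proof. by case: z => a b; exact: sqrtr_ge0. Qed.

Lemma ncM z w : nc (z * w) = nc z * nc w. Proof. exact: Normc.normcM. Qed.
Lemma ncN z : nc (- z) = nc z. Proof. exact: normcN. Qed.
Lemma ncV z : nc z^-1 = (nc z)^-1. Proof. exact: Normc.normcV. Qed.
Lemma nc0 : nc (0 : R[i]) = 0. Proof. exact: Normc.normc0. Qed.
Lemma nc1 : nc (1 : R[i]) = 1. Proof. exact: Normc.normc1. Qed.
Lemma ncD z w : nc (z + w) <= nc z + nc w. Proof. exact: le_normcD. Qed.
Lemma ncB z w : nc (z - w) = nc (w - z). Proof. by rewrite -ncN opprB. Qed.
Lemma ncBle z w : nc (z - w) <= nc z + nc w.
Proof. by rewrite -(ncN w); exact: ncD. Qed.
Lemma nc_eq0 z : (nc z == 0) = (z == 0).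
Proof.
by apply/eqP/eqP => [|->]; [exact: Normc.eq0_normc|exact: nc0].
Qed.
Lemma nc_gt0 z : (0 < nc z) = (z != 0).
Proof. by rewrite lt_def nc_ge0 andbT nc_eq0. Qed.
Lemma ncC x : nc x%:C = `|x|.
Proof. by rewrite /= expr0n /= addr0 sqrtr_sqr. Qed.
Lemma ncX z n : nc (z ^+ n) = nc z ^+ n.
Proof. by elim: n => [|n IH]; rewrite ?expr0 ?nc1// !exprS ncM IH. Qed.
Lemma nc_sqr z : nc z ^+ 2 = (complex.Re z) ^+ 2 + (complex.Im z) ^+ 2.
Proof. by case: z => a b /=; rewrite sqr_sqrtr// addr_ge0 ?sqr_ge0. Qed.
Lemma nc_geRe z : `|complex.Re z| <= nc z.
Proof.
rewrite -(@ler_pXn2r _ 2)// ?nnegrE ?nc_ge0//.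
by rewrite nc_sqr real_normK ?num_real// lerDl sqr_ge0.
Qed.
Lemma nc_geIm z : `|complex.Im z| <= nc z.
Proof.
rewrite -(@ler_pXn2r _ 2)// ?nnegrE ?nc_ge0//.
by rewrite nc_sqr real_normK ?num_real// lerDr sqr_ge0.
Qed.
Lemma nc_leReIm z : nc z <= `|complex.Re z| + `|complex.Im z|.
Proof.
rewrite -(@ler_pXn2r _ 2)// ?nnegrE ?nc_ge0 ?addr_ge0//.
rewrite nc_sqr sqrrD !real_normK ?num_real// -addrA lerD2l lerDr.
by rewrite mulrn_wge0// mulr_ge0.
Qed.
Lemma ncDist z w : nc z - nc w <= nc (z - w).
Proof. by rewrite lerBlDr (le_trans _ (ncD _ _))// subrK. Qed.

End Modulus.

(** * Complex derivatives *)

Section ComplexDerivative.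
Variable R : realType.
Implicit Types (f g : R[i] -> R[i]) (z w d h : R[i]) (e : R).

(** The derivative expressed with the real-valued modulus, so that estimates
    can be carried out over the reals; [is_cderP] identifies it with the
    convergence of difference quotients. *)
Definition is_cder f z d := forall e : R, 0 < e -> exists2 r : R, 0 < r &
  forall h, nc h < r -> nc (f (z + h) - f z - d * h) <= e * nc h.

Lemma is_cderP f z d : is_cder f z d <->
  h^-1 *: ((f (h + z) - f z) : R[i]^o) @[h --> (0 : (R[i] : numFieldType))^'] --> (d : R[i]^o).
Proof.
split=> [fd|].
  apply/cvgrPdist_le => /= e e0.
  have [x xE] : exists x : R, e = x%:C by exists (complex.Re e); rewrite RRe_real// gtr0_real.
  move: e0; rewrite xE ltcR => x0.
  have [r r0 H] := fd x x0.
  apply/nbhs_ballP; exists r%:C; rewrite /= ?ltcR//.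
  move=> h; rewrite /ball/= sub0r normrN normE ltcR => hr h0.
  rewrite normE lecR -(@ler_pM2r _ (nc h)) ?nc_gt0// -ncM.
  apply: le_trans (H h hr); rewrite /GRing.scale/= -ncN.
  rewrite (addrC z) le_eqVlt; apply/orP; left; apply/eqP; congr nc.
  by field.
move/cvgrPdist_le => H e e0.
have /H/nbhs_ballP[r /= r0 {}H] : (0 : R[i]) < e%:C by rewrite ltcR.
have [x xE] : exists x : R, r = x%:C by exists (complex.Re r); rewrite RRe_real// gtr0_real.
move: r0 H; rewrite xE ltcR => r0 H.
exists x => // h hx; have [->|h0] := eqVneq h 0.
  by rewrite addr0 subrr mulr0 subrr nc0 mulr0.
have := H h; rewrite /ball/= sub0r normrN normE ltcR => /(_ hx h0).
rewrite normE lecR -(@ler_pM2r _ (nc h)) ?nc_gt0// -ncM; apply: le_trans.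
rewrite /GRing.scale/= -ncN (addrC z) le_eqVlt; apply/orP; left; apply/eqP.
by congr nc; field.
Qed.

Lemma is_cder_is_derive f z d :
  is_cder f z d <-> is_derive (z : R[i]^o) (1 : R[i]^o) (f : R[i]^o -> R[i]^o) d.
Proof.
have E : (fun h : R[i] => h^-1 *: ((f (h + z) - f z) : R[i]^o)) =
  (fun h : R[i] => h^-1 *: (f (h *: (1 : R[i]^o) + z) - f z : R[i]^o)).
  by apply/funext => h; rewrite /GRing.scale/= mulr1.
rewrite is_cderP E; split=> [fd|[fd <-]].
  apply: DeriveDef; first by apply/cvg_ex; exists d.
  exact/cvg_lim.
exact: fd.
Qed.

Lemma is_cder_derivable f z d :
  is_cder f z d -> derivable (f : R[i]^o -> R[i]^o) z 1.
Proof. by move/is_cder_is_derive => []. Qed.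

Lemma is_cder_cderiv f z d : is_cder f z d -> cderiv f z = d.
Proof.
by move/is_cder_is_derive => [_ <-]; rewrite /cderiv derive1E.
Qed.

Lemma derivable_is_cder f z :
  derivable (f : R[i]^o -> R[i]^o) z 1 -> is_cder f z (cderiv f z).
Proof.
by move=> fz; apply/is_cder_is_derive; rewrite /cderiv derive1E; exact/derivableP.
Qed.

Lemma is_cder_cst w z : is_cder (fun=> w) z 0.
Proof. by apply/is_cder_is_derive; exact: is_derive_cst. Qed.

Lemma is_cder_id z : is_cder id z 1.
Proof. by apply/is_cder_is_derive; exact: is_derive_id. Qed.

Lemma is_cderD f g z d d' : is_cder f z d -> is_cder g z d' ->
  is_cder (fun x => f x + g x) z (d + d').
Proof.
move=> /is_cder_is_derive fd /is_cder_is_derive gd.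
by apply/is_cder_is_derive; exact: is_deriveD.
Qed.

Lemma is_cderB f g z d d' : is_cder f z d -> is_cder g z d' ->
  is_cder (fun x => f x - g x) z (d - d').
Proof.
move=> /is_cder_is_derive fd /is_cder_is_derive gd.
by apply/is_cder_is_derive; exact: is_deriveB.
Qed.

Lemma is_cderM f g z d d' : is_cder f z d -> is_cder g z d' ->
  is_cder (fun x => f x * g x) z (f z * d' + g z * d).
Proof.
move=> /is_cder_is_derive fd /is_cder_is_derive gd.
by apply/is_cder_is_derive; exact: is_deriveM.
Qed.

Lemma is_cderZ w f z d : is_cder f z d ->
  is_cder (fun x => w * f x) z (w * d).
Proof.
by move=> fd; have := is_cderM (is_cder_cst w z) fd; rewrite mulr0 addr0.
Qed.

Lemma is_cderV f z d : f z != 0 -> is_cder f z d ->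
  is_cder (fun x => (f x)^-1) z (- d / f z ^+ 2).
Proof.
move=> fz0 /is_cder_is_derive fd; apply/is_cder_is_derive; apply: DeriveDef.
  by apply: derivableV => //; case: fd.
by rewrite deriveV//; case: fd => _ ->; rewrite /GRing.scale/= mulrC mulrN mulNr.
Qed.

Definition ccont f z := forall e, 0 < e -> exists2 r : R, 0 < r &
    forall h, nc h < r -> nc (f (z + h) - f z) <= e.

Lemma ccontM f g z : ccont f z -> ccont g z -> ccont (fun x => f x * g x) z.
Proof.
move=> cf cg e e0.
have f1 : 0 < nc (f z) + 1 by rewrite ltr_wpDl ?nc_ge0.
have g1 : 0 < nc (g z) + 1 by rewrite ltr_wpDl ?nc_ge0.
have [r r0 Hf] := cf _ (divr_gt0 (divr_gt0 e0 (ltr0n R 2)) g1).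
have [s s0 Hg] := cg (Num.min 1 (e / 2 / (nc (f z) + 1)))
  ltac:(by rewrite lt_min ltr01 !divr_gt0).
exists (Num.min r s); first by rewrite lt_min r0.
move=> h; rewrite lt_min => /andP[hr hs].
have {}Hf := Hf h hr; have := Hg h hs; rewrite le_min => /andP[Hg1 Hg2].
have gb : nc (g (z + h)) <= nc (g z) + 1.
  by rewrite -[g (z + h)](subrK (g z)) (le_trans (ncD _ _))// addrC lerD2l.
have -> : f (z + h) * g (z + h) - f z * g z =
  (f (z + h) - f z) * g (z + h) + f z * (g (z + h) - g z) by ring.
rewrite (le_trans (ncD _ _))// !ncM.
have -> : e = e / 2 / (nc (g z) + 1) * (nc (g z) + 1) +
   (nc (f z) + 1) * (e / 2 / (nc (f z) + 1)) by field; rewrite !gt_eqF.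
apply: lerD; apply: ler_pM; rewrite ?nc_ge0//.
by rewrite lerDl.
Qed.

Lemma ccontB f g z : ccont f z -> ccont g z -> ccont (fun x => f x - g x) z.
Proof.
move=> cf cg e e0.
have [r r0 Hf] := cf _ (divr_gt0 e0 (ltr0n R 2)).
have [s s0 Hg] := cg _ (divr_gt0 e0 (ltr0n R 2)).
exists (Num.min r s); first by rewrite lt_min r0.
move=> h; rewrite lt_min => /andP[/Hf {}Hf /Hg {}Hg].
have -> : f (z + h) - g (z + h) - (f z - g z) =
  (f (z + h) - f z) - (g (z + h) - g z) by ring.
by rewrite (le_trans (ncBle _ _))//; lra.
Qed.

Lemma is_cder_cont f z d : is_cder f z d -> ccont f z.
Proof.
move=> fd e e0; have [r r0 H] := fd 1 ltr01.
have c0 : 0 < 1 + nc d by rewrite ltr_pwDl// nc_ge0.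
exists (Num.min r (e / (1 + nc d))); first by rewrite lt_min r0 divr_gt0.
move=> h; rewrite lt_min ltr_pdivlMr// => /andP[hr he].
have := H h hr; rewrite mul1r => {}H.
rewrite -[X in nc X](subrK (d * h)) (le_trans (ncD _ _))// ncM.
have : nc h * (1 + nc d) <= e by exact: ltW.
by rewrite mulrDr mulr1 mulrC; lra.
Qed.

Lemma is_cder_comp f g z d d' : is_cder g z d' -> is_cder f (g z) d ->
  is_cder (fun x => f (g x)) z (d * d').
Proof.
move=> gd fd e e0.
have c1 : 0 < 1 + nc d' by rewrite ltr_pwDl// nc_ge0.
have c2 : 0 < 1 + nc d by rewrite ltr_pwDl// nc_ge0.
have e1 : 0 < e / 2 / (1 + nc d') by rewrite !divr_gt0.
have e2 : 0 < Num.min 1 (e / 2 / (1 + nc d)) by rewrite lt_min ltr01 !divr_gt0.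
have [r r0 Hf] := fd _ e1.
have [s s0 Hg] := gd _ e2.
have [t t0 Hc] := is_cder_cont gd (divr_gt0 r0 (ltr0n R 2)).
exists (Num.min s t); first by rewrite lt_min s0.
move=> h; rewrite lt_min => /andP[hs ht].
have {}Hc := Hc _ ht.
have {}Hg := Hg _ hs.
set k := g (z + h) - g z in Hc Hg.
have kr : nc k < r by lra.
have := Hf _ kr; rewrite {1}/k (addrC (g z)) subrK => {}Hf.
have kle : nc k <= (1 + nc d') * nc h.
  rewrite -[k](subrK (d' * h)) (le_trans (ncD _ _))// ncM mulrDl.
  by rewrite lerD2r (le_trans Hg)// ler_wpM2r ?nc_ge0// ge_min lexx.
have -> : f (g (z + h)) - f (g z) - d * d' * h =
  (f (g (z + h)) - f (g z) - d * k) + d * (k - d' * h) by ring.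
rewrite (le_trans (ncD _ _))// ncM.
have -> : e * nc h = e / 2 / (1 + nc d') * ((1 + nc d') * nc h) +
   (1 + nc d) * (e / 2 / (1 + nc d) * nc h) by field; rewrite !gt_eqF.
apply: lerD; first by rewrite (le_trans Hf)// ler_wpM2l// ltW.
apply: ler_pM; rewrite ?nc_ge0//; first by rewrite lerDr.
by rewrite (le_trans Hg)// ler_wpM2r ?nc_ge0// ge_min lexx orbT.
Qed.

End ComplexDerivative.

(** * Integrals of complex-valued functions over segments *)

Section ComplexIntegral.
Variable R : realType.
Notation mu := (@lebesgue_measure R).
Implicit Types (F G : R -> R[i]) (a b x : R) (w : R[i]).

Lemma measurable_seg a b : measurable (`[a, b]%classic : set (measurableTypeR R)).
Proof. exact: measurable_itv. Qed.

Definition cint F a b : R[i] :=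
  (\int[mu]_(t in `[a, b]) Re (F t)) +i* (\int[mu]_(t in `[a, b]) Im (F t)).

Definition cintegrable F a b : Prop :=
  mu.-integrable `[a, b] (fun t => (Re (F t))%:E) /\
  mu.-integrable `[a, b] (fun t => (Im (F t))%:E).

Definition seg_continuous F a b : Prop := forall t, a <= t <= b ->
  forall e : R, 0 < e -> exists2 r : R, 0 < r &
    forall s, a <= s <= b -> `|s - t| < r -> nc (F s - F t) <= e.

Lemma Re_add w w' : Re (w + w') = Re w + Re w'. Proof. by case: w; case: w'. Qed.
Lemma Im_add w w' : Im (w + w') = Im w + Im w'. Proof. by case: w; case: w'. Qed.
Lemma Re_opp w : Re (- w) = - Re w. Proof. by case: w. Qed.
Lemma Im_opp w : Im (- w) = - Im w. Proof. by case: w. Qed.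
Lemma Re_mul w w' : Re (w * w') = Re w * Re w' - Im w * Im w'.
Proof. by case: w; case: w'. Qed.
Lemma Im_mul w w' : Im (w * w') = Re w * Im w' + Im w * Re w'.
Proof. by case: w => ? ?; case: w' => ? ?. Qed.
Lemma complex_eq w w' : Re w = Re w' -> Im w = Im w' -> w = w'.
Proof. by case: w => ? ?; case: w' => ? ? /= -> ->. Qed.

Lemma within_continuous_seg (f : R -> R) a b :
  (forall t, a <= t <= b -> forall e : R, 0 < e -> exists2 r : R, 0 < r &
    forall s, a <= s <= b -> `|s - t| < r -> `|f s - f t| <= e) ->
  {within `[a, b], continuous f}.
Proof.
move=> H; apply/subspace_continuousP => t /= tab.
apply/cvgrPdist_le => e e0.
have [r r0 {}H] := H t tab e e0.
rewrite near_withinE; apply/nbhs_ballP; exists r => //= s.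
rewrite /ball/= distrC => sr sab; rewrite distrC; apply: H => //.
Qed.

Lemma seg_continuous_integrable F a b : seg_continuous F a b ->
  cintegrable F a b.
Proof.
move=> cF; split; apply: continuous_compact_integrable;
  try exact: segment_compact; apply: within_continuous_seg => t tab e e0;
  have [r r0 H] := cF t tab e e0; exists r => // s sab st;
  apply: le_trans (H s sab st).
- by rewrite -Re_opp -Re_add nc_geRe.
- by rewrite -Im_opp -Im_add nc_geIm.
Qed.

Lemma continuous_integrable (f : R -> R) a b :
  (forall t, a <= t <= b -> forall e : R, 0 < e -> exists2 r : R, 0 < r &
    forall s, a <= s <= b -> `|s - t| < r -> `|f s - f t| <= e) ->
  mu.-integrable `[a, b] (fun t => (f t)%:E).
Proof.
move=> cf; apply: continuous_compact_integrable;
  [exact: segment_compact|exact: within_continuous_seg].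
Qed.

Lemma cintegrableZ w F a b : cintegrable F a b ->
  cintegrable (fun t => w * F t) a b.
Proof.
move=> [F1 F2]; split.
  have := integrableB (measurable_seg a b)
    (integrableZl (measurable_seg a b) (Re w) F1)
    (integrableZl (measurable_seg a b) (Im w) F2).
  by apply: eq_integrable => // t _; rewrite /= Re_mul.
have := integrableD (measurable_seg a b)
  (integrableZl (measurable_seg a b) (Re w) F2)
  (integrableZl (measurable_seg a b) (Im w) F1).
by apply: eq_integrable => // t _; rewrite /= Im_mul.
Qed.

Lemma cintD F G a b : cintegrable F a b -> cintegrable G a b ->
  cint (fun t => F t + G t) a b = cint F a b + cint G a b.
Proof.
move=> [F1 F2] [G1 G2]; apply: complex_eq; rewrite ?Re_add ?Im_add /=.
  by rewrite -RintegralD//; apply: eq_Rintegral => t _; rewrite Re_add.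
by rewrite -RintegralD//; apply: eq_Rintegral => t _; rewrite Im_add.
Qed.

Lemma cintZ w F a b : cintegrable F a b ->
  cint (fun t => w * F t) a b = w * cint F a b.
Proof.
move=> [F1 F2]; have mi := measurable_seg a b.
have Z v (f : R -> R) : mu.-integrable `[a, b] (fun t => (f t)%:E) ->
  mu.-integrable `[a, b] (fun t => (v * f t)%:E).
  by move=> fi; have := integrableZl mi v fi; apply: eq_integrable.
apply: complex_eq; rewrite ?Re_mul ?Im_mul /=.
  rewrite -!RintegralZl// -RintegralB//; [|exact: Z..].
  by apply: eq_Rintegral => t _; rewrite Re_mul.
rewrite -!RintegralZl// -RintegralD//; [|exact: Z..].
by apply: eq_Rintegral => t _; rewrite Im_mul.
Qed.

Lemma cintB F G a b : cintegrable F a b -> cintegrable G a b ->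
  cint (fun t => F t - G t) a b = cint F a b - cint G a b.
Proof.
move=> Fi Gi; rewrite -[in RHS]mulN1r -cintZ// -cintD//; last exact: cintegrableZ.
by congr cint; apply/funext => t; rewrite mulN1r.
Qed.

Lemma eq_cint F G a b : (forall t, a <= t <= b -> F t = G t) ->
  cint F a b = cint G a b.
Proof.
move=> FG; rewrite /cint; congr Complex; apply: eq_Rintegral => t;
  by rewrite inE/= in_itv/= => /FG ->.
Qed.

Lemma Rintegral_seg_cst a b x : a <= b -> \int[mu]_(t in `[a, b]) x = x * (b - a).
Proof.
move=> ab; rewrite Rintegral_cst//= lebesgue_measure_itv /= lte_fin.
move: ab; rewrite le_eqVlt => /predU1P[->|->]; last by rewrite -EFinB.
by rewrite ltxx subrr.
Qed.

Lemma cint_cst w a b : a <= b -> cint (fun=> w) a b = (b - a)%:C * w.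
Proof.
move=> ab; rewrite /cint !Rintegral_seg_cst//.
by case: w => u v; apply: complex_eq => /=; ring.
Qed.

Lemma subset_seg a b a' b' : a <= a' -> b' <= b -> `[a', b'] `<=` `[a, b].
Proof.
move=> aa bb t /=; rewrite !in_itv/= => /andP[at_ tb].
by rewrite (le_trans aa at_) (le_trans tb bb).
Qed.

Lemma Rintegral_seg_split (f : R -> R) a b x : a <= x <= b ->
  mu.-integrable `[a, b] (fun t => (f t)%:E) ->
  \int[mu]_(t in `[a, b]) f t =
  \int[mu]_(t in `[a, x]) f t + \int[mu]_(t in `[x, b]) f t.
Proof.
move=> /andP[ax xb] fi; apply/eqP; rewrite -subr_eq0 opprD addrA; apply/eqP.
rewrite (@Rintegral_itvB _ _ _ _ x)// ?bnd_simp//.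
rewrite Rintegral_itv_obnd_cbnd ?subrr//.
by apply: integrableS fi => //; apply: subset_itvr; rewrite bnd_simp.
Qed.

Lemma cint_split F a b x : a <= x <= b -> cintegrable F a b ->
  cint F a b = cint F a x + cint F x b.
Proof.
move=> axb [F1 F2]; apply: complex_eq; rewrite ?Re_add ?Im_add/=;
  exact: Rintegral_seg_split.
Qed.

(** Rotating the integral to the positive real axis reduces this to the
    monotonicity of the integral of the real part, so no constant is lost. *)
Lemma cint_le F (g : R -> R) a b : cintegrable F a b ->
  mu.-integrable `[a, b] (fun t => (g t)%:E) ->
  (forall t, a <= t <= b -> nc (F t) <= g t) ->
  nc (cint F a b) <= \int[mu]_(t in `[a, b]) g t.
Proof.
move=> Fi gi Fg.
have [I0|I0] := eqVneq (cint F a b) 0.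
  rewrite I0 nc0; apply: Rintegral_ge0 => t /=; rewrite in_itv/= => /Fg.
  exact: le_trans (nc_ge0 _).
set I := cint F a b in I0 *.
have n0 : nc I != 0 by rewrite nc_eq0.
(* the unimodular factor that makes the integral positive *)
pose w : R[i] := I^-1 * (nc I)%:C.
have nw : nc w = 1 by rewrite ncM ncV ncC ger0_norm ?nc_ge0// mulVf.
have -> : nc I = Re (cint (fun t => w * F t) a b).
  by rewrite cintZ// -/I /w mulrAC mulVf// mul1r.
have [wF _] := cintegrableZ w Fi.
apply: le_Rintegral => // t /=; rewrite in_itv/= => /Fg; apply: le_trans.
by rewrite (le_trans (ler_norm _))// (le_trans (nc_geRe _))// ncM nw mul1r.
Qed.

Lemma cint_le_cst F x a b : a <= b -> cintegrable F a b ->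
  (forall t, a <= t <= b -> nc (F t) <= x) ->
  nc (cint F a b) <= x * (b - a).
Proof.
move=> ab Fi Fx; rewrite -Rintegral_seg_cst//; apply: cint_le => //.
by apply: continuous_integrable => t _ e e0; exists 1 => // s _ _;
  rewrite subrr normr0 ltW.
Qed.

End ComplexIntegral.

(** * Bisection of rectangles *)

Section Sequences.
Variable R : realType.
Implicit Types (lo hi : nat -> R) (x r : R).

(** The common point is the supremum of the left ends. *)
Lemma nested_intervals lo hi : (forall n, lo n <= lo n.+1) ->
  (forall n, hi n.+1 <= hi n) -> (forall n, lo n <= hi n) ->
  exists x, forall n, lo n <= x <= hi n.
Proof.
move=> loS hiS lohi.
have lh m n : lo m <= hi n.
  apply: le_trans ((nondecreasing_seqP lo).1 loS m (maxn m n) (leq_maxl _ _)) _.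
  by apply: le_trans (lohi _) ((nonincreasing_seqP hi).1 hiS _ _ (leq_maxr _ _)).
exists (sup (range lo)) => n; apply/andP; split.
  by apply: ub_le_sup; [exists (hi n) => _ [m _ <-]|exists n].
by apply: ge_sup; [exists (lo n), n|move=> _ [m _ <-]].
Qed.

Lemma exp2_small x r : 0 < r -> exists n, x / 2 ^+ n < r.
Proof.
move=> r0; exists (Num.bound `|x / r|).
rewrite ltr_pdivrMr ?exprn_gt0// mulrC -ltr_pdivrMr//.
apply: le_lt_trans (ler_norm _) _.
apply: lt_le_trans (archi_boundP (normr_ge0 _)) _.
by rewrite -natrX ler_nat ltnW// ltn_expl.
Qed.

End Sequences.

Section Rectangles.
Variable R : realType.
Implicit Types (k : R[i] -> R[i]) (a b c d x y e s t : R) (w z : R[i]).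

(** Bisection as an induction principle: a property of rectangles that passes
    from the four quarters to the whole, and that holds for all small rectangles
    around each point, holds for the whole rectangle.  Otherwise some quarter of
    each bad rectangle is bad, and the rectangles shrink to a point around which
    all small rectangles are good.  It serves for Goursat's theorem, for the mean
    value inequality and for the boundedness of continuous functions on compact
    sets. *)
Lemma rect_bisect (P : R -> R -> R -> R -> Prop) a b c d : a <= b -> c <= d ->
  (forall a' b' c' d', a <= a' -> a' <= b' -> b' <= b ->
     c <= c' -> c' <= d' -> d' <= d ->
     let m := (a' + b') / 2 in let n := (c' + d') / 2 in
     P a' m c' n -> P m b' c' n -> P a' m n d' -> P m b' n d' ->
     P a' b' c' d') ->
  (forall x y, a <= x <= b -> c <= y <= d ->
     exists2 r : R, 0 < r & forall a' b' c' d',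
       a <= a' -> a' <= x <= b' -> b' <= b ->
       c <= c' -> c' <= y <= d' -> d' <= d ->
       b' - a' < r -> d' - c' < r -> P a' b' c' d') ->
  P a b c d.
Proof.
move=> ab cd split4 loc; apply: contrapT => nP0.
pose T := (R * R * R * R)%type.
pose PT (q : T) := P q.1.1.1 q.1.1.2 q.1.2 q.2.
pose sub (q : T) := [/\ a <= q.1.1.1, q.1.1.1 <= q.1.1.2 & q.1.1.2 <= b] /\
  [/\ c <= q.1.2, q.1.2 <= q.2 & q.2 <= d].
pose half (q q' : T) := [/\ q.1.1.1 <= q'.1.1.1, q'.1.1.2 <= q.1.1.2,
    q.1.2 <= q'.1.2 & q'.2 <= q.2] /\
  (q'.1.1.2 - q'.1.1.1 = (q.1.1.2 - q.1.1.1) / 2 /\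
   q'.2 - q'.1.2 = (q.2 - q.1.2) / 2).
have stp q : exists q', sub q -> ~ PT q -> [/\ sub q', ~ PT q' & half q q'].
  have [sq|] := pselect (sub q); last by move=> ?; exists q.
  have [Pq|nPq] := pselect (PT q); first by exists q.
  case: q sq nPq => [[[a' b'] c'] d'] sq; rewrite /PT/= => nPq.
  move: (sq) => [/= [q1 q2 q3] [q4 q5 q6]].
  have := split4 a' b' c' d' q1 q2 q3 q4 q5 q6 => /=.
  set m := (a' + b') / 2; set n := (c' + d') / 2 => S4.
  have [m1 m2 m3] : [/\ a' <= m, m <= b' & m - a' = (b' - a') / 2 /\
     b' - m = (b' - a') / 2] by rewrite /m; split; try split; lra.
  have [n1 n2 n3] : [/\ c' <= n, n <= d' & n - c' = (d' - c') / 2 /\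
     d' - n = (d' - c') / 2] by rewrite /n; split; try split; lra.
  have [p1|p1] := pselect (P a' m c' n); last first.
    exists (a', m, c', n) => _ _.
    by split => //; split => /=; split => //; case: m3 n3 => ? ? []; lra.
  have [p2|p2] := pselect (P m b' c' n); last first.
    exists (m, b', c', n) => _ _.
    by split => //; split => /=; split => //; case: m3 n3 => ? ? []; lra.
  have [p3|p3] := pselect (P a' m n d'); last first.
    exists (a', m, n, d') => _ _.
    by split => //; split => /=; split => //; case: m3 n3 => ? ? []; lra.
  have [p4|p4] := pselect (P m b' n d'); last first.
    exists (m, b', n, d') => _ _.
    by split => //; split => /=; split => //; case: m3 n3 => ? ? []; lra.
  by exfalso; apply: nPq; exact: S4.
have [nxt Hn] := choice stp.
pose q := fun n => iter n nxt (a, b, c, d).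
have q0 : sub (q 0%N) /\ ~ PT (q 0%N) by split.
have qn n : sub (q n) /\ ~ PT (q n).
  by elim: n => [//|n [s1 s2]]; have [] := Hn (q n) s1 s2.
have hf n : half (q n) (q n.+1) by have [s1 s2] := qn n; have [] := Hn (q n) s1 s2.
pose A n := (q n).1.1.1; pose B n := (q n).1.1.2.
pose C n := (q n).1.2; pose D n := (q n).2.
have sz (f : nat -> R) : (forall n, f n.+1 = f n / 2) -> forall n, f n = f 0%N / 2 ^+ n.
  move=> fS; elim=> [|n IH]; first by rewrite expr0 divr1.
  by rewrite fS IH exprS; field; rewrite expf_neq0.
have [x Hx] : exists x, forall n, A n <= x <= B n.
  apply: nested_intervals => n; [by case: (hf n) => -[]|by case: (hf n) => -[]|].
  by case: (qn n) => -[[]].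
have [y Hy] : exists x, forall n, C n <= x <= D n.
  apply: nested_intervals => n; [by case: (hf n) => -[]|by case: (hf n) => -[]|].
  by case: (qn n) => -[_ []].
have [r r0 H] := loc x y (Hx 0%N) (Hy 0%N).
have [n1 Hn1] := exp2_small (b - a) r0; have [n2 Hn2] := exp2_small (d - c) r0.
pose n := maxn n1 n2.
have dec (f : R) n' : 0 <= f -> (n' <= n)%N -> f / 2 ^+ n <= f / 2 ^+ n'.
  by move=> f0 nn; rewrite ler_wpM2l// lef_pV2 ?posrE ?exprn_gt0// ler_weXn2l// ler1n.
have [[[s1 s2 s3] [s4 s5 s6]] nPn] := qn n.
apply: nPn; apply: H => //; try exact: Hx; try exact: Hy.
  rewrite (sz (fun n => B n - A n)) => [|j]; last by case: (hf j) => _ [].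
  by apply: le_lt_trans Hn1; rewrite /B/A/= dec ?subr_ge0// leq_maxl.
rewrite (sz (fun n => D n - C n)) => [|j]; last by case: (hf j) => _ [].
by apply: le_lt_trans Hn2; rewrite /D/C/= dec ?subr_ge0// leq_maxr.
Qed.

End Rectangles.

(** * Goursat's theorem *)

Section Goursat.
Variable R : realType.
Implicit Types (k : R[i] -> R[i]) (a b c d x y e s t : R) (w z : R[i]).

(** The integral of k along the positively oriented boundary of the rectangle
    with sides [a, b] and [c, d]. *)
Definition rect_int k a b c d : R[i] :=
  (cint (fun x => k (x +i* c)) a b - cint (fun x => k (x +i* d)) a b) +
  'i%C * (cint (fun y => k (b +i* y)) c d - cint (fun y => k (a +i* y)) c d).

Definition rect_integrable k a b c d : Prop :=
  [/\ cintegrable (fun x => k (x +i* c)) a b,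
      cintegrable (fun x => k (x +i* d)) a b,
      cintegrable (fun y => k (b +i* y)) c d &
      cintegrable (fun y => k (a +i* y)) c d].

Lemma rect_intB k k' a b c d : rect_integrable k a b c d -> rect_integrable k' a b c d ->
  rect_int (fun z => k z - k' z) a b c d = rect_int k a b c d - rect_int k' a b c d.
Proof. by move=> [? ? ? ?] [? ? ? ?]; rewrite /rect_int !cintB//; ring. Qed.

Lemma rect_intZ w k a b c d : rect_integrable k a b c d ->
  rect_int (fun z => w * k z) a b c d = w * rect_int k a b c d.
Proof. by move=> [? ? ? ?]; rewrite /rect_int !cintZ//; ring. Qed.

(** The two copies of the inner side cancel formally, whatever the values of k
    on it. *)
Lemma rect_int_splitx k a b c d x : a <= x <= b ->
  cintegrable (fun x => k (x +i* c)) a b ->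
  cintegrable (fun x => k (x +i* d)) a b ->
  rect_int k a b c d = rect_int k a x c d + rect_int k x b c d.
Proof.
by move=> axb k1 k2; rewrite /rect_int (cint_split axb k1) (cint_split axb k2); ring.
Qed.

Lemma rect_int_splity k a b c d y : c <= y <= d ->
  cintegrable (fun y => k (b +i* y)) c d ->
  cintegrable (fun y => k (a +i* y)) c d ->
  rect_int k a b c d = rect_int k a b c y + rect_int k a b y d.
Proof.
by move=> cyd k1 k2; rewrite /rect_int (cint_split cyd k1) (cint_split cyd k2); ring.
Qed.

Lemma nc_i : nc ('i%C : R[i]) = 1.
Proof. by rewrite /= expr0n expr1n add0r sqrtr1. Qed.

Lemma rect_int_le k a b c d e : a <= b -> c <= d -> rect_integrable k a b c d ->
  (forall x y, a <= x <= b -> c <= y <= d ->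
     (x = a \/ x = b) \/ (y = c \/ y = d) -> nc (k (x +i* y)) <= e) ->
  nc (rect_int k a b c d) <= e * (2 * ((b - a) + (d - c))).
Proof.
move=> ab cd [k1 k2 k3 k4] ke.
have H1 : nc (cint (fun x => k (x +i* c)) a b) <= e * (b - a).
  by apply: cint_le_cst => // t tab; apply: ke => //; rewrite ?lexx ?cd//; right; left.
have H2 : nc (cint (fun x => k (x +i* d)) a b) <= e * (b - a).
  by apply: cint_le_cst => // t tab; apply: ke => //; rewrite ?lexx ?cd//; right; right.
have H3 : nc (cint (fun y => k (b +i* y)) c d) <= e * (d - c).
  by apply: cint_le_cst => // t tab; apply: ke => //; rewrite ?lexx ?ab//; left; right.
have H4 : nc (cint (fun y => k (a +i* y)) c d) <= e * (d - c).
  by apply: cint_le_cst => // t tab; apply: ke => //; rewrite ?lexx ?ab//; left; left.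
rewrite /rect_int (le_trans (ncD _ _))// ncM nc_i mul1r.
have -> : e * (2 * (b - a + (d - c))) = (e * (b - a) + e * (b - a)) + (e * (d - c) + e * (d - c)).
  by ring.
by apply: lerD; rewrite (le_trans (ncBle _ _))// lerD.
Qed.

Lemma ccont_seg_x k a b c : (forall x, a <= x <= b -> ccont k (x +i* c)) ->
  seg_continuous (fun x => k (x +i* c)) a b.
Proof.
move=> kc t tab e e0; have [r r0 H] := kc t tab e e0; exists r => // s _ st.
have -> : s +i* c = t +i* c + (s - t)%:C.
  by apply: complex_eq; rewrite /= ?addr0// addrC subrK.
by apply: H; rewrite ncC.
Qed.

Lemma ccont_seg_y k a c d : (forall y, c <= y <= d -> ccont k (a +i* y)) ->
  seg_continuous (fun y => k (a +i* y)) c d.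
Proof.
move=> kc t tab e e0; have [r r0 H] := kc t tab e e0; exists r => // s _ st.
have -> : a +i* s = a +i* t + 'i%C * (s - t)%:C.
  by apply: complex_eq; rewrite /= ?mul0r ?mulr0 ?subr0 ?mul1r ?addr0 ?add0r// addrC subrK.
by apply: H; rewrite ncM nc_i mul1r ncC.
Qed.

Lemma ccont_rect_integrable k a b c d : a <= b -> c <= d ->
  (forall x y, a <= x <= b -> c <= y <= d ->
     (x = a \/ x = b) \/ (y = c \/ y = d) ->
     ccont k (x +i* y)) -> rect_integrable k a b c d.
Proof.
move=> ab cd kD; split; apply: seg_continuous_integrable;
  [apply: ccont_seg_x|apply: ccont_seg_x|apply: ccont_seg_y|apply: ccont_seg_y];
  move=> t tab; apply: kD; rewrite ?lexx ?ab ?cd//.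
- by right; left.
- by right; right.
- by left; right.
- by left; left.
Qed.

Lemma is_cder_rect_integrable k a b c d : a <= b -> c <= d ->
  (forall x y, a <= x <= b -> c <= y <= d ->
     (x = a \/ x = b) \/ (y = c \/ y = d) ->
     exists D, is_cder k (x +i* y) D) -> rect_integrable k a b c d.
Proof.
move=> ab cd kD; apply: ccont_rect_integrable => // x y xab ycd xy.
by have [D /is_cder_cont] := kD x y xab ycd xy.
Qed.

(** On opposite sides an affine function differs by a constant, and the two
    resulting contributions cancel. *)
Lemma rect_int_affine w w' a b c d : a <= b -> c <= d ->
  rect_int (fun z => w + w' * z) a b c d = 0.
Proof.
move=> ab cd; have [i1 i2 i3 i4] : rect_integrable (fun z => w + w' * z) a b c d.
  apply: is_cder_rect_integrable => // x y _ _ _; exists (0 + w' * 1).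
  by apply: is_cderD; [exact: is_cder_cst|apply: is_cderZ; exact: is_cder_id].
rewrite /rect_int -!cintB//.
rewrite (@eq_cint _ _ (fun=> w' * 'i%C * (c - d)%:C)); last first.
  by move=> t _; apply: complex_eq; rewrite !(Re_add,Im_add,Re_opp,Im_opp,Re_mul,Im_mul)/=; ring.
rewrite [X in 'i%C * X](@eq_cint _ _ (fun=> w' * (b - a)%:C)); last first.
  by move=> t _; apply: complex_eq; rewrite !(Re_add,Im_add,Re_opp,Im_opp,Re_mul,Im_mul)/=; ring.
by rewrite !cint_cst// -(opprB d c) rmorphN; ring.
Qed.

(** By bisection it suffices to bound the integral over each small rectangle
    by e times the squared sum of its sides, a bound that is additive enough to
    pass from quarters to the whole.  Near a point, k is affine up to an error
    e/2 |h|, and affine functions integrate to 0. *)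
Lemma goursat k a b c d : a <= b -> c <= d ->
  (forall x y, a <= x <= b -> c <= y <= d -> exists D, is_cder k (x +i* y) D) ->
  rect_int k a b c d = 0.
Proof.
move=> ab cd kD.
have ki a' b' c' d' : a <= a' -> a' <= b' -> b' <= b -> c <= c' -> c' <= d' -> d' <= d ->
    rect_integrable k a' b' c' d'.
  move=> h1 h2 h3 h4 h5 h6; apply: is_cder_rect_integrable => // x y xab ycd _; apply: kD; lra.
suff H e : 0 < e -> nc (rect_int k a b c d) <= e * ((b - a) + (d - c)) ^+ 2.
  apply/eqP; rewrite -nc_eq0; apply/negPn/negP => n0.
  have {}n0 : 0 < nc (rect_int k a b c d) by rewrite lt_def n0 nc_ge0.
  set s := ((b - a) + (d - c)) ^+ 2 in H.
  have s0 : 0 <= s by exact: sqr_ge0.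
  have := H (nc (rect_int k a b c d) / 2 / (s + 1)) (divr_gt0 (divr_gt0 n0 (ltr0n R 2)) (ltr_pwDr ltr01 s0)).
  rewrite leNgt => /negP; apply; rewrite mulrAC ltr_pdivrMr ?ltr_pwDr//.
  by rewrite mulrDr mulr1; nra.
move=> e0; apply: (rect_bisect (P := fun a b c d => nc (rect_int k a b c d) <= e * ((b - a) + (d - c)) ^+ 2)) => //.
  move=> a' b' c' d' h1 h2 h3 h4 h5 h6 m n P1 P2 P3 P4.
  have [am mb] : a' <= m /\ m <= b' by rewrite /m; lra.
  have [cn nd] : c' <= n /\ n <= d' by rewrite /n; lra.
  have hmb : m <= b by lra.
  have hnd : n <= d by lra.
  have ham : a <= m by lra.
  have hcn : c <= n by lra.
  have [i1 i2 i3 i4] := ki a' b' c' d' h1 h2 h3 h4 h5 h6.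
  have [j1 j2 j3 j4] := ki a' m c' d' h1 am hmb h4 h5 h6.
  have [l1 l2 l3 l4] := ki m b' c' d' ham mb h3 h4 h5 h6.
  rewrite (@rect_int_splitx _ a' b' _ _ m)// ?am//.
  rewrite (@rect_int_splity _ a' m _ _ n)// ?cn// (@rect_int_splity _ m b' _ _ n)// ?cn//.
  apply: le_trans (ncD _ _) _.
  apply: le_trans (lerD (ncD _ _) (ncD _ _)) _.
  apply: le_trans (lerD (lerD P1 P3) (lerD P2 P4)) _.
  by rewrite le_eqVlt; apply/orP; left; apply/eqP; rewrite /m /n; field.
move=> x y xab ycd; have [D HD] := kD x y xab ycd.
have [r r0 H] := HD _ (divr_gt0 e0 (ltr0n R 2)).
exists (r / 2); first by rewrite divr_gt0.
move=> a' b' c' d' h1 /andP[h2 h2'] h3 h4 /andP[h5 h5'] h6 br dr.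
have ab' : a' <= b' by lra.
have cd' : c' <= d' by lra.
pose z := x +i* y.
pose l := fun w => (k z - D * z) + D * w.
have li : rect_integrable l a' b' c' d'.
  apply: is_cder_rect_integrable => // u v _ _ _; exists (0 + D * 1).
  by apply: is_cderD; [exact: is_cder_cst|apply: is_cderZ; exact: is_cder_id].
have kii : rect_integrable k a' b' c' d' by apply: ki.
have -> : rect_int k a' b' c' d' = rect_int (fun w => k w - l w) a' b' c' d'.
  by rewrite rect_intB// /l rect_int_affine// subr0.
have -> : e * (b' - a' + (d' - c')) ^+ 2 =
  (e / 2 * (b' - a' + (d' - c'))) * (2 * (b' - a' + (d' - c'))) by field.
have kl : rect_integrable (fun w => k w - l w) a' b' c' d'.
  apply: is_cder_rect_integrable => // u v uab vcd _.
  have uab' : a <= u <= b by lra.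
  have vcd' : c <= v <= d by lra.
  have [D' HD'] := kD u v uab' vcd'.
  exists (D' - (0 + D * 1)); apply: is_cderB => //.
  by apply: is_cderD; [exact: is_cder_cst|apply: is_cderZ; exact: is_cder_id].
apply: rect_int_le => // u v uab vcd _.
pose h : R[i] := (u - x) +i* (v - y).
have hh : nc h <= b' - a' + (d' - c').
  rewrite (le_trans (nc_leReIm _))//=; apply: lerD; rewrite ler_norml; lra.
have -> : u +i* v = z + h by apply: complex_eq => /=; rewrite addrC subrK.
have -> : k (z + h) - l (z + h) = k (z + h) - k z - D * h by rewrite /l; ring.
apply: le_trans (H _ _) _; first by lra.
by rewrite ler_wpM2l// divr_ge0// ltW.
Qed.

End Goursat.

(** * Cauchy's formula on rectangles *)

Section Puncture.
Variable R : realType.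
Implicit Types (k f g : R[i] -> R[i]) (a b c d x y e s t : R) (w z h : R[i]).

(** Four rectangles free of the puncture are cut off by Goursat's theorem,
    which leaves a square of half side t around it.  There |k| is at most e/t on
    a contour of length 8t, so the integral is arbitrarily small. *)
Lemma rect_int_puncture k a b c d x y : a < x < b -> c < y < d ->
  (forall u v, a <= u <= b -> c <= v <= d -> (u, v) <> (x, y) ->
     exists D, is_cder k (u +i* v) D) ->
  (forall e, 0 < e -> exists2 r : R, 0 < r & forall h, 0 < nc h < r ->
     nc h * nc (k (x +i* y + h)) <= e) ->
  rect_int k a b c d = 0.
Proof.
move=> /andP[ax xb] /andP[cy yd] kD ksing.
have ki a' b' c' d' : a <= a' -> a' <= b' -> b' <= b -> c <= c' -> c' <= d' -> d' <= d ->
    a' != x -> b' != x -> c' != y -> d' != y ->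
    rect_integrable k a' b' c' d'.
  move=> h1 h2 h3 h4 h5 h6 /eqP h7 /eqP h8 /eqP h9 /eqP h10.
  apply: is_cder_rect_integrable => // u v uab vcd uv; apply: kD; [lra|lra|].
  by case=> ? ?; subst u v; case: uv => [[]|[]] /esym.
have gour a' b' c' d' : a <= a' -> a' <= b' -> b' <= b -> c <= c' -> c' <= d' -> d' <= d ->
    (x < a' \/ b' < x) \/ (y < c' \/ d' < y) -> rect_int k a' b' c' d' = 0.
  move=> h1 h2 h3 h4 h5 h6 h7; apply: goursat => // u v uab vcd; apply: kD; [lra|lra|].
  by case=> ? ?; subst u v; lra.
suff H e : 0 < e -> nc (rect_int k a b c d) <= e.
  apply/eqP; rewrite -nc_eq0; apply/negPn/negP => n0.
  have {}n0 : 0 < nc (rect_int k a b c d) by rewrite lt_def n0 nc_ge0.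
  by have := H _ (divr_gt0 n0 (ltr0n R 2)); lra.
move=> e0.
(* the inner contour has length 8 t and |h| is at least t on it *)
have [r r0 Hr] := ksing _ (divr_gt0 e0 (ltr0n R 8)).
pose m := Num.min (Num.min (x - a) (b - x)) (Num.min (y - c) (d - y)).
pose t := Num.min (m / 2) (r / 3).
have m0 : 0 < m by rewrite !lt_min !subr_gt0 ax xb cy yd.
have t0 : 0 < t by rewrite lt_min !divr_gt0.
have [m1 m2 m3 m4] : [/\ m <= x - a, m <= b - x, m <= y - c & m <= d - y].
  by split; rewrite /m !ge_min lexx ?orbT.
have [t1 t2] : t <= m / 2 /\ t <= r / 3 by split; rewrite /t ge_min lexx ?orbT.
have nx1 : x - t != x by apply/eqP; lra.
have nx2 : x + t != x by apply/eqP; lra.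
have ny1 : y - t != y by apply/eqP; lra.
have ny2 : y + t != y by apply/eqP; lra.
have na : a != x by apply/eqP; lra.
have nb : b != x by apply/eqP; lra.
have ncc : c != y by apply/eqP; lra.
have nd : d != y by apply/eqP; lra.
have O1 : a <= x - t by lra.
have O2 : x - t <= x + t by lra.
have O3 : x + t <= b by lra.
have O4 : c <= y - t by lra.
have O5 : y - t <= y + t by lra.
have O6 : y + t <= d by lra.
have O7 : a <= b by lra.
have O8 : c <= d by lra.
have O9 : x - t <= b by lra.
have O10 : y - t <= d by lra.
have O11 : a <= x + t by lra.
have O12 : c <= y + t by lra.
have S1 : a <= x - t <= b by rewrite O1 O9.
have S2 : x - t <= x + t <= b by rewrite O2 O3.
have S3 : c <= y - t <= d by rewrite O4 O10.
have S4 : y - t <= y + t <= d by rewrite O5 O6.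
have [i1 i2 i3 i4] := ki a b c d (lexx _) O7 (lexx _) (lexx _) O8 (lexx _) na nb ncc nd.
have [j1 j2 j3 j4] := ki (x - t) b c d O1 O9 (lexx _) (lexx _) O8 (lexx _) nx1 nb ncc nd.
have [l1 l2 l3 l4] := ki (x - t) (x + t) c d O1 O2 O3 (lexx _) O8 (lexx _) nx1 nx2 ncc nd.
have [p1 p2 p3 p4] := ki (x - t) (x + t) (y - t) d O1 O2 O3 O4 O10 (lexx _) nx1 nx2 ny1 nd.
have I := ki (x - t) (x + t) (y - t) (y + t) O1 O2 O3 O4 O5 O6 nx1 nx2 ny1 ny2.
rewrite (@rect_int_splitx _ k _ _ _ _ _ S1 i1 i2) (@rect_int_splitx _ k _ _ _ _ _ S2 j1 j2).
rewrite (@rect_int_splity _ k _ _ _ _ _ S3 l3 l4) (@rect_int_splity _ k _ _ _ _ _ S4 p3 p4).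
rewrite (gour a (x - t))//; last by lra.
rewrite (gour (x + t) b)//; last by lra.
rewrite (gour _ _ c (y - t))//; last by lra.
rewrite (gour _ _ (y + t) d)//; last by lra.
rewrite !(add0r, addr0).
have -> : e = e / 8 / t * (2 * ((x + t - (x - t)) + (y + t - (y - t)))).
  by field; lra.
apply: rect_int_le => // u v uab vcd uv.
pose h : R[i] := (u - x) +i* (v - y).
have hE : u +i* v = x +i* y + h by apply: complex_eq => /=; rewrite addrC subrK.
have h2 : nc h <= 2 * t.
  by rewrite (le_trans (nc_leReIm _))//= mulr_natl mulr2n; apply: lerD; rewrite ler_norml; lra.
have h1 : t <= nc h.
  case: uv => uv.
    by rewrite (le_trans _ (nc_geRe _))//= ler_normr; apply/orP; lra.
  by rewrite (le_trans _ (nc_geIm _))//= ler_normr; apply/orP; lra.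
have := Hr h ltac:(lra); rewrite -hE => H.
rewrite ler_pdivlMr// mulrC; apply: le_trans H.
by rewrite ler_wpM2r ?nc_ge0.
Qed.

Lemma is_cder_shift f w z D : is_cder f (w + z) D ->
  is_cder (fun p => f (w + p)) z D.
Proof.
move=> fD; rewrite -(mulr1 D); apply: (is_cder_comp (f := f)) => //.
rewrite -[X in is_cder _ _ X]add0r; apply: is_cderD; first exact: is_cder_cst.
exact: is_cder_id.
Qed.

Lemma is_cder_subid w z : is_cder (fun p => p - w) z 1.
Proof.
rewrite -[X in is_cder _ _ X]subr0; apply: is_cderB; first exact: is_cder_id.
exact: is_cder_cst.
Qed.

Lemma is_cder_inv w z : z != w -> exists D, is_cder (fun p => (p - w)^-1) z D.
Proof.
move=> zw; exists (- 1 / (z - w) ^+ 2); apply: (is_cderV (f := fun p => p - w)).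
  by rewrite subr_eq0.
exact: is_cder_subid.
Qed.

Lemma neq_complex x y u v : (u, v) <> (x, y) -> u +i* v != x +i* y :> R[i].
Proof. by move=> uv; apply/eqP => -[? ?]; subst; exact: uv. Qed.

Lemma inv_rect_integrable a b c d x y : a < x < b -> c < y < d ->
  rect_integrable (fun z => (z - x +i* y)^-1) a b c d.
Proof.
move=> xab ycd; apply: is_cder_rect_integrable; [lra|lra|] => u v uab vcd uv.
by apply: is_cder_inv; apply: neq_complex => -[? ?]; subst; lra.
Qed.

(** The quotient (g(z) - g(w)) / (z - w) stays bounded near w, so the puncture
    theorem applies to it. *)
Lemma cauchy_rect g a b c d x y : a < x < b -> c < y < d ->
  (forall u v, a <= u <= b -> c <= v <= d -> exists D, is_cder g (u +i* v) D) ->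
  rect_int (fun z => g z * (z - x +i* y)^-1) a b c d =
  g (x +i* y) * rect_int (fun z => (z - x +i* y)^-1) a b c d.
Proof.
move=> xab ycd gD; set w := x +i* y.
have wi := inv_rect_integrable xab ycd.
have gi : rect_integrable (fun z => g z * (z - w)^-1) a b c d.
  apply: is_cder_rect_integrable; [lra|lra|] => u v uab vcd uv.
  have [D HD] := gD u v uab vcd.
  have [|D' HD'] := @is_cder_inv w (u +i* v).
    by apply: neq_complex => -[? ?]; subst; lra.
  by eexists; exact: is_cderM HD HD'.
have cwi : rect_integrable (fun z => g w * (z - w)^-1) a b c d.
  by case: wi => ? ? ? ?; split; exact: cintegrableZ.
apply/eqP; rewrite -subr_eq0 -rect_intZ// -rect_intB//; apply/eqP.
apply: (rect_int_puncture xab ycd).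
  move=> u v uab vcd uv.
  have [D HD] := gD u v uab vcd.
  have [|D' HD'] := @is_cder_inv w (u +i* v); first exact: neq_complex.
  by eexists; apply: is_cderB; [exact: is_cderM HD HD'|exact: is_cderZ HD'].
move=> e e0; have [D HD] := gD x y ltac:(lra) ltac:(lra).
have [r r0 H] := is_cder_cont HD e0; exists r => // h /andP[h0 hr].
rewrite -/w -mulrBl (addrC w h) addrK (addrC h w) ncM ncV mulrC mulfVK ?gt_eqF//.
exact: H.
Qed.

(** The function (f(z) - f(0) - D z) / z^2 is o(1/|z|) at 0, so the puncture
    theorem applies.  Keeping the difference f(z) - f(0) in the numerator avoids
    computing the integral of 1/z^2. *)
Lemma cauchy_deriv f s D : 0 < s ->
  (forall u v, - s <= u <= s -> - s <= v <= s -> exists D, is_cder f (u +i* v) D) ->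
  is_cder f 0 D ->
  rect_int (fun z => (f z - f 0) * (z^-1 * z^-1)) (- s) s (- s) s =
  D * rect_int (fun z => z^-1) (- s) s (- s) s.
Proof.
move=> s0 fD f0.
have s00 : - s < 0 < s by lra.
have zi u v : (u, v) <> (0, 0) -> exists D', is_cder (fun z : R[i] => z^-1) (u +i* v) D'.
  move=> /neq_complex /is_cder_inv [D' HD']; exists D'.
  by congr (is_cder _ _ _): HD'; apply/funext => z; rewrite subr0.
have fi u v : - s <= u <= s -> - s <= v <= s -> (u, v) <> (0, 0) ->
    exists D', is_cder (fun z => (f z - f 0) * (z^-1 * z^-1)) (u +i* v) D'.
  move=> uab vcd uv; have [D1 HD1] := fD u v uab vcd.
  have [D2 HD2] := zi _ _ uv; eexists.
  by apply: is_cderM (is_cderM HD2 HD2); apply: is_cderB HD1 (is_cder_cst _ _).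
have bd u v : - s <= u <= s -> - s <= v <= s ->
    (u = - s \/ u = s) \/ (v = - s \/ v = s) -> (u, v) <> (0, 0).
  by move=> _ _ uv [? ?]; subst; lra.
have I1 : rect_integrable (fun z : R[i] => z^-1) (- s) s (- s) s.
  by apply: is_cder_rect_integrable; [lra|lra|] => u v h1 h2 h3; apply: zi; exact: bd h3.
have I2 : rect_integrable (fun z => (f z - f 0) * (z^-1 * z^-1)) (- s) s (- s) s.
  by apply: is_cder_rect_integrable; [lra|lra|] => u v h1 h2 h3; apply: fi => //; exact: bd h3.
have I3 : rect_integrable (fun z => D * z^-1) (- s) s (- s) s.
  by case: I1 => ? ? ? ?; split; exact: cintegrableZ.
apply/eqP; rewrite -subr_eq0 -rect_intZ// -rect_intB//; apply/eqP.
apply: (rect_int_puncture s00 s00).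
  move=> u v h1 h2 h3; have [D1 HD1] := fi u v h1 h2 h3.
  have [D2 HD2] := zi _ _ h3.
  by eexists; apply: is_cderB HD1 _; exact: is_cderZ HD2.
move=> e e0; have [r r0 H] := f0 e e0; exists r => // h /andP[h0 hr].
have -> : (0 +i* 0 : R[i]) = 0 by [].
have hn0 : h != 0 by rewrite -nc_gt0.
have := H h hr; rewrite add0r => {}H.
have -> : (f h - f 0) * (h^-1 * h^-1) - D * h^-1 = (f h - f 0 - D * h) * (h^-1 * h^-1).
  by field.
rewrite !ncM ncV.
have -> : nc h * (nc (f h - f 0 - D * h) * ((nc h)^-1 * (nc h)^-1)) = nc (f h - f 0 - D * h) / nc h.
  by field; rewrite gt_eqF.
by rewrite ler_pdivrMr.
Qed.

End Puncture.

Section Winding.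
Variable R : realType.
Implicit Types (k f g : R[i] -> R[i]) (a b c d x y e s t : R) (w z h : R[i]).

(** All four sides contribute nonnegatively to the imaginary part, and the right
    side alone contributes at least the integral of 1/(4e) over a length at
    least e.  This replaces the exact value 2 pi i. *)
Lemma winding_ge a b c d x y e : 0 < e ->
  a <= x - e / 2 -> x + e / 2 <= b <= x + e ->
  y - e <= c <= y - e / 2 -> y + e / 2 <= d <= y + e ->
  4^-1 <= nc (rect_int (fun z => (z - x +i* y)^-1) a b c d).
Proof.
move=> e0 ax xb yc yd.
have xab : a < x < b by lra.
have ycd : c < y < d by lra.
have [[i1 j1] [i2 j2] [i3 j3] [i4 j4]] := inv_rect_integrable xab ycd.
apply: (le_trans _ (nc_geIm _)); apply: (le_trans _ (ler_norm _)).
pose IB := \int[lebesgue_measure]_(t in `[a, b]) Im ((t +i* c - x +i* y)^-1).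
pose IT := \int[lebesgue_measure]_(t in `[a, b]) Im ((t +i* d - x +i* y)^-1).
pose RR := \int[lebesgue_measure]_(t in `[c, d]) Re ((b +i* t - x +i* y)^-1).
pose RL := \int[lebesgue_measure]_(t in `[c, d]) Re ((a +i* t - x +i* y)^-1).
have -> : Im (rect_int (fun z => (z - x +i* y)^-1) a b c d) = (IB - IT) + (RR - RL).
  by rewrite /rect_int !(Im_add, Im_opp, Im_mul, Re_add, Re_opp) /= mul0r mul1r add0r.
have invE (u v : R) : (u +i* v - x +i* y)^-1 =
  ((u - x) / ((u - x) ^+ 2 + (v - y) ^+ 2)) +i* (- (v - y) / ((u - x) ^+ 2 + (v - y) ^+ 2)) :> R[i].
  by apply: complex_eq => //=; rewrite mulNr.
have den (u v : R) : 0 <= (u - x) ^+ 2 + (v - y) ^+ 2 by rewrite addr_ge0 ?sqr_ge0.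
have B1 : 0 <= IB.
  apply: Rintegral_ge0 => t _; rewrite invE/=; apply: divr_ge0 => //; lra.
have B2 : IT <= 0.
  rewrite -(mul0r (b - a)) -Rintegral_seg_cst; last lra.
  apply: le_Rintegral => //.
    by apply: continuous_integrable => t _ r r0; exists 1 => // ? _ _; rewrite subrr normr0 ltW.
  move=> t _; rewrite invE/= mulNr oppr_le0; apply: divr_ge0 => //; lra.
have B3 : 4^-1 <= RR.
  apply: (@le_trans _ _ ((4 * e)^-1 * (d - c))).
    rewrite invfM -mulrA -[X in X <= _]mulr1 ler_wpM2l ?invr_ge0//.
    by rewrite mulrC ler_pdivlMr// mul1r; lra.
  rewrite -Rintegral_seg_cst; last lra.
  apply: le_Rintegral => //.
    by apply: continuous_integrable => t _ r r0; exists 1 => // ? _ _; rewrite subrr normr0 ltW.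
  move=> t; rewrite invE /= in_itv/= => tcd.
  have bx0 : 0 < b - x by lra.
  rewrite ler_pdivlMr ?ltr_pwDl ?exprn_gt0 ?sqr_ge0//.
  rewrite mulrC ler_pdivrMr ?mulr_gt0//.
  have b1 : (b - x) ^+ 2 <= e ^+ 2 by rewrite !expr2; apply: ler_pM; lra.
  have b2 : (t - y) ^+ 2 <= e ^+ 2.
    rewrite -(real_normK (num_real (t - y))) !expr2.
    by apply: ler_pM => //; rewrite ler_norml; lra.
  have b3 : e / 2 <= b - x by lra.
  rewrite !expr2 in b1 b2 *; nra.
have B4 : RL <= 0.
  rewrite -(mul0r (d - c)) -Rintegral_seg_cst; last lra.
  apply: le_Rintegral => //.
    by apply: continuous_integrable => t _ r r0; exists 1 => // ? _ _; rewrite subrr normr0 ltW.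
  move=> t _; rewrite invE/= -oppr_ge0 -mulNr; apply: divr_ge0 => //; lra.
clear -B1 B2 B3 B4; move: B1 B2 B3 B4; move: IB IT RR RL => p q r u; lra.
Qed.

End Winding.

(** * Cauchy estimates *)

Section CauchyEstimates.
Variable R : realType.
Implicit Types (k f g : R[i] -> R[i]) (a b c d x y e r s t u v : R) (w z h D : R[i]).

Lemma hol_is_cder f z : holomorphic_on_disc f -> nc z < 1 -> is_cder f z (cderiv f z).
Proof. by move=> hf z1; apply: derivable_is_cder; exact: hf. Qed.

Lemma holomorphic_of_is_cder f : (forall z, nc z < 1 -> exists D, is_cder f z D) ->
  holomorphic_on_disc f.
Proof. by move=> H z z1; have [D /is_cder_derivable] := H z z1. Qed.

Lemma nc_segment w h e t : nc w <= e -> nc (w + h) <= e -> 0 <= t <= 1 ->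
  nc (w + t%:C * h) <= e.
Proof.
move=> we he /andP[t0 t1].
have -> : w + t%:C * h = (1 - t)%:C * w + t%:C * (w + h).
  by rewrite rmorphB/=; ring.
rewrite (le_trans (ncD _ _))// !ncM !ncC !ger0_norm ?subr_ge0//.
have -> : e = (1 - t) * e + t * e by ring.
by apply: lerD; rewrite ler_wpM2l ?subr_ge0.
Qed.

(** By bisection of the parameter interval: the bound is additive in the
    interval, and it holds locally with x + e in place of x.  The rectangles of
    [rect_bisect] are used with their second side reduced to a point. *)
Lemma mean_value_le f w h x : (forall t, 0 <= t <= 1 ->
    exists2 D, is_cder f (w + t%:C * h) D & nc D <= x) ->
  nc (f (w + h) - f w) <= x * nc h.
Proof.
move=> fD.
suff H e : 0 < e -> nc (f (w + h) - f w) <= (x + e) * nc h.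
  have [->|h0] := eqVneq h 0; first by rewrite addr0 subrr nc0 mulr0.
  have {}h0 : 0 < nc h by rewrite nc_gt0.
  rewrite leNgt; apply/negP => lt.
  pose q := (nc (f (w + h) - f w) - x * nc h) / 2 / nc h.
  have q0 : 0 < q by rewrite !divr_gt0// subr_gt0.
  have := H q q0; rewrite mulrDl /q divfK ?gt_eqF//.
  by move: lt; clear; move: (nc (f (w + h) - f w)) (x * nc h) => p q; lra.
move=> e0.
pose P a b (c d : R) := nc (f (w + b%:C * h) - f (w + a%:C * h)) <= (x + e) * (b - a) * nc h.
have : P 0 1 0 0.
  apply: (rect_bisect (P := P)) => //.
    move=> a b c d h1 h2 h3 h4 h5 h6 m n; rewrite /P => P1 P2 _ _.
    have -> : f (w + b%:C * h) - f (w + a%:C * h) =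
      (f (w + b%:C * h) - f (w + m%:C * h)) + (f (w + m%:C * h) - f (w + a%:C * h)) by ring.
    rewrite (le_trans (ncD _ _))//; apply: le_trans (lerD P2 P1) _.
    by rewrite le_eqVlt; apply/orP; left; apply/eqP; ring.
  move=> t y t01 _; have [D HD Dx] := fD t t01.
  have [r r0 H] := HD _ e0.
  have n1 : 0 < nc h + 1 by rewrite ltr_wpDl ?nc_ge0.
  exists (r / (nc h + 1)); first by rewrite divr_gt0.
  move=> a b c d h1 /andP[h2 h2'] h3 _ _ _; rewrite ltr_pdivlMr// => ba _.
  have Q u : a <= u <= b -> nc (f (w + u%:C * h) - f (w + t%:C * h)) <= (x + e) * `|u - t| * nc h.
    move=> uab.
    have uE : w + u%:C * h = (w + t%:C * h) + (u - t)%:C * h by rewrite rmorphB/=; ring.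
    have ut : `|u - t| <= b - a by rewrite ler_norml; lra.
    have nh : nc ((u - t)%:C * h) < r.
      rewrite ncM ncC (le_lt_trans _ ba)//.
      by apply: ler_pM; rewrite ?nc_ge0 ?lerDl.
    have := H _ nh; rewrite -uE => {}H.
    rewrite -[X in nc X](subrK (D * ((u - t)%:C * h))) (le_trans (ncD _ _))//.
    rewrite (ncM D) ncM ncC in H *.
    have := ler_wpM2r (mulr_ge0 (normr_ge0 (u - t)) (nc_ge0 h)) Dx.
    by rewrite mulrDl mulrDl -!mulrA; lra.
  rewrite /P.
  have -> : f (w + b%:C * h) - f (w + a%:C * h) =
    (f (w + b%:C * h) - f (w + t%:C * h)) - (f (w + a%:C * h) - f (w + t%:C * h)) by ring.
  rewrite (le_trans (ncBle _ _))//.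
  have Qb := Q b ltac:(lra); have Qa := Q a ltac:(lra).
  apply: le_trans (lerD Qb Qa) _.
  rewrite ger0_norm ?subr_ge0// distrC ger0_norm ?subr_ge0//.
  by rewrite le_eqVlt; apply/orP; left; apply/eqP; ring.
by rewrite /P subr0 mulr1 mul1r mul0r addr0.
Qed.

(** Bisection of the square [-1, 1]^2; near a point outside the open disc no
    point of the smaller closed disc is met. *)
Lemma hol_bounded f r : holomorphic_on_disc f -> r < 1 ->
  exists x, forall z, nc z <= r -> nc (f z) <= x.
Proof.
move=> hf r1.
pose P a b c d := exists x, forall u v, a <= u <= b -> c <= v <= d ->
  nc (u +i* v) <= r -> nc (f (u +i* v)) <= x.
have [x Hx] : P (-1) 1 (-1) 1.
  apply: (rect_bisect (P := P)); [lra|lra|..].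
    move=> a b c d h1 h2 h3 h4 h5 h6 m n [x1 X1] [x2 X2] [x3 X3] [x4 X4].
    exists (Num.max (Num.max x1 x2) (Num.max x3 x4)) => u v /andP[au ub] /andP[cv vd] uvr.
    rewrite !le_max; case: (leP u m) => um; case: (leP v n) => vn.
    - by rewrite X1 ?au ?um ?cv ?vn.
    - by rewrite X3 ?au ?um ?(ltW vn) ?vd ?orbT.
    - by rewrite X2 ?(ltW um) ?ub ?cv ?vn ?orbT.
    - by rewrite X4 ?(ltW um) ?ub ?(ltW vn) ?vd ?orbT.
  move=> x y _ _; have [xyr|xyr] := ltP (nc (x +i* y)) 1.
    have [e e0 H] := is_cder_cont (hol_is_cder hf xyr) ltr01.
    exists (e / 2); first by rewrite divr_gt0.
    move=> a b c d _ xab _ _ ycd _ ba dc; exists (nc (f (x +i* y)) + 1) => u v uab vcd _.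
    pose h : R[i] := (u - x) +i* (v - y).
    have hE : u +i* v = x +i* y + h by apply: complex_eq => /=; rewrite addrC subrK.
    have he : nc h < e.
      rewrite (le_lt_trans (nc_leReIm _))//= [X in _ < X](splitr e); apply: ltrD;
        rewrite ltr_norml; lra.
    have := H h he; rewrite -hE => {}H.
    by rewrite -[X in nc X <= _](subrK (f (x +i* y))) (le_trans (ncD _ _))// addrC lerD2l.
  exists ((1 - r) / 2); first by rewrite divr_gt0 ?subr_gt0.
  move=> a b c d _ xab _ _ ycd _ ba dc; exists 0 => u v uab vcd uvr; exfalso.
  pose h : R[i] := (u - x) +i* (v - y).
  have hE : x +i* y = u +i* v - h by apply: complex_eq => /=; ring.
  have he : nc h < 1 - r.
    rewrite (le_lt_trans (nc_leReIm _))//= [X in _ < X](splitr (1 - r)); apply: ltrD;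
      rewrite ltr_norml; lra.
  have := ncBle (u +i* v) h; rewrite -hE => {}H.
  by move: H xyr uvr he; clear -r1; move: (nc _) (nc _) (nc _); move=> p q o; lra.
exists x => z zr; have := Hx (Re z) (Im z).
have -> : Re z +i* Im z = z by case: z {zr}.
have H1 := nc_geRe z; have H2 := nc_geIm z.
apply=> //; rewrite -ler_norml; lra.
Qed.

Lemma boundary_inv s u v : 0 < s -> (u = - s \/ u = s) \/ (v = - s \/ v = s) ->
  nc ((u +i* v)^-1 * (u +i* v)^-1 : R[i]) <= s^-1 * s^-1.
Proof.
move=> s0 uv; rewrite ncM ncV.
have H : s <= nc (u +i* v).
  case: uv => uv; last first.
    by rewrite (le_trans _ (nc_geIm _))//= ler_normr; apply/orP; lra.
  by rewrite (le_trans _ (nc_geRe _))//= ler_normr; apply/orP; lra.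
have n0 : 0 < nc (u +i* v) by exact: lt_le_trans H.
by apply: ler_pM; rewrite ?invr_ge0 ?nc_ge0// lef_pV2.
Qed.

Lemma ccont_inv_sq s u v : 0 < s -> (u = - s \/ u = s) \/ (v = - s \/ v = s) ->
  ccont (fun z : R[i] => z^-1 * z^-1) (u +i* v).
Proof.
move=> s0 uv; have z0 : u +i* v != 0 :> R[i].
  by apply: (@neq_complex _ 0 0) => -[? ?]; subst; lra.
have c1 : ccont (fun z : R[i] => z^-1) (u +i* v).
  by apply: is_cder_cont; apply: is_cderV z0 (is_cder_id _).
exact: ccontM.
Qed.

Lemma kernel_rect_integrable k s : 0 < s ->
  (forall u v, - s <= u <= s -> - s <= v <= s -> ccont k (u +i* v)) ->
  rect_integrable (fun z => k z * (z^-1 * z^-1)) (- s) s (- s) s.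
Proof.
move=> s0 kc; apply: ccont_rect_integrable; [lra|lra|] => u v h1 h2 h3.
by apply: ccontM; [exact: kc|exact: ccont_inv_sq h3].
Qed.

Lemma kernel_le k s e : 0 < s ->
  (forall u v, - s <= u <= s -> - s <= v <= s -> ccont k (u +i* v)) ->
  (forall u v, - s <= u <= s -> - s <= v <= s -> nc (k (u +i* v)) <= e) ->
  nc (rect_int (fun z => k z * (z^-1 * z^-1)) (- s) s (- s) s) <= 8 * e / s.
Proof.
move=> s0 kc ke; have I := kernel_rect_integrable s0 kc.
have -> : 8 * e / s = e * (s^-1 * s^-1) * (2 * (s - - s + (s - - s))) by field; lra.
apply: rect_int_le; [lra|lra|exact: I|] => u v h1 h2 h3.
by rewrite ncM; apply: ler_pM; rewrite ?nc_ge0 ?ke// boundary_inv.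
Qed.

Lemma winding0_ge s : 0 < s -> 4^-1 <= nc (rect_int (fun z : R[i] => z^-1) (- s) s (- s) s).
Proof.
move=> s0; have := @winding_ge R (- s) s (- s) s 0 0 s s0.
have -> : (fun z : R[i] => (z - 0 +i* 0)^-1) = (fun z : R[i] => z^-1).
  by apply/funext => z; rewrite subr0.
by apply; lra.
Qed.

(** Stated for functions that are differentiable only on the square, so that it
    also applies to differences of translates. *)
Lemma local_cauchy_estimate f s D e : 0 < s ->
  (forall u v, - s <= u <= s -> - s <= v <= s -> exists D, is_cder f (u +i* v) D) ->
  is_cder f 0 D ->
  (forall u v, - s <= u <= s -> - s <= v <= s -> nc (f (u +i* v) - f 0) <= e) ->
  nc D <= 32 * e / s.
Proof.
move=> s0 fD f0 fe.
have fc u v : - s <= u <= s -> - s <= v <= s -> ccont (fun z => f z - f 0) (u +i* v).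
  move=> h1 h2; have [D' HD'] := fD u v h1 h2.
  by apply: is_cder_cont; apply: is_cderB HD' (is_cder_cst _ _).
have := kernel_le s0 fc fe; rewrite (cauchy_deriv s0 fD f0) ncM.
have := winding0_ge s0; move: (nc (rect_int _ _ _ _ _)) => p p4.
have := ler_wpM2l (nc_ge0 D) p4.
have -> : 32 * e / s = 4 * (8 * e / s) by ring.
by move: (nc D * p) => q; lra.
Qed.

Lemma square_in_disc w s u v e : nc w <= e - 2 * s -> - s <= u <= s -> - s <= v <= s ->
  nc (w + u +i* v) <= e.
Proof.
move=> we us vs; rewrite (le_trans (ncD _ _))//.
have : nc (u +i* v) <= `|u| + `|v| by exact: nc_leReIm.
have : `|u| <= s by rewrite ler_norml.
have : `|v| <= s by rewrite ler_norml.
move: (nc w) we (nc _) => p pe q; lra.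
Qed.

Lemma cderiv_le f r x s w : holomorphic_on_disc f -> r < 1 -> 0 < s ->
  (forall z, nc z <= r -> nc (f z) <= x) ->
  nc w <= r - 2 * s -> nc (cderiv f w) <= 64 * x / s.
Proof.
move=> hf r1 s0 fx wr; have -> : 64 * x / s = 32 * (x + x) / s by ring.
have wr' : nc w <= r by lra.
apply: (@local_cauchy_estimate (fun z => f (w + z))) => //.
- move=> u v us vs; exists (cderiv f (w + u +i* v)).
  apply: is_cder_shift; apply: hol_is_cder => //.
  by apply: le_lt_trans (square_in_disc wr us vs) r1.
- by apply: is_cder_shift; rewrite addr0; apply: hol_is_cder => //; lra.
move=> u v us vs; rewrite addr0; apply: le_trans (ncBle _ _) _.
by apply: lerD; apply: fx => //; exact: (square_in_disc wr us vs).
Qed.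

Lemma hol_lipschitz f r x s w h : holomorphic_on_disc f -> r < 1 -> 0 < s ->
  (forall z, nc z <= r -> nc (f z) <= x) ->
  nc w <= r - 2 * s -> nc (w + h) <= r - 2 * s ->
  nc (f (w + h) - f w) <= 64 * x / s * nc h.
Proof.
move=> hf r1 s0 fx wr hr; apply: mean_value_le => t t01.
have wt := nc_segment wr hr t01.
exists (cderiv f (w + t%:C * h)); last exact: (cderiv_le hf r1 s0 fx).
by apply: hol_is_cder => //; lra.
Qed.

(** The derivative of z |-> f(w + h + z) - f(w + z) at 0 is estimated by the
    supremum of that function, which is O(|h|) by [hol_lipschitz]. *)
Lemma cderiv_lipschitz f r x s w h : holomorphic_on_disc f -> r < 1 -> 0 < s ->
  (forall z, nc z <= r -> nc (f z) <= x) ->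
  nc w <= r - 4 * s -> nc (w + h) <= r - 4 * s ->
  nc (cderiv f (w + h) - cderiv f w) <= 64 * (64 * x) / s ^+ 2 * nc h.
Proof.
move=> hf r1 s0 fx wr hr.
have -> : 64 * (64 * x) / s ^+ 2 * nc h = 32 * (64 * x / s * nc h + 64 * x / s * nc h) / s.
  by field; lra.
have [w1 h1] : nc w <= r - 2 * s /\ nc (w + h) <= r - 2 * s by lra.
have sq p u v : nc p <= r - 4 * s -> - s <= u <= s -> - s <= v <= s ->
    nc (p + u +i* v) <= r - 2 * s.
  by move=> pr us vs; apply: (@square_in_disc _ s) => //; lra.
have in1 p : nc p <= r - 2 * s -> nc p < 1 by lra.
apply: (@local_cauchy_estimate (fun z => f (w + h + z) - f (w + z))) => //.
- move=> u v us vs; eexists; apply: is_cderB;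
    apply: is_cder_shift; apply: hol_is_cder => //; apply: in1; exact: sq.
- by apply: is_cderB; apply: is_cder_shift; rewrite addr0; apply: hol_is_cder => //; apply: in1.
move=> u v us vs; rewrite !addr0 (le_trans (ncBle _ _))// lerD//; last exact: (hol_lipschitz hf r1 s0 fx).
rewrite -addrA (addrC h) addrA; apply: (hol_lipschitz hf r1 s0 fx); first exact: sq.
by rewrite -addrA (addrC _ h) addrA; exact: sq.
Qed.

(** The constant depends on f only through its supremum x, which makes the
    estimate uniform over bounded families; termwise differentiation of series
    relies on this. *)
Lemma taylor2_le f r x s z h : holomorphic_on_disc f -> r < 1 -> 0 < s ->
  (forall z, nc z <= r -> nc (f z) <= x) ->
  nc z <= r - 4 * s -> nc (z + h) <= r - 4 * s ->
  nc (f (z + h) - f z - cderiv f z * h) <= 64 * (64 * x) / s ^+ 2 * nc h ^+ 2.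
Proof.
move=> hf r1 s0 fx zr hr; pose g p := f p - cderiv f z * p.
have -> : f (z + h) - f z - cderiv f z * h = g (z + h) - g z by rewrite /g; ring.
have zr' : nc z <= r by lra.
have x0 : 0 <= x by exact: le_trans (nc_ge0 (f z)) (fx z zr').
rewrite (expr2 (nc h)) (mulrA _ (nc h)); apply: (@mean_value_le g) => t t01.
have zt := nc_segment zr hr t01.
exists (cderiv f (z + t%:C * h) - cderiv f z * 1).
  by apply: is_cderB; [apply: hol_is_cder => //; lra|apply: is_cderZ; exact: is_cder_id].
rewrite mulr1 (le_trans (cderiv_lipschitz hf r1 s0 fx zr zt))// ncM ncC.
apply: ler_wpM2l; first by rewrite divr_ge0 ?sqr_ge0 ?mulr_ge0.
by case/andP: t01 => t0 t1; rewrite ger0_norm// ler_piMl ?nc_ge0.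
Qed.

End CauchyEstimates.

Section DerivativeHolomorphic.
Variable R : realType.
Implicit Types (k f g : R[i] -> R[i]) (a b c d x y e r s t u v : R) (w z h D : R[i]).

Lemma ccont_cst w z : ccont (fun=> w) z.
Proof. exact: is_cder_cont (is_cder_cst _ _). Qed.

(** Cauchy's formula expresses f'(w) through an integral of f(w + z) over a
    square that does not move with w.  Differentiating under the integral is
    justified by the quadratic Taylor estimate, and gives f''(w) as the same
    integral of f'(w + z). *)
Lemma cderiv_hol f : holomorphic_on_disc f -> holomorphic_on_disc (cderiv f).
Proof.
move=> hf; apply: holomorphic_of_is_cder => w w1.
(* eight steps of size s remain between w and the radius r, which is enough for all translates below *)
pose s := (1 - nc w) / 16; pose r := nc w + 8 * s.
have s0 : 0 < s by rewrite divr_gt0// subr_gt0.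
have r1 : r < 1 by rewrite /r /s; move: w1; move: (nc w) => q; lra.
have [x fx] := hol_bounded hf r1.
have wr : nc w = r - 8 * s by rewrite /r addrK.
clearbody r; clearbody s.
pose L := 64 * (64 * x) / s ^+ 2.
have x0 : 0 <= x by apply: le_trans (nc_ge0 (f w)) (fx _ _); lra.
have L0 : 0 <= L by rewrite divr_ge0 ?sqr_ge0 ?mulr_ge0.
have L1 : 0 < L + 1 by rewrite ltr_wpDl.
have near z e : nc z <= r - e -> forall u v, - s <= u <= s -> - s <= v <= s ->
    nc (z + u +i* v) <= r - (e - 2 * s).
  by move=> ze u v us vs; apply: (@square_in_disc _ _ s) => //; lra.
have lip z h : nc z <= r - 4 * s -> nc (z + h) <= r - 4 * s ->
    nc (cderiv f (z + h) - cderiv f z) <= L * nc h.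
  exact: (cderiv_lipschitz hf r1 s0 fx).
have tay z h : nc z <= r - 4 * s -> nc (z + h) <= r - 4 * s ->
    nc (f (z + h) - f z - cderiv f z * h) <= L * nc h ^+ 2.
  exact: (taylor2_le hf r1 s0 fx).
have w8 : nc w <= r - 8 * s by lra.
have w4 : nc w <= r - 4 * s by lra.
have in1 p : nc p <= r - 4 * s -> nc p < 1 by lra.
pose N z := cderiv f (w + z) - cderiv f w.
have Nc u v : - s <= u <= s -> - s <= v <= s -> ccont N (u +i* v).
  move=> us vs e e0; exists (Num.min s (e / (L + 1))).
    by rewrite lt_min s0 divr_gt0.
  move=> h; rewrite lt_min ltr_pdivlMr// => /andP[hs he].
  rewrite /N opprB addrA subrK addrA.
  have wn := near w _ w8 u v us vs.
  apply: le_trans (lip _ _ _ _) _.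
  - by apply: le_trans wn _; lra.
  - by apply: le_trans (ncD _ _) _; lra.
  have := nc_ge0 h; move: he; rewrite mulrDr mulr1 mulrC; lra.
pose C := rect_int (fun z : R[i] => z^-1) (- s) s (- s) s.
have C4 : 4^-1 <= nc C by exact: winding0_ge.
have C0 : C != 0 by rewrite -nc_gt0; lra.
have NI := kernel_rect_integrable s0 Nc.
pose J := rect_int (fun z => N z * (z^-1 * z^-1)) (- s) s (- s) s.
exists (J / C) => e e0.
pose K := 64 * L / s.
have K0 : 0 <= K by apply: divr_ge0; [exact: mulr_ge0|exact: ltW].
have K1 : 0 < K + 1 by rewrite ltr_wpDl.
exists (Num.min s (e / (K + 1))); first by rewrite lt_min s0 divr_gt0.
move=> h; rewrite lt_min ltr_pdivlMr// => /andP[hs he].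
suff H : nc (cderiv f (w + h) - cderiv f w - J / C * h) <= K * nc h ^+ 2.
  apply: le_trans H _; rewrite expr2 mulrA ler_wpM2r ?nc_ge0//.
  have := nc_ge0 h; move: he; rewrite mulrDr mulr1 mulrC; lra.
have wh6 : nc (w + h) <= r - 6 * s by apply: le_trans (ncD _ _) _; lra.
have wh4 : nc (w + h) <= r - 4 * s by lra.
pose G z := f (w + h + z) - f (w + z).
have GD z : nc (w + z) <= r - 4 * s -> nc (w + h + z) <= r - 4 * s ->
    is_cder G z (cderiv f (w + h + z) - cderiv f (w + z)).
  by move=> h1 h2; apply: is_cderB; apply: is_cder_shift; apply: hol_is_cder => //; exact: in1.
have n1 u v : - s <= u <= s -> - s <= v <= s -> nc (w + u +i* v) <= r - 4 * s.
  by move=> us vs; apply: le_trans (near w _ w8 u v us vs) _; lra.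
have n2 u v : - s <= u <= s -> - s <= v <= s -> nc (w + h + u +i* v) <= r - 4 * s.
  by move=> us vs; apply: le_trans (near _ _ wh6 u v us vs) _; lra.
have GDs u v : - s <= u <= s -> - s <= v <= s -> exists D, is_cder G (u +i* v) D.
  by move=> us vs; eexists; apply: GD; [exact: n1|exact: n2].
have G0 : is_cder G 0 (cderiv f (w + h) - cderiv f w).
  by have := GD 0; rewrite !addr0; apply.
have Gc u v : - s <= u <= s -> - s <= v <= s -> ccont (fun z => G z - G 0) (u +i* v).
  move=> us vs; have [D HD] := GDs u v us vs.
  by apply: is_cder_cont; apply: is_cderB HD (is_cder_cst _ _).
have GI := kernel_rect_integrable s0 Gc.
have hNc u v : - s <= u <= s -> - s <= v <= s -> ccont (fun z => h * N z) (u +i* v).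
  by move=> us vs; apply: ccontM; [exact: ccont_cst|exact: Nc].
have hNI := kernel_rect_integrable s0 hNc.
have E : (cderiv f (w + h) - cderiv f w - J / C * h) * C =
    rect_int (fun z => (G z - G 0 - h * N z) * (z^-1 * z^-1)) (- s) s (- s) s.
  have -> : (fun z => (G z - G 0 - h * N z) * (z^-1 * z^-1)) =
      (fun z => (G z - G 0) * (z^-1 * z^-1) - h * N z * (z^-1 * z^-1)).
    by apply/funext => z; rewrite mulrBl.
  rewrite rect_intB// (cauchy_deriv s0 GDs G0) -/C.
  have -> : (fun z => h * N z * (z^-1 * z^-1)) = (fun z => h * (N z * (z^-1 * z^-1))).
    by apply/funext => z; rewrite mulrA.
  rewrite rect_intZ// -/J mulrBl; congr (_ - _).
  by rewrite mulrAC divfK// mulrC.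
have B : nc (rect_int (fun z => (G z - G 0 - h * N z) * (z^-1 * z^-1)) (- s) s (- s) s) <=
    8 * (2 * (L * nc h ^+ 2)) / s.
  apply: kernel_le => // u v us vs; first by apply: ccontB; [exact: Gc|exact: hNc].
  have -> : G (u +i* v) - G 0 - h * N (u +i* v) =
    (f (w + u +i* v + h) - f (w + u +i* v) - cderiv f (w + u +i* v) * h) -
    (f (w + h) - f w - cderiv f w * h).
    rewrite /G /N !addr0 (addrAC w _ h).
    move: (f (w + h + _)) (f (w + _)) (f (w + h)) (f w) (cderiv f (w + _)) (cderiv f w).
    by move=> p1 p2 p3 p4 p5 p6; ring.
  apply: le_trans (ncBle _ _) _; rewrite mulr_natl mulr2n; apply: lerD.
    apply: tay; first exact: n1.
    by rewrite -addrA (addrC (u +i* v)) addrA; exact: n2.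
  exact: tay.
move: B; rewrite -E ncM.
have := ler_wpM2l (nc_ge0 (cderiv f (w + h) - cderiv f w - J / C * h)) C4.
have -> : K * nc h ^+ 2 = 4 * (8 * (2 * (L * nc h ^+ 2)) / s) by rewrite /K; field; lra.
move: (_ * nc C) (_ / s) => p q; lra.
Qed.

End DerivativeHolomorphic.

(** * Holomorphic functions are measurable on the plane *)

Section PlaneMeasurability.
Variable R : realType.
Local Notation MR := (measurableTypeR R).
Implicit Types (A : set (MR * MR)) (p q : MR * MR).

(** Openness for the sup distance on R x R, stated without the product
    topology. *)
Definition open2 A := forall p, A p -> exists2 r : R, 0 < r &
  forall q, `|q.1 - p.1| < r -> `|q.2 - p.2| < r -> A q.

(** An open set is the union of the rational open rectangles that it
    contains. *)
Lemma open2_measurable A : open2 A -> measurable A.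
Proof.
move=> oA.
pose box (a b c d : rat) : set (MR * MR) :=
  (`]ratr a, ratr b[ : set R) `*` (`]ratr c, ratr d[ : set R).
pose F a b c d := if `[< box a b c d `<=` A >] then box a b c d else set0.
have -> : A = \bigcup_a \bigcup_b \bigcup_c \bigcup_d F a b c d.
  apply/seteqP; split=> [p Ap|p [a _ [b _ [c _ [d _]]]]]; last first.
    by rewrite /F; case: asboolP => // bA /bA.
  have [r r0 H] := oA p Ap.
  have lt1 (t : R) : t - r < t by rewrite ltrBlDr ltrDl.
  have lt2 (t : R) : t < t + r by rewrite ltrDl.
  have [a] := rat_in_itvoo (lt1 p.1); rewrite in_itv/= => /andP[a1 a2].
  have [b] := rat_in_itvoo (lt2 p.1); rewrite in_itv/= => /andP[b1 b2].
  have [c] := rat_in_itvoo (lt1 p.2); rewrite in_itv/= => /andP[c1 c2].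
  have [d] := rat_in_itvoo (lt2 p.2); rewrite in_itv/= => /andP[d1 d2].
  exists a => //; exists b => //; exists c => //; exists d => //; rewrite /F.
  case: asboolP => [_|].
    by split; rewrite /= in_itv/= ?a2 ?b1 ?c2 ?d1.
  case=> q [] /=; rewrite !in_itv/= => /andP[q1 q2] /andP[q3 q4].
  by apply: H; rewrite ltr_norml; lra.
do 4! (apply: bigcupT_measurable_rat => ?).
rewrite /F; case: asboolP => _; last exact: measurable0.
by apply: measurableX; exact: measurable_itv.
Qed.

Lemma continuous2_measurable A (f : MR * MR -> R) : open2 A ->
  (forall p, A p -> forall e : R, 0 < e -> exists2 r : R, 0 < r &
    forall q, `|q.1 - p.1| < r -> `|q.2 - p.2| < r -> `|f q - f p| <= e) ->
  measurable_fun A f.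
Proof.
move=> oA cf mA; apply: (measurability _ (measurable_realfun.RGenOInfty.measurableE R)) => //.
move=> _ [_ [y ->] <-]; apply: open2_measurable => p [Ap] /=.
rewrite in_itv/= andbT => yf.
have [r r0 H] := oA p Ap.
have [s s0 K] := cf p Ap ((f p - y) / 2) ltac:(by rewrite divr_gt0// subr_gt0).
exists (Num.min r s); first by rewrite lt_min r0.
move=> q; rewrite !lt_min => /andP[q1 q2] /andP[q3 q4]; split; first exact: H.
rewrite /= in_itv/= andbT; have := K q q2 q4; rewrite ler_norml; lra.
Qed.

Definition disc2 : set (MR * MR) := [set p | unit_disc (p.1 +i* p.2)].

Lemma near2_complex p q (r : R) : `|q.1 - p.1| < r / 2 -> `|q.2 - p.2| < r / 2 ->
  exists2 h : R[i], nc h < r & q.1 +i* q.2 = p.1 +i* p.2 + h.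
Proof.
move=> h1 h2; exists ((q.1 - p.1) +i* (q.2 - p.2)).
  by rewrite (le_lt_trans (nc_leReIm _))//= [ltRHS]splitr ltrD.
by apply: complex_eq => /=; rewrite addrC subrK.
Qed.

Lemma open2_disc2 : open2 disc2.
Proof.
move=> p p1.
pose r := 1 - nc (p.1 +i* p.2).
have r0 : 0 < r by rewrite subr_gt0; exact: p1.
exists (r / 2); first by rewrite divr_gt0.
move=> q h1 h2; have [h hr qE] := near2_complex h1 h2.
rewrite /disc2 /unit_disc; change (nc (q.1 +i* q.2) < 1).
by rewrite qE (le_lt_trans (ncD _ _))// -ltrBrDl.
Qed.

Lemma measurable_disc2 : measurable disc2.
Proof. exact: open2_measurable open2_disc2. Qed.

Lemma nc2_dist (z w : R[i]) : `|nc z ^+ 2 - nc w ^+ 2| <= nc (z * z - w * w).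
Proof.
rewrite !expr2 -!ncM; have H1 := ncDist (z * z) (w * w).
have := ncDist (w * w) (z * z); rewrite ncB => H2.
by rewrite ler_norml; lra.
Qed.

Lemma ccont_sq (f : R[i] -> R[i]) (z : R[i]) : ccont f z ->
  forall e : R, 0 < e -> exists2 r : R, 0 < r & forall h, nc h < r ->
    `|nc (f (z + h)) ^+ 2 - nc (f z) ^+ 2| <= e.
Proof.
move=> cf e e0; have [r r0 H] := ccontM cf cf e0.
by exists r => // h /H; apply: le_trans; exact: nc2_dist.
Qed.

Lemma hol_measurable (g : R[i] -> R[i]) : holomorphic_on_disc g ->
  measurable_fun disc2 (fun p => nc (g (p.1 +i* p.2)) ^+ 2).
Proof.
move=> hg; apply: continuous2_measurable; first exact: open2_disc2.
move=> p p1 e e0; have [r r0 H] := ccont_sq (is_cder_cont (hol_is_cder hg p1)) e0.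
exists (r / 2); first by rewrite divr_gt0.
by move=> q h1 h2; have [h hr ->] := near2_complex h1 h2; exact: H.
Qed.

End PlaneMeasurability.

(** * Point values are controlled by area integrals *)

Section SliceBounds.
Local Open Scope ereal_scope.
Context d1 d2 (T1 : measurableType d1) (T2 : measurableType d2) (R : realType).
Variable m1 : {sigma_finite_measure set T1 -> \bar R}.
Variable m2 : {sigma_finite_measure set T2 -> \bar R}.
Variables (I : set T1) (J : set T2) (f : T1 * T2 -> \bar R) (y : R).
Hypothesis mI : measurable I.
Hypothesis mJ : measurable J.
Hypothesis mf : measurable_fun (I `*` J) f.
Hypothesis f0 : forall p, (I `*` J) p -> 0 <= f p.
Hypothesis y0 : (0 <= y)%R.

Let mfp : measurable_fun setT (f \_ (I `*` J)).
Proof. by apply/(measurable_restrictT f (measurableX mI mJ)). Qed.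

Let fp0 p : 0 <= (f \_ (I `*` J)) p.
Proof. by rewrite patchE; case: ifPn => //; rewrite inE => /f0. Qed.

(** Tonelli's theorem, used only through the lower bound that it gives when all
    vertical slices have a large integral. *)
Lemma slice_lower_x :
  (forall u, I u -> y%:E <= \int[m2]_(v in J) f (u, v)) ->
  y%:E * m1 I <= \int[m1 \x m2]_(p in I `*` J) f p.
Proof.
move=> H; rewrite integral_mkcond fubini_tonelli1// -integral_cst// integral_mkcond.
apply: ge0_le_integral => //.
- by move=> u _; rewrite patchE; case: ifPn; rewrite ?lee_fin.
- by apply/(measurable_restrictT _ mI); exact: measurable_cst.
- exact: measurable_fun_fubini_tonelli_F.
move=> u _; rewrite patchE /fubini_F; case: ifPn => [uI|uI]; last first.
  by apply: integral_ge0 => v _; exact: fp0.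
have Iu : I u by move: uI; rewrite inE.
apply: le_trans (H u Iu) _.
rewrite [leLHS]integral_mkcond le_eqVlt; apply/orP; left; apply/eqP.
apply: eq_integral => v _; rewrite !patchE in_setX/= uI/=.
by case: ifPn.
Qed.

Lemma slice_lower_y :
  (forall v, J v -> y%:E <= \int[m1]_(u in I) f (u, v)) ->
  y%:E * m2 J <= \int[m1 \x m2]_(p in I `*` J) f p.
Proof.
move=> H; rewrite integral_mkcond fubini_tonelli2// -integral_cst// integral_mkcond.
apply: ge0_le_integral => //.
- by move=> u _; rewrite patchE; case: ifPn; rewrite ?lee_fin.
- by apply/(measurable_restrictT _ mJ); exact: measurable_cst.
- exact: measurable_fun_fubini_tonelli_G.
move=> v _; rewrite patchE /fubini_G; case: ifPn => [vJ|vJ]; last first.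
  by apply: integral_ge0 => u _; exact: fp0.
have Jv : J v by move: vJ; rewrite inE.
apply: le_trans (H v Jv) _.
rewrite [leLHS]integral_mkcond le_eqVlt; apply/orP; left; apply/eqP.
apply: eq_integral => u _; rewrite !patchE in_setX/= vJ andbT.
by case: ifPn.
Qed.

End SliceBounds.

Section AreaEstimate.
Variable R : realType.
Notation mu := (@lebesgue_measure R).
Implicit Types (g : R[i] -> R[i]) (a b c d x y e r s t u v : R) (w z h D : R[i]).

Lemma Rintegral_seg_mono (f : R -> R) a b c d : a <= c -> c <= d -> d <= b ->
  mu.-integrable `[a, b] (fun t => (f t)%:E) ->
  (forall t, a <= t <= b -> 0 <= f t) ->
  \int[mu]_(t in `[c, d]) f t <= \int[mu]_(t in `[a, b]) f t.
Proof.
move=> ac cd db fi f0.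
have acb : a <= c <= b by rewrite ac (le_trans cd db).
rewrite (Rintegral_seg_split acb fi).
have fi' : mu.-integrable `[c, b] (fun t => (f t)%:E).
  by apply: integrableS fi => //; apply: subset_seg.
have cdb : c <= d <= b by rewrite cd db.
rewrite (Rintegral_seg_split cdb fi').
rewrite addrCA lerDl addr_ge0//; apply: Rintegral_ge0 => t /=; rewrite in_itv/= => /andP[t1 t2];
  apply: f0; lra.
Qed.

(** The inequality 2 m |g| <= t m^2 + |g|^2 / t, integrated along the side,
    plays the role of the Cauchy-Schwarz inequality; the interval [a, b] may be
    longer than the side [c, d] of the contour. *)
Lemma side_le (F G : R -> R[i]) a b c d m e t : a <= c -> c <= d -> d <= b ->
  0 <= m -> 0 < e -> 0 < t ->
  cintegrable F c d ->
  mu.-integrable `[a, b] (fun u => (nc (G u) ^+ 2)%:E) ->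
  (forall u, c <= u <= d -> nc (F u) <= 2 / e * nc (G u)) ->
  m * nc (cint F c d) <=
    e^-1 * (t * m ^+ 2 * (b - a) + t^-1 * \int[mu]_(u in `[a, b]) nc (G u) ^+ 2).
Proof.
move=> ac cd db m0 e0 t0 Fi Gi FG.
have ab : a <= b by lra.
have -> : m * nc (cint F c d) = nc (cint (fun u => m%:C * F u) c d).
  by rewrite cintZ// ncM ncC ger0_norm.
have ci : mu.-integrable `[a, b] (fun=> (t * m ^+ 2)%:E).
  by apply: continuous_integrable => ? _ r r0; exists 1 => // ? _ _; rewrite subrr normr0 ltW.
have Zi v (f : R -> R) : mu.-integrable `[a, b] (fun u => (f u)%:E) ->
  mu.-integrable `[a, b] (fun u => (v * f u)%:E).
  by move=> fi; have := integrableZl (measurable_seg a b) v fi; apply: eq_integrable.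
have Si : mu.-integrable `[a, b] (fun u => (t * m ^+ 2 + t^-1 * nc (G u) ^+ 2)%:E).
  have := integrableD (measurable_seg a b) ci (Zi t^-1 _ Gi).
  by apply: eq_integrable.
rewrite -Rintegral_seg_cst// -RintegralZl// -RintegralD//; last exact: Zi.
rewrite -RintegralZl//.
apply: (le_trans _ (Rintegral_seg_mono ac cd db _ _)); last 2 first.
- exact: Zi.
- move=> u _; rewrite mulr_ge0 ?invr_ge0 ?(ltW e0)// addr_ge0// mulr_ge0 ?sqr_ge0 ?(ltW t0)//.
  by rewrite invr_ge0 ltW.
apply: cint_le.
- exact: cintegrableZ.
- by apply: integrableS (Zi e^-1 _ Si) => //; apply: subset_seg.
move=> u ucd; rewrite ncM ncC ger0_norm//.
apply: le_trans (ler_wpM2l m0 (FG u ucd)) _.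
rewrite mulrCA -mulrA mulrCA ler_wpM2l ?invr_ge0 ?(ltW e0)//.
move: (nc (G u)) => q.
have : 0 <= t * (m - q / t) ^+ 2 by rewrite mulr_ge0 ?sqr_ge0// ltW.
have -> : t * (m - q / t) ^+ 2 = (t * m ^+ 2 + t^-1 * q ^+ 2) - 2 * (m * q) by field; lra.
by rewrite subr_ge0.
Qed.

End AreaEstimate.

Section AreaSubMeanValue.
Variable R : realType.
Notation mu := (@lebesgue_measure R).
Implicit Types (m n : R) (g : R[i] -> R[i]) (a b c d x y e r s t u v : R) (w z h D : R[i]).

Lemma sq_integrable (F : R -> R[i]) a b :
  seg_continuous (fun t => F t * F t) a b ->
  mu.-integrable `[a, b] (fun t => (nc (F t) ^+ 2)%:E).
Proof.
move=> cF; apply: continuous_integrable => t ht e e0.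
have [r r0 H] := cF t ht e e0; exists r => // s hs st.
exact: le_trans (nc2_dist _ _) (H s hs st).
Qed.

Lemma sq_integrable_y g u c d :
  (forall v, c <= v <= d -> exists D, is_cder g (u +i* v) D) ->
  mu.-integrable `[c, d] (fun v => (nc (g (u +i* v)) ^+ 2)%:E).
Proof.
move=> gD; apply: sq_integrable; apply: (ccont_seg_y (k := fun z => g z * g z)) => v hv.
by have [D /is_cder_cont HD] := gD v hv; exact: ccontM.
Qed.

Lemma sq_integrable_x g v a b :
  (forall u, a <= u <= b -> exists D, is_cder g (u +i* v) D) ->
  mu.-integrable `[a, b] (fun u => (nc (g (u +i* v)) ^+ 2)%:E).
Proof.
move=> gD; apply: sq_integrable; apply: (ccont_seg_x (k := fun z => g z * g z)) => u hu.
by have [D /is_cder_cont HD] := gD u hu; exact: ccontM.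
Qed.

Let contour_arith m e p1 p2 p3 p4 q1 q2 q3 q4 n : 0 < e ->
  4^-1 <= n -> 0 <= m -> m * n <= (p1 + p2) + (p3 + p4) ->
  m * p1 <= e^-1 * (64^-1 * m ^+ 2 * (2 * e) + 64^-1^-1 * q3) ->
  m * p2 <= e^-1 * (64^-1 * m ^+ 2 * (2 * e) + 64^-1^-1 * q4) ->
  m * p3 <= e^-1 * (64^-1 * m ^+ 2 * (2 * e) + 64^-1^-1 * q2) ->
  m * p4 <= e^-1 * (64^-1 * m ^+ 2 * (2 * e) + 64^-1^-1 * q1) ->
  e * m ^+ 2 / (8 * 64) <= q1 + q2 + q3 + q4.
Proof.
move=> e0 n4 m0 T.
have E q : e^-1 * (64^-1 * m ^+ 2 * (2 * e) + 64^-1^-1 * q) = m ^+ 2 / 32 + 64 * (q / e).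
  by field; rewrite gt_eqF.
rewrite !E => S1 S2 S3 S4.
have B1 := ler_wpM2l m0 n4; have B2 := ler_wpM2l m0 (le_trans B1 T).
have : m ^+ 2 / 8 <= 64 * ((q1 + q2 + q3 + q4) / e).
  have -> : m ^+ 2 / 8 = m * (m * 4^-1) - 4 * (m ^+ 2 / 32) by field.
  rewrite lerBlDr; apply: le_trans B2 _.
  have -> : m * (p1 + p2 + (p3 + p4)) = (m * p1 + m * p2) + (m * p3 + m * p4) by ring.
  apply: le_trans (lerD (lerD S1 S2) (lerD S3 S4)) _.
  by rewrite le_eqVlt; apply/orP; left; apply/eqP; ring.
rewrite mulrA ler_pdivlMr// => H.
have -> : e * m ^+ 2 / (8 * 64) = (m ^+ 2 / 8 * e) / 64 by field.
by rewrite ler_pdivrMr// (mulrC _ 64).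
Qed.

(** Cauchy's formula at x + iy over a rectangle with sides x1, x2, y1, y2.  The
    four integrals on the right run over full cross-sections of the square of
    half side e, so each depends on one of the four sides only. *)
Lemma contour_lower_bound g x y e x1 x2 y1 y2 : 0 < e ->
  (forall u v, x - e <= u <= x + e -> y - e <= v <= y + e ->
     exists D, is_cder g (u +i* v) D) ->
  x - e <= x1 <= x - e / 2 -> x + e / 2 <= x2 <= x + e ->
  y - e <= y1 <= y - e / 2 -> y + e / 2 <= y2 <= y + e ->
  e * nc (g (x +i* y)) ^+ 2 / (8 * 64) <=
    \int[mu]_(v in `[y - e, y + e]) nc (g (x1 +i* v)) ^+ 2 +
    \int[mu]_(v in `[y - e, y + e]) nc (g (x2 +i* v)) ^+ 2 +
    \int[mu]_(u in `[x - e, x + e]) nc (g (u +i* y1)) ^+ 2 +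
    \int[mu]_(u in `[x - e, x + e]) nc (g (u +i* y2)) ^+ 2.
Proof.
move=> e0 gD Hx1 Hx2 Hy1 Hy2.
have W : 4^-1 <= nc (rect_int (fun z => (z - x +i* y)^-1) x1 x2 y1 y2).
  by apply: (winding_ge e0) => //; case/andP: Hx1.
have xab : x1 < x < x2 by lra.
have ycd : y1 < y < y2 by lra.
have Iy u : x - e <= u <= x + e ->
    mu.-integrable `[y - e, y + e] (fun v => (nc (g (u +i* v)) ^+ 2)%:E).
  by move=> hu; apply: sq_integrable_y => v; exact: gD.
have Ix v : y - e <= v <= y + e ->
    mu.-integrable `[x - e, x + e] (fun u => (nc (g (u +i* v)) ^+ 2)%:E).
  by move=> hv; apply: sq_integrable_x => u hu; exact: gD.
pose w := x +i* y; pose k z := g z * (z - w)^-1.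
have gD' u v : x1 <= u <= x2 -> y1 <= v <= y2 -> exists D, is_cder g (u +i* v) D.
  by move=> h1 h2; apply: gD; lra.
have x12 : x1 <= x2 by lra.
have y12 : y1 <= y2 by lra.
have [k1 k2 k3 k4] : rect_integrable k x1 x2 y1 y2.
  apply: is_cder_rect_integrable => // u v h1 h2 h3; have [D HD] := gD' u v h1 h2.
  have [|D' HD'] := @is_cder_inv _ w (u +i* v).
    by apply: neq_complex => -[? ?]; subst; lra.
  by eexists; exact: is_cderM HD HD'.
have kle u v : e / 2 <= `|u - x| \/ e / 2 <= `|v - y| ->
    nc (k (u +i* v)) <= 2 / e * nc (g (u +i* v)).
  move=> uv; rewrite /k ncM ncV mulrC ler_wpM2r ?nc_ge0//.
  have wE : u +i* v - w = (u - x) +i* (v - y) by [].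
  have H : e / 2 <= nc (u +i* v - w).
    rewrite wE; case: uv => uv; apply: le_trans uv _.
      exact: (nc_geRe ((u - x) +i* (v - y))).
    exact: (nc_geIm ((u - x) +i* (v - y))).
  have e2 : 0 < e / 2 by rewrite divr_gt0.
  by rewrite -[2 / e]invrK lef_pV2 ?posrE ?(lt_le_trans e2 H)// ?invf_div.
have m0 := nc_ge0 (g w).
set m := nc (g w) in m0 *.
have hy1 : e / 2 <= `|y1 - y| by rewrite ler0_norm; lra.
have hy2 : e / 2 <= `|y2 - y| by rewrite ger0_norm; lra.
have hx1 : e / 2 <= `|x1 - x| by rewrite ler0_norm; lra.
have hx2 : e / 2 <= `|x2 - x| by rewrite ger0_norm; lra.
have [rx1 [rx2 [ry1 ry2]]] : x - e <= x1 <= x + e /\ x - e <= x2 <= x + e /\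
  (y - e <= y1 <= y + e /\ y - e <= y2 <= y + e) by lra.
have [[lx rx] [ly ry]] : (x - e <= x1 /\ x2 <= x + e) /\ (y - e <= y1 /\ y2 <= y + e) by lra.
(* with t = 1/64 the terms in m^2 absorb only half of the left-hand side *)
have t0 : 0 < (64^-1 : R) by rewrite invr_gt0.
have S1 := @side_le R _ (fun u => g (u +i* y1)) (x - e) (x + e) x1 x2 m e 64^-1
  lx x12 rx m0 e0 t0 k1 (Ix y1 ry1)
  (fun u _ => kle u y1 (or_intror hy1)).
have S2 := @side_le R _ (fun u => g (u +i* y2)) (x - e) (x + e) x1 x2 m e 64^-1
  lx x12 rx m0 e0 t0 k2 (Ix y2 ry2)
  (fun u _ => kle u y2 (or_intror hy2)).
have S3 := @side_le R _ (fun v => g (x2 +i* v)) (y - e) (y + e) y1 y2 m e 64^-1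
  ly y12 ry m0 e0 t0 k3 (Iy x2 rx2)
  (fun v _ => kle x2 v (or_introl hx2)).
have S4 := @side_le R _ (fun v => g (x1 +i* v)) (y - e) (y + e) y1 y2 m e 64^-1
  ly y12 ry m0 e0 t0 k4 (Iy x1 rx1)
  (fun v _ => kle x1 v (or_introl hx1)).
have C := cauchy_rect xab ycd gD'.
have T : nc (rect_int k x1 x2 y1 y2) <= (nc (cint (fun u => k (u +i* y1)) x1 x2) + nc (cint (fun u => k (u +i* y2)) x1 x2)) +
   (nc (cint (fun v => k (x2 +i* v)) y1 y2) + nc (cint (fun v => k (x1 +i* v)) y1 y2)).
  rewrite /rect_int (le_trans (ncD _ _))// ncM nc_i mul1r.
  by apply: lerD; exact: ncBle.
rewrite C ncM -/w -/m in T.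
have Ex : x + e - (x - e) = 2 * e by ring.
have Ey : y + e - (y - e) = 2 * e by ring.
rewrite Ex in S1 S2; rewrite Ey in S3 S4.
exact: (contour_arith e0 W m0 T S1 S2 S3 S4).
Qed.

End AreaSubMeanValue.

Section AreaEstimateFinal.
Variable R : realType.
Notation mu := (@lebesgue_measure R).
Local Notation MR := (measurableTypeR R).
Implicit Types (g : R[i] -> R[i]) (a b c d x y e r s t u v : R) (w z h D : R[i]).

Lemma area_integral (f : MR * MR -> R) : measurable_fun (@disc2 R) f ->
  (forall p, 0 <= f p) ->
  (\int[area R]_(p in @disc2 R) (f p)%:E =
   (pi^-1)%:E * \int[(mu \x mu)%E]_(p in @disc2 R) (f p)%:E)%E.
Proof.
move=> mf f0; rewrite /area ge0_integral_mscale//.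
- exact: measurable_disc2.
- exact/measurable_EFinP.
- by move=> p _; rewrite lee_fin.
Qed.

Lemma measure_seg a b : a <= b -> mu `[a, b] = (b - a)%:E.
Proof.
move=> ab; rewrite lebesgue_measure_itv/= lte_fin.
move: ab; rewrite le_eqVlt => /predU1P[->|->]; last by rewrite -EFinB.
by rewrite ltxx subrr.
Qed.

(** The four sides of the rectangle in [contour_lower_bound] vary independently
    in intervals of length e/2.  If each of the four terms could be made smaller
    than k, their sum would fall below the lower bound 4k; so one of them is at
    least k throughout its interval, and Tonelli's theorem bounds the area
    integral from below. *)
Lemma square_integral_ge g x y e : 0 < e -> holomorphic_on_disc g ->
  (forall u v, x - e <= u <= x + e -> y - e <= v <= y + e -> nc (u +i* v) < 1) ->
  ((e / 2 * (e / (8 * 64) / 4) * nc (g (x +i* y)) ^+ 2)%:E <=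
   \int[(mu \x mu)%E]_(p in @disc2 R) (nc (g (p.1 +i* p.2)) ^+ 2)%:E)%E.
Proof.
move=> e0 hg in1.
have gD u v : x - e <= u <= x + e -> y - e <= v <= y + e ->
    exists D, is_cder g (u +i* v) D.
  by move=> hu hv; exists (cderiv g (u +i* v)); apply: hol_is_cder => //; exact: in1.
have Iy u : x - e <= u <= x + e ->
    mu.-integrable `[y - e, y + e] (fun v => (nc (g (u +i* v)) ^+ 2)%:E).
  by move=> hu; apply: sq_integrable_y => v; exact: gD.
have Ix v : y - e <= v <= y + e ->
    mu.-integrable `[x - e, x + e] (fun u => (nc (g (u +i* v)) ^+ 2)%:E).
  by move=> hv; apply: sq_integrable_x => u hu; exact: gD.
have low := contour_lower_bound e0 gD.
pose F (p : MR * MR) := (nc (g (p.1 +i* p.2)) ^+ 2)%:E.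
have F0 p : (0 <= F p)%E by rewrite lee_fin sqr_ge0.
have mF : measurable_fun (@disc2 R) F by apply/measurable_EFinP; exact: hol_measurable.
pose k := e / (8 * 64) / 4 * nc (g (x +i* y)) ^+ 2.
have k0 : 0 <= k.
  by apply: mulr_ge0; [do 2 (apply: divr_ge0 => //); exact: ltW|exact: sqr_ge0].
have kE a b : b - a = e / 2 ->
    ((e / 2 * (e / (8 * 64) / 4) * nc (g (x +i* y)) ^+ 2)%:E = k%:E * mu `[a, b])%E.
  move=> ba; rewrite measure_seg ?ba; last by rewrite -subr_ge0 ba divr_ge0// ltW.
  by rewrite -EFinM /k; congr EFin; rewrite [RHS]mulrC [RHS]mulrA.
have k4 : 4 * k = e * nc (g (x +i* y)) ^+ 2 / (8 * 64).
  by rewrite /k; move: (nc _ ^+ 2) => q; field.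
have sub a b c d : x - e <= a -> b <= x + e -> y - e <= c -> d <= y + e ->
    (`[a, b] : set MR) `*` (`[c, d] : set MR) `<=` @disc2 R.
  move=> h1 h2 h3 h4 [u v] [] /=; rewrite !in_itv/= => /andP[u1 u2] /andP[v1 v2].
  apply: in1; apply/andP; split; [exact: le_trans u1|exact: le_trans h2|
    exact: le_trans v1|exact: le_trans h4].
pose A u := \int[mu]_(v in `[y - e, y + e]) nc (g (u +i* v)) ^+ 2.
pose B v := \int[mu]_(u in `[x - e, x + e]) nc (g (u +i* v)) ^+ 2.
move: k k0 kE k4 => k k0 kE k4.
have caseA a b : b - a = e / 2 -> x - e <= a -> b <= x + e ->
    (forall u, a <= u <= b -> k <= A u) ->
  ((e / 2 * (e / (8 * 64) / 4) * nc (g (x +i* y)) ^+ 2)%:E <= \int[(mu \x mu)%E]_(p in @disc2 R) F p)%E.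
  move=> ba xa bx H; rewrite (kE a b)//.
  have S := sub a b (y - e) (y + e) xa bx (lexx _) (lexx _).
  pose S0 := (`[a, b] : set MR) `*` (`[y - e, y + e] : set MR).
  have mS : measurable_fun S0 F.
    by apply: measurable_funS mF; [exact: measurable_disc2|exact: S].
  apply: (@le_trans _ _ (\int[(mu \x mu)%E]_(p in S0) F p)%E).
    apply: slice_lower_x => //.
    move=> u; rewrite /= in_itv/= => /andP[hu1 hu2].
    have hu' : x - e <= u <= x + e by rewrite (le_trans xa hu1) (le_trans hu2 bx).
      have := H u; rewrite hu1 hu2 => /(_ isT); rewrite -lee_fin /A /Rintegral fineK//.
      exact: (integrable_fin_num (measurable_seg _ _) (Iy u hu')).
  apply: ge0_subset_integral => //; [|exact: measurable_disc2].
  by apply: measurableX; exact: measurable_itv.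
have caseB a b : b - a = e / 2 -> y - e <= a -> b <= y + e ->
    (forall v, a <= v <= b -> k <= B v) ->
  ((e / 2 * (e / (8 * 64) / 4) * nc (g (x +i* y)) ^+ 2)%:E <= \int[(mu \x mu)%E]_(p in @disc2 R) F p)%E.
  move=> ba ya b_y H; rewrite (kE a b)//.
  have S := sub (x - e) (x + e) a b (lexx _) (lexx _) ya b_y.
  pose S0 := (`[x - e, x + e] : set MR) `*` (`[a, b] : set MR).
  have mS : measurable_fun S0 F.
    by apply: measurable_funS mF; [exact: measurable_disc2|exact: S].
  apply: (@le_trans _ _ (\int[(mu \x mu)%E]_(p in S0) F p)%E).
    apply: slice_lower_y => //.
    move=> v; rewrite /= in_itv/= => /andP[hv1 hv2].
    have hv' : y - e <= v <= y + e by rewrite (le_trans ya hv1) (le_trans hv2 b_y).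
      have := H v; rewrite hv1 hv2 => /(_ isT); rewrite -lee_fin /B /Rintegral fineK//.
      exact: (integrable_fin_num (measurable_seg _ _) (Ix v hv')).
  apply: ge0_subset_integral => //; [|exact: measurable_disc2].
  by apply: measurableX; exact: measurable_itv.
have dich (P : R -> R) a b : (forall u, a <= u <= b -> k <= P u) \/
    exists2 u, a <= u <= b & P u < k.
  have [H|/existsNP[u /not_implyP[hu /negP]]] := pselect (forall u, a <= u <= b -> k <= P u).
    by left.
  by rewrite -ltNge => Pu; right; exists u.
have l1 t : t - e / 2 - (t - e) = e / 2 by field.
have l2 t : t + e - (t + e / 2) = e / 2 by field.
have l3 t : t - e / 2 <= t + e by clear -e0; lra.
have l4 t : t - e <= t + e / 2 by clear -e0; lra.
(* each side either is at least k on its whole interval, which ends the proof, or has a position where it is below k *)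
have [/caseA|[x1 hx1 X1]] := dich A (x - e) (x - e / 2); first exact.
have [/caseA|[x2 hx2 X2]] := dich A (x + e / 2) (x + e); first exact.
have [/caseB|[y1 hy1 Y1]] := dich B (y - e) (y - e / 2); first exact.
have [/caseB|[y2 hy2 Y2]] := dich B (y + e / 2) (y + e); first exact.
have := low _ _ _ _ hx1 hx2 hy1 hy2.
rewrite -k4 -/(A x1) -/(A x2) -/(B y1) -/(B y2) => {}low; exfalso.
clear -low X1 X2 Y1 Y2; move: low X1 X2 Y1 Y2.
by move: (A x1) (A x2) (B y1) (B y2) => q1 q2 q3 q4; lra.
Qed.

(** A form of the sub-mean value property of |g|^2, with a constant depending
    only on r. *)
Lemma area_estimate r : 0 <= r -> r < 1 -> exists2 c, 0 < c & forall g w,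
  holomorphic_on_disc g -> nc w <= r ->
  ((c * nc (g w) ^+ 2)%:E <=
   \int[area R]_(p in @disc2 R) (nc (g (p.1 +i* p.2)) ^+ 2)%:E)%E.
Proof.
move=> r0 r1; pose e := (1 - r) / 4.
have e0 : 0 < e by rewrite divr_gt0// subr_gt0.
have r2 : r + 2 * e < 1 by rewrite /e; lra.
clearbody e; exists (pi^-1 * (e / 2 * (e / (8 * 64) / 4))).
  by rewrite mulr_gt0 ?invr_gt0 ?pi_gt0// !mulr_gt0// ?divr_gt0.
move=> g w hg wr.
rewrite area_integral; [|exact: hol_measurable|by move=> p; exact: sqr_ge0].
rewrite -(mulrA pi^-1) EFinM; apply: lee_wpmul2l; first by rewrite lee_fin invr_ge0 pi_ge0.
have wE : w = Re w +i* Im w by case: (w).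
rewrite {1}wE; apply: square_integral_ge => // u v /andP[u1 u2] /andP[v1 v2].
have -> : u +i* v = w + (u - Re w) +i* (v - Im w).
  by apply: complex_eq; rewrite ?Re_add ?Im_add /= addrC subrK.
apply: le_lt_trans _ r2; apply: (@square_in_disc _ _ e); first by rewrite addrK.
  by rewrite lerBrDl u1 lerBlDl.
by rewrite lerBrDl v1 lerBlDl.
Qed.

End AreaEstimateFinal.

(** * The Dirichlet space *)

Section DirichletSpace.
Variable R : realType.
Local Notation MR := (measurableTypeR R).
Implicit Types (f g u : R[i] -> R[i]) (r c x : R) (w z : R[i]).

(** The part of the squared norm carried by the derivative. *)
Definition energy f : \bar R :=
  (\int[area R]_(p in @disc2 R) (nc (cderiv f (p.1 +i* p.2)) ^+ 2)%:E)%E.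

Lemma dirichlet_normsqE f : dirichlet_normsq f = ((nc (f 0) ^+ 2)%:E + energy f)%E.
Proof. by []. Qed.

Lemma energy_ge0 f : (0 <= energy f)%E.
Proof. by apply: integral_ge0 => p _; rewrite lee_fin sqr_ge0. Qed.

Lemma dirichletP f : dirichlet f <-> holomorphic_on_disc f /\ (energy f < +oo)%E.
Proof.
rewrite /dirichlet /= dirichlet_normsqE.
split=> -[hf H]; split => //; last by rewrite lte_add_pinfty// ltry.
by apply: le_lt_trans H; rewrite leeDr// lee_fin sqr_ge0.
Qed.

Lemma dirichlet_hol f : dirichlet f -> holomorphic_on_disc f.
Proof. by case. Qed.

Lemma dirichlet_energy f : dirichlet f -> energy f = (fine (energy f))%:E.
Proof.
by move=> /dirichletP[_ H]; rewrite fineK// ge0_fin_numE ?energy_ge0.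
Qed.

Lemma dirichlet_norm_ge0 f : 0 <= dirichlet_norm f.
Proof. exact: sqrtr_ge0. Qed.

Lemma dirichlet_norm_sq f : dirichlet f ->
  dirichlet_norm f ^+ 2 = nc (f 0) ^+ 2 + fine (energy f).
Proof.
move=> Df; rewrite /dirichlet_norm sqr_sqrtr; last first.
  by rewrite fine_ge0// dirichlet_normsqE adde_ge0 ?energy_ge0// lee_fin sqr_ge0.
by rewrite dirichlet_normsqE (dirichlet_energy Df) -EFinD.
Qed.

Lemma dirichlet_norm_le f x : dirichlet f -> 0 <= x ->
  (nc (f 0) ^+ 2 + fine (energy f) <= x ^+ 2) = (dirichlet_norm f <= x).
Proof.
move=> Df x0; rewrite -dirichlet_norm_sq//.
by rewrite ler_pXn2r// nnegrE dirichlet_norm_ge0.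
Qed.

Lemma dirichlet_bound f x a b : holomorphic_on_disc f -> 0 <= x ->
  nc (f 0) ^+ 2 <= a -> (energy f <= b%:E)%E -> a + b <= x ^+ 2 ->
  dirichlet f /\ dirichlet_norm f <= x.
Proof.
move=> hf x0 fa fb abx.
have Df : dirichlet f by apply/dirichletP; split => //; exact: le_lt_trans fb (ltry _).
split => //; rewrite -dirichlet_norm_le//; apply: le_trans abx; apply: lerD => //.
by rewrite -lee_fin -dirichlet_energy.
Qed.

Lemma measurable_cderiv_sq f : holomorphic_on_disc f ->
  measurable_fun (@disc2 R) (fun p => (nc (cderiv f (p.1 +i* p.2)) ^+ 2)%:E).
Proof. by move=> hf; apply/measurable_EFinP; apply: hol_measurable; exact: cderiv_hol. Qed.

Lemma energy_le f (G : MR * MR -> R) : holomorphic_on_disc f ->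
  measurable_fun (@disc2 R) G ->
  (forall p, disc2 p -> nc (cderiv f (p.1 +i* p.2)) ^+ 2 <= G p) ->
  (energy f <= \int[area R]_(p in @disc2 R) (G p)%:E)%E.
Proof.
move=> hf mG fG; apply: ge0_le_integral => //.
- exact: measurable_disc2.
- by move=> p _; rewrite lee_fin sqr_ge0.
- exact: measurable_cderiv_sq.
- exact/measurable_EFinP.
Qed.

Lemma area_rect a b c d : a <= b -> c <= d ->
  area R ((`[a, b] : set MR) `*` (`[c, d] : set MR)) =
  (pi^-1 * ((b - a) * (d - c)))%:E.
Proof.
move=> ab cd.
pose S := (`[a, b] : set MR) `*` (`[c, d] : set MR).
transitivity ((pi^-1)%:E * (@lebesgue_measure R \x @lebesgue_measure R) S)%E; first by [].
rewrite product_measure1E; [|exact: measurable_seg|exact: measurable_seg].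
by rewrite 2!EFinM; congr (_ * (_ * _))%E; exact: measure_seg.
Qed.

(** The bound for f' is the area estimate applied to f', and the bound for f
    follows by integrating from 0. *)
Lemma point_eval_bound r : 0 <= r -> r < 1 -> exists2 c, 0 <= c & forall f w,
  dirichlet f -> nc w <= r ->
  nc (f w) <= c * dirichlet_norm f /\ nc (cderiv f w) <= c * dirichlet_norm f.
Proof.
move=> r0 r1; have [c c0 H] := area_estimate r0 r1.
pose k := Num.sqrt c^-1; have k0 : 0 <= k by exact: sqrtr_ge0.
exists (1 + k); first by rewrite addr_ge0.
move=> f w Df wr.
have dk z : nc z <= r -> nc (cderiv f z) <= k * dirichlet_norm f.
  move=> zr; rewrite -(@ler_pXn2r _ 2)// ?nnegrE ?nc_ge0 ?mulr_ge0 ?dirichlet_norm_ge0//.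
  have ci : 0 <= c^-1 by rewrite invr_ge0 ltW.
  have cN : c * nc (cderiv f z) ^+ 2 <= dirichlet_norm f ^+ 2.
    rewrite dirichlet_norm_sq//; apply: ler_wpDl; first exact: sqr_ge0.
    rewrite -lee_fin -dirichlet_energy//.
    by apply: H => //; apply: cderiv_hol; exact: dirichlet_hol.
  rewrite exprMn (sqr_sqrtr ci); apply: le_trans (ler_wpM2l ci cN).
  by rewrite mulrA mulVf ?mul1r// gt_eqF.
have N0 := dirichlet_norm_ge0 f.
split; last by apply: le_trans (dk w wr) _; rewrite ler_wpM2r// lerDr.
have f0 : nc (f 0) <= dirichlet_norm f.
  rewrite -(@ler_pXn2r _ 2)// ?nnegrE ?nc_ge0// dirichlet_norm_sq//.
  by rewrite lerDl fine_ge0// energy_ge0.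
rewrite -[f w](subrK (f 0)) (le_trans (ncD _ _))// addrC mulrDl mul1r lerD//.
have -> : f w - f 0 = f (0 + w) - f 0 by rewrite add0r.
apply: (@le_trans _ _ (k * dirichlet_norm f * nc w)).
  apply: mean_value_le => t t01.
  have tw : nc (0 + t%:C * w) <= r by apply: nc_segment; rewrite ?nc0 ?add0r.
  exists (cderiv f (0 + t%:C * w)); last exact: dk.
  by apply: hol_is_cder; [exact: dirichlet_hol|exact: le_lt_trans r1].
by rewrite ler_piMr ?mulr_ge0// (le_trans wr)// ltW.
Qed.

End DirichletSpace.

(** * Weighted composition with a multiplier symbol *)

Section Sufficiency.
Variable R : realType.
Local Notation MR := (measurableTypeR R).
Implicit Types (f g u phi : R[i] -> R[i]) (r c x a b : R) (w z : R[i]).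

Lemma hol_cst w : holomorphic_on_disc (fun=> w).
Proof. by apply: holomorphic_of_is_cder => z _; exists 0; exact: is_cder_cst. Qed.

Lemma hol_mul f g : holomorphic_on_disc f -> holomorphic_on_disc g ->
  holomorphic_on_disc (fun z => f z * g z).
Proof.
move=> hf hg; apply: holomorphic_of_is_cder => z z1.
by eexists; apply: is_cderM; exact: hol_is_cder.
Qed.

Lemma hol_comp f phi : holomorphic_on_disc f -> analytic_self_map phi ->
  holomorphic_on_disc (fun z => f (phi z)).
Proof.
move=> hf [hphi phi1]; apply: holomorphic_of_is_cder => z z1.
by eexists; apply: (is_cder_comp (hol_is_cder hphi z1)); apply: hol_is_cder => //; exact: phi1.
Qed.

Lemma energy_comb f g a b : holomorphic_on_disc f -> holomorphic_on_disc g ->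
  0 <= a -> 0 <= b ->
  (\int[area R]_(p in @disc2 R)
     (a * nc (cderiv f (p.1 +i* p.2)) ^+ 2 + b * nc (cderiv g (p.1 +i* p.2)) ^+ 2)%:E =
   a%:E * energy f + b%:E * energy g)%E.
Proof.
move=> hf hg a0 b0; have mD := @measurable_disc2 R.
have mf := measurable_cderiv_sq hf; have mg := measurable_cderiv_sq hg.
have f0 h (p : MR * MR) : (0 <= (nc (cderiv h (p.1 +i* p.2)) ^+ 2)%:E)%E.
  by rewrite lee_fin sqr_ge0.
transitivity (\int[area R]_(p in @disc2 R)
   (a%:E * (nc (cderiv f (p.1 +i* p.2)) ^+ 2)%:E +
    b%:E * (nc (cderiv g (p.1 +i* p.2)) ^+ 2)%:E))%E; first by [].
rewrite ge0_integralD//; last 4 first.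
- by move=> p _; rewrite mule_ge0.
- exact: (measurable_funeM a%:E mf).
- by move=> p _; rewrite mule_ge0.
- exact: (measurable_funeM b%:E mg).
have Z h k : measurable_fun (@disc2 R) (fun p => (nc (cderiv h (p.1 +i* p.2)) ^+ 2)%:E) ->
    0 <= k -> (\int[area R]_(p in @disc2 R) (k%:E * (nc (cderiv h (p.1 +i* p.2)) ^+ 2)%:E) =
      k%:E * energy h)%E.
  by move=> mh k0; apply: ge0_integralZl_EFin => // p _; exact: f0.
by congr (_ + _)%E; exact: Z.
Qed.

Let sq_split (q k s t : R) : 0 <= q -> q <= k * (t + 2 * s) ->
  q ^+ 2 <= k ^+ 2 * 8 * s ^+ 2 + k ^+ 2 * 2 * t ^+ 2.
Proof.
move=> q0 qk.
have -> : k ^+ 2 * 8 * s ^+ 2 + k ^+ 2 * 2 * t ^+ 2 =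
  (k * (t + 2 * s)) ^+ 2 + k ^+ 2 * (t - 2 * s) ^+ 2 by ring.
apply: ler_wpDr; first by rewrite mulr_ge0 ?sqr_ge0.
by rewrite ler_pXn2r ?nnegrE// (le_trans q0).
Qed.

Lemma dirichlet_energy_real f : dirichlet f ->
  exists2 x : R, energy f = x%:E & 0 <= x.
Proof.
move=> Df; exists (fine (energy f)); first exact: dirichlet_energy.
by apply: fine_ge0; exact: energy_ge0.
Qed.

(** With N the norm of f, the product rule and the identity
    u phi' = (u phi)' - u' phi give
    |(u f(phi))'| <= c N (|(u phi)'| + 2 |u'|) pointwise. *)
Lemma wcomp_bounded u phi r : dirichlet u -> dirichlet (fun z => u z * phi z) ->
  analytic_self_map phi -> 0 <= r -> r < 1 ->
  (forall z, nc z < 1 -> nc (phi z) <= r) ->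
  bounded_on_dirichlet (wcomp u phi).
Proof.
move=> Du Dup sphi r0 r1 phir; have [hphi phi1] := sphi.
have [c c0 H] := point_eval_bound r0 r1.
have hu := dirichlet_hol Du; have hup := dirichlet_hol Dup.
have [eu euE eu0] := dirichlet_energy_real Du.
have [ep epE ep0] := dirichlet_energy_real Dup.
pose k := nc (u 0) ^+ 2 + (8 * eu + 2 * ep).
have k0 : 0 <= k.
  apply: addr_ge0; first exact: sqr_ge0.
  by apply: addr_ge0; apply: mulr_ge0.
exists (c * Num.sqrt k) => f Df; have hf := dirichlet_hol Df.
set N := dirichlet_norm f; have N0 : 0 <= N by exact: dirichlet_norm_ge0.
have hW : holomorphic_on_disc (wcomp u phi f) := hol_mul hu (hol_comp hf sphi).
have cN : 0 <= c * N by rewrite mulr_ge0.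
apply: (@dirichlet_bound _ _ _ ((c * N) ^+ 2 * nc (u 0) ^+ 2)
  ((c * N) ^+ 2 * 8 * eu + (c * N) ^+ 2 * 2 * ep)) => //.
- by rewrite !mulr_ge0 ?sqrtr_ge0.
- have z1 : nc (0 : R[i]) < 1 by rewrite nc0.
  rewrite /wcomp ncM -exprMn mulrC ler_pXn2r ?nnegrE ?mulr_ge0 ?nc_ge0//.
  by apply: ler_wpM2r; [exact: nc_ge0|exact: (H f (phi 0) Df (phir _ z1)).1].
- pose G (p : MR * MR) := (c * N) ^+ 2 * 8 * nc (cderiv u (p.1 +i* p.2)) ^+ 2 +
     (c * N) ^+ 2 * 2 * nc (cderiv (fun z => u z * phi z) (p.1 +i* p.2)) ^+ 2.
  have := @energy_le _ (wcomp u phi f) G hW.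
  rewrite energy_comb//; try by rewrite mulr_ge0 ?sqr_ge0.
  rewrite euE epE -!EFinM -EFinD; apply.
    apply: measurable_funD; apply: measurable_funM; try exact: measurable_cst;
      by apply: hol_measurable; exact: cderiv_hol.
  move=> p p1; set z := p.1 +i* p.2; have z1 : nc z < 1 by exact: p1.
  have ud := hol_is_cder hu z1; have pd := hol_is_cder hphi z1.
  have fd := hol_is_cder hf (phi1 z z1).
  have Wd := is_cder_cderiv (is_cderM ud (is_cder_comp pd fd)).
  have upd := is_cder_cderiv (is_cderM ud pd).
  rewrite -[wcomp u phi f]/(fun z => u z * f (phi z)) Wd.
  have [fb fb'] := H f (phi z) Df (phir z z1); rewrite -/N in fb fb'.
  have -> : u z * (cderiv f (phi z) * cderiv phi z) + f (phi z) * cderiv u z =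
     cderiv f (phi z) * cderiv (fun z => u z * phi z) z + (f (phi z) - cderiv f (phi z) * phi z) * cderiv u z.
    rewrite upd.
    move: (cderiv f (phi z)) => d1; move: (f (phi z)) => d2.
    move: (cderiv phi z) (cderiv u z) (u z) (phi z) => z2 z3 z4 z5.
    by ring.
  have pz1 : nc (phi z) <= 1 by apply: le_trans (phir z z1) (ltW r1).
  have B : nc (cderiv f (phi z) * cderiv (fun z => u z * phi z) z + (f (phi z) - cderiv f (phi z) * phi z) * cderiv u z) <=
     c * N * (nc (cderiv (fun z => u z * phi z) z) + 2 * nc (cderiv u z)).
    apply: le_trans (ncD _ _) _; rewrite mulrDr; apply: lerD.
      by rewrite ncM ler_wpM2r ?nc_ge0.
    rewrite ncM mulrA ler_wpM2r ?nc_ge0//.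
    apply: le_trans (ncBle _ _) _; rewrite ncM mulr_natr mulr2n; apply: lerD => //.
    by apply: le_trans fb'; rewrite ler_piMr ?nc_ge0.
  exact: sq_split (nc_ge0 _) B.
- have -> : (c * N) ^+ 2 * nc (u 0) ^+ 2 +
    ((c * N) ^+ 2 * 8 * eu + (c * N) ^+ 2 * 2 * ep) =
    (c * N) ^+ 2 * k by rewrite /k; ring.
  by rewrite (mulrAC c) (exprMn _ (c * N)) sqr_sqrtr.
Qed.

Lemma cderiv_id z : cderiv id z = 1.
Proof. exact: is_cder_cderiv (is_cder_id z). Qed.

(** The disc lies in the square [-1, 1]^2, of area 4. *)
Lemma area_disc_le : (area R (@disc2 R) <= (4 / pi)%:E)%E.
Proof.
pose S0 := (`[-1, 1] : set MR) `*` (`[-1, 1] : set MR).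
have S : @disc2 R `<=` S0.
  move=> [x y] /= xy1; have H1 := nc_geRe (x +i* y); have H2 := nc_geIm (x +i* y).
  by split; rewrite /= in_itv/= -ler_norml; apply: le_trans (ltW xy1).
have n11 : -1 <= 1 :> R by lra.
have E : area R S0 = (4 / pi)%:E.
  by rewrite (area_rect n11 n11); congr EFin; ring.
have L : (area R (@disc2 R) <= area R S0)%E.
  apply: le_measure; rewrite ?inE//; first exact: measurable_disc2.
  by apply: measurableX; exact: measurable_seg.
by rewrite E in L.
Qed.

Lemma dirichlet_id : dirichlet (@id R[i]).
Proof.
apply/dirichletP; split; first by apply: holomorphic_of_is_cder => z _; exists 1; exact: is_cder_id.
apply: le_lt_trans (ltry (4 / pi)); apply: le_trans area_disc_le.
rewrite -[leRHS]mul1e -integral_cst//; last exact: measurable_disc2.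
apply: ge0_le_integral.
- exact: measurable_disc2.
- by move=> p _; rewrite lee_fin sqr_ge0.
- by apply: measurable_cderiv_sq; apply: holomorphic_of_is_cder => z _; exists 1; exact: is_cder_id.
- exact: measurable_cst.
by move=> p _; rewrite cderiv_id nc1 expr1n.
Qed.


End Sufficiency.

(** * Test functions with large point values *)

Section TestFunctions.
Variable R : realType.
Local Notation MR := (measurableTypeR R).
Implicit Types (f g : R[i] -> R[i]) (r x b d : R) (w z xi ze c : R[i]) (n m k N : nat).

Lemma dirichletZ c f : dirichlet f ->
  dirichlet (fun z => c * f z) /\ dirichlet_norm (fun z => c * f z) <= nc c * dirichlet_norm f.
Proof.
move=> Df; have hf := dirichlet_hol Df; have [e eE e0] := dirichlet_energy_real Df.
have hc : holomorphic_on_disc (fun z => c * f z) := hol_mul (@hol_cst _ c) hf.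
have dE z : nc z < 1 -> cderiv (fun z => c * f z) z = c * cderiv f z.
  by move=> z1; apply: is_cder_cderiv; apply: is_cderZ; exact: hol_is_cder.
have Ec : (energy (fun z => c * f z)%R <= (nc c ^+ 2 * e)%:E)%E.
  pose G (p : MR * MR) := nc c ^+ 2 * nc (cderiv f (p.1 +i* p.2)) ^+ 2
    + 0 * nc (cderiv f (p.1 +i* p.2)) ^+ 2.
  have := energy_le (G := G) hc.
  rewrite energy_comb ?sqr_ge0// eE mul0e adde0 -EFinM; apply.
    apply: measurable_funD; apply: measurable_funM; try exact: measurable_cst;
      by apply: hol_measurable; exact: cderiv_hol.
  by move=> p p1; rewrite /G mul0r addr0 dE// ncM exprMn.
have N0 := dirichlet_norm_ge0 f.
apply: (dirichlet_bound hc _ (lexx _) Ec); first by rewrite mulr_ge0 ?nc_ge0.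
by rewrite ncM !exprMn -mulrDr dirichlet_norm_sq// eE.
Qed.

Lemma is_cder_scaleX xi z n :
  is_cder (fun z => (xi * z) ^+ n.+1) z (n.+1%:R * (xi * (xi * z) ^+ n)).
Proof.
have H1 : is_cder (fun z => xi * z) z xi.
  by rewrite -[X in is_cder _ _ X]mulr1; apply: is_cderZ; exact: is_cder_id.
elim: n => [|n IH]; first by rewrite expr0 mul1r mulr1; exact: H1.
have H2 := is_cderM H1 IH.
have E : n.+2%:R * (xi * (xi * z) ^+ n.+1) =
    xi * z * (n.+1%:R * (xi * (xi * z) ^+ n)) + (xi * z) ^+ n.+1 * xi.
  rewrite -[n.+2%:R]natr1 exprS; move: (_ ^+ n) n.+1%:R => p s; ring.
by rewrite E.
Qed.

(** The N-th Taylor polynomial of -log(1 - xi z). *)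
Fixpoint logpoly xi N z : R[i] :=
  if N is n.+1 then logpoly xi n z + (n.+1%:R)^-1 * (xi * z) ^+ n.+1 else 0.

Lemma is_cder_logpoly xi N z :
  is_cder (logpoly xi N) z (xi * \sum_(i < N) (xi * z) ^+ i).
Proof.
elim: N => [|n IH]; first by rewrite big_ord0 mulr0; exact: is_cder_cst.
have := is_cderD IH (is_cderZ (n.+1%:R)^-1 (is_cder_scaleX xi z n)).
rewrite mulrA mulVf ?pnatr_eq0// mul1r.
by rewrite big_ord_recr/= mulrDr.
Qed.

Lemma nc_geom_le w N : nc w <= 1 -> nc (\sum_(i < N) w ^+ i) <= N%:R.
Proof.
move=> w1; elim: N => [|n IH]; first by rewrite big_ord0 nc0.
rewrite big_ord_recr/= (le_trans (ncD _ _))// -natr1 lerD// ncX.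
by rewrite exprn_ile1// nc_ge0.
Qed.

(** The geometric sum times 1 - w is 1 - w^N. *)
Lemma nc_geom_dist_le w N : nc w <= 1 -> nc (\sum_(i < N) w ^+ i) * nc (1 - w) <= 2.
Proof.
move=> w1; rewrite -ncM mulrC -[1 - w]opprB mulNr -subrX1 ncN.
apply: le_trans (ncBle _ _) _; rewrite nc1 ncX.
have : nc w ^+ N <= 1 by rewrite exprn_ile1// nc_ge0.
lra.
Qed.

(** Concentric squares of half side 4/2^k; the disc lies in the one with k = 0
    when |ze| = 1. *)
Definition dsquare ze k : set (MR * MR) :=
  (`[Re ze - 4 / 2 ^+ k, Re ze + 4 / 2 ^+ k] : set MR) `*`
  (`[Im ze - 4 / 2 ^+ k, Im ze + 4 / 2 ^+ k] : set MR).

Fixpoint dyadic ze m (p : MR * MR) : R :=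
  if m is m'.+1 then dyadic ze m' p + 4 ^+ m'.+1 * \1_(dsquare ze m'.+1) p
  else \1_(dsquare ze 0) p.

Lemma dyadic_ge0 ze m p : 0 <= dyadic ze m p.
Proof. by elim: m => [//|m IH] /=; rewrite addr_ge0// mulr_ge0// exprn_ge0. Qed.

Lemma measurable_dsquare ze k : measurable (dsquare ze k).
Proof. by apply: measurableX; exact: measurable_seg. Qed.

Lemma measurable_dyadic ze m (D : set (MR * MR)) : measurable_fun D (dyadic ze m).
Proof.
apply: measurable_funTS; elim: m => [|m IH] /=.
  by apply: measurable_indic; exact: measurable_dsquare.
apply: measurable_funD => //; apply: measurable_funM; first exact: measurable_cst.
by apply: measurable_indic; exact: measurable_dsquare.
Qed.

Lemma dsquareP ze k p : (forall t : R, t \in [:: `|p.1 - Re ze|; `|p.2 - Im ze|] -> t <= 4 / 2 ^+ k) <-> dsquare ze k p.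
Proof.
have D (a b t : R) : (`|a - b| <= t) = (b - t <= a <= b + t) by rewrite ler_distl.
split=> [H|[]] /=.
  by split; rewrite /= in_itv/= -D; apply: H; rewrite !inE eqxx ?orbT.
rewrite !in_itv/= -!D => h1 h2 t; rewrite !inE => /orP[]/eqP -> //.
Qed.

(** A function bounded by 2^m and by 2/d, where d is the distance to ze, is
    dominated on dyadic scales: if k is the largest index up to m with p in the
    k-th square then b^2 <= 4^k. *)
Lemma dyadic_ge ze m p b d : dsquare ze 0 p -> `|p.1 - Re ze| <= d -> `|p.2 - Im ze| <= d ->
  0 <= b -> b * d <= 2 -> b <= 2 ^+ m -> b ^+ 2 <= dyadic ze m p.
Proof.
move=> p0 d1 d2 b0 bd; elim: m => [|m IH] /= bm.
  by rewrite indicE mem_set// exprn_ile1.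
have [pm|pm] := pselect (dsquare ze m.+1 p).
  rewrite indicE mem_set// mulr1; apply: ler_wpDl; first exact: dyadic_ge0.
  have -> : (4 : R) ^+ m.+1 = (2 ^+ m.+1) ^+ 2 by rewrite -exprM mulnC exprM; congr (_ ^+ _); ring.
  by rewrite ler_pXn2r// nnegrE// exprn_ge0.
apply: ler_wpDr; first by rewrite mulr_ge0// exprn_ge0.
apply: IH; rewrite leNgt; apply/negP => bm'; apply: pm; apply/dsquareP => t.
have P0 : 0 < (2 : R) ^+ m by rewrite exprn_gt0.
have dd : d <= 4 / 2 ^+ m.+1.
  rewrite exprS invfM mulrA (_ : 4 / 2 = 2 :> R); last by field.
  rewrite ler_pdivlMr//.
  have d0 : 0 <= d by exact: le_trans d1.
  by apply: le_trans bd; rewrite mulrC ler_wpM2r// ltW.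
by rewrite !inE => /orP[]/eqP ->; [exact: le_trans d1 dd|exact: le_trans d2 dd].
Qed.

(** The weight 4^k compensates for the area of the square, so every scale
    contributes a bounded amount. *)
Lemma integral_dsquare_le ze k :
  (\int[area R]_(p in @disc2 R) (4 ^+ k * \1_(dsquare ze k) p)%:E <= 64%:E)%E.
Proof.
have k0 : 0 <= (4 : R) ^+ k by rewrite exprn_ge0.
have P0 : 0 < (2 : R) ^+ k by rewrite exprn_gt0.
have mS := measurable_dsquare ze k.
rewrite (_ : (fun p => _) = (fun p => (4 ^+ k)%:E * (\1_(dsquare ze k) p)%:E)%E)//.
rewrite ge0_integralZl_EFin//; last 2 first.
- exact: measurable_disc2.
- by apply/measurable_EFinP; exact: measurable_indic.
rewrite integral_indic//; last exact: measurable_disc2.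
have L : (area R (dsquare ze k `&` @disc2 R) <= area R (dsquare ze k))%E.
  apply: le_measure; rewrite ?inE//; first by apply: measurableI => //; exact: measurable_disc2.
apply: (@le_trans _ _ ((4 ^+ k)%:E * area R (dsquare ze k))%E).
  by apply: lee_wpmul2l => //; rewrite lee_fin.
have h (t : R) : t - 4 / 2 ^+ k <= t + 4 / 2 ^+ k.
  have : 0 <= 4 / (2 : R) ^+ k by rewrite divr_ge0// ltW.
  by clear; move: (_ / _) => q; lra.
rewrite (area_rect (h _) (h _)) -EFinM lee_fin.
have -> : (4 : R) ^+ k = 2 ^+ k * 2 ^+ k by rewrite -exprMn; congr (_ ^+ _); ring.
have -> : 2 ^+ k * 2 ^+ k * (pi^-1 * ((Re ze + 4 / 2 ^+ k - (Re ze - 4 / 2 ^+ k)) *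
   (Im ze + 4 / 2 ^+ k - (Im ze - 4 / 2 ^+ k)))) = pi^-1 * 64.
  by move: (pi^-1) => q; field; rewrite gt_eqF.
rewrite ler_piMl// invf_le1 ?pi_gt0//; apply: le_trans (pi_ge2 _); lra.
Qed.

Lemma integral_dyadic_le ze m :
  (\int[area R]_(p in @disc2 R) (dyadic ze m p)%:E <= (64 * m.+1%:R)%:E)%E.
Proof.
elim: m => [|m IH].
  by have := integral_dsquare_le ze 0; rewrite expr0 mulr1; under eq_integral do rewrite mul1r.
rewrite (_ : (fun p => _) = (fun p => (dyadic ze m p)%:E + (4 ^+ m.+1 * \1_(dsquare ze m.+1) p)%:E)%E)//.
rewrite ge0_integralD//.
- apply: le_trans (leeD IH (integral_dsquare_le ze m.+1)) _.
  by rewrite -EFinD lee_fin -[m.+2%:R]natr1 mulrDr mulr1.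
- exact: measurable_disc2.
- by move=> p _; rewrite lee_fin dyadic_ge0.
- by apply/measurable_EFinP; exact: measurable_dyadic.
- apply/measurable_EFinP; apply: measurable_funM; first exact: measurable_cst.
  by apply: measurable_indic; exact: measurable_dsquare.
Qed.

(** The derivative of the polynomial with N = 2^m is, up to a unimodular factor, a
    geometric sum in xi z.  It is bounded both by N and by 2/|z - ze|, hence its
    square integral grows only like m = log_2 N. *)
Lemma energy_logpoly xi ze m : nc xi = 1 -> xi * ze = 1 ->
  holomorphic_on_disc (logpoly xi (2 ^ m)) /\
  (energy (logpoly xi (2 ^ m)) <= (64 * m.+1%:R)%:E)%E.
Proof.
move=> x1 xze.
have z1 : nc ze = 1 by rewrite -[nc ze]mul1r -x1 -ncM xze nc1.
have h : holomorphic_on_disc (logpoly xi (2 ^ m)).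
  by apply: holomorphic_of_is_cder => z _; eexists; exact: is_cder_logpoly.
split => //; apply: le_trans (integral_dyadic_le ze m).
apply: energy_le => //; first exact: measurable_dyadic.
move=> p p1; set z := p.1 +i* p.2; have zlt : nc z < 1 by exact: p1.
rewrite (is_cder_cderiv (is_cder_logpoly xi _ z)) ncM x1 mul1r.
have xz : nc (xi * z) <= 1 by rewrite ncM x1 mul1r ltW.
have zd : nc (1 - xi * z) = nc (z - ze).
  have -> : 1 - xi * z = xi * (ze - z).
    by rewrite mulrBr xze.
  by rewrite ncM x1 mul1r ncB.
apply: (@dyadic_ge _ _ _ _ (nc (z - ze))).
- apply/dsquareP => t; rewrite expr0 divr1.
  have zz : nc (z - ze) <= 4 by apply: le_trans (ncBle _ _) _; rewrite z1; lra.
  rewrite !inE => /orP[]/eqP ->; apply: le_trans zz.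
    by have := nc_geRe (z - ze); rewrite Re_add Re_opp.
  by have := nc_geIm (z - ze); rewrite Im_add Im_opp.
- by have := nc_geRe (z - ze); rewrite Re_add Re_opp.
- by have := nc_geIm (z - ze); rewrite Im_add Im_opp.
- exact: nc_ge0.
- by rewrite -zd; exact: nc_geom_dist_le.
- by apply: le_trans (nc_geom_le _ xz) _; rewrite natrX.
Qed.

End TestFunctions.

Section UnboundedEvaluations.
Variable R : realType.
Implicit Types (f g : R[i] -> R[i]) (r x y c : R) (w z xi ze : R[i]) (n m i j N : nat).

Fixpoint rlog x N : R := if N is n.+1 then rlog x n + x ^+ n.+1 / n.+1%:R else 0.

Lemma logpoly_real xi w x N : xi * w = x%:C -> logpoly xi N w = (rlog x N)%:C.
Proof.
move=> E; elim: N => [//|n IH] /=.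
rewrite IH E rmorphD; congr (_ + _).
by rewrite mulrC rmorphM rmorphXn fmorphV rmorph_nat.
Qed.

Lemma rlog_add x N j c : (forall n, (n < N + j)%N -> c <= x ^+ n.+1 / n.+1%:R) ->
  rlog x N + j%:R * c <= rlog x (N + j).
Proof.
elim: j => [|j IH] H; first by rewrite mul0r addr0 addn0.
rewrite addnS /= -natr1 mulrDl mul1r addrA lerD//.
  by apply: IH => n nj; apply: H; rewrite addnS ltnS ltnW.
by apply: H; rewrite addnS.
Qed.

(** Each of the i dyadic blocks of the harmonic sum contributes at least 1/4, as
    long as the powers of x stay above 1/2. *)
Lemma rlog_dyadic x m i : 0 <= x -> x <= 1 -> 2^-1 <= x ^+ (2 ^ m) -> (i <= m)%N ->
  i%:R / 4 <= rlog x (2 ^ i).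
Proof.
move=> x0 x1 xm; elim: i => [|i IH] im.
  by rewrite mul0r /= add0r divr_ge0// exprn_ge0.
have P0 : 0 < (2 : R) ^+ i by rewrite exprn_gt0.
pose c : R := 2^-1 / 2 ^+ i.+1.
have := @rlog_add x (2 ^ i) (2 ^ i) c; rewrite addnn -mul2n -expnS => H.
apply: le_trans (H _) => [|n nN].
  have := IH (ltnW im); rewrite /c exprS natrX -[i.+1%:R]natr1.
  have -> : 2 ^+ i * (2^-1 / (2 * 2 ^+ i)) = 4^-1 :> R by field; rewrite gt_eqF.
  by clear; move: (rlog _ _) (i%:R) => p q; lra.
have n1 : (n.+1 <= 2 ^ m)%N by apply: leq_trans nN _; rewrite leq_pexp2l.
apply: ler_pM => //.
  by apply: le_trans xm _; rewrite ler_wiXn2l.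
by rewrite lef_pV2 ?posrE ?exprn_gt0// -natrX ler_nat.
Qed.

Lemma bernoulli_le y n : 0 <= y -> y <= 1 -> 1 - n%:R * y <= (1 - y) ^+ n.
Proof.
move=> y0 y1; elim: n => [|n IH]; first by rewrite mul0r subr0.
rewrite exprS; apply: le_trans (ler_wpM2l _ IH); last by rewrite subr_ge0.
have -> : (1 - y) * (1 - n%:R * y) = 1 - n.+1%:R * y + n%:R * y ^+ 2.
  by rewrite -[n.+1%:R]natr1; ring.
by rewrite lerDl mulr_ge0// sqr_ge0.
Qed.

(** At points close to ze the polynomial with N = 2^m has a value of order m,
    while its norm is of order sqrt m. *)
Lemma unbounded_point_eval j : exists2 r, r < 1 & forall w, r <= nc w -> nc w < 1 ->
  exists2 f, dirichlet f /\ dirichlet_norm f <= 1 & j.+1%:R / 64 <= nc (f w).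
Proof.
(* m is a square, so that the norm of the polynomial is at most 16 J without square roots *)
pose m := (j.+1 ^ 2)%N; pose J : R := j.+1%:R.
have J1 : 1 <= J by rewrite /J ler1n.
have mJ : m%:R = J ^+ 2 by rewrite /m natrX.
have P0 : 0 < (2 : R) ^+ m by rewrite exprn_gt0.
have P1 : 1 <= (2 : R) ^+ m by rewrite exprn_ege1// ler1n.
pose y : R := (2 * 2 ^+ m)^-1.
have y0 : 0 < y by rewrite invr_gt0 mulr_gt0.
have y1 : y <= 1 by rewrite invf_le1 ?mulr_gt0//; lra.
have y2 : y < 1 by rewrite invf_lt1 ?mulr_gt0//; lra.
exists (1 - y); first by rewrite ltrBlDr ltrDl.
move=> w yw w1; set x := nc w in yw w1 *.
have x0 : 0 < x by apply: lt_le_trans yw; rewrite subr_gt0.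
have w0 : w != 0 by rewrite -nc_gt0.
have xC : x%:C != 0 :> R[i] by rewrite -nc_gt0 ncC gtr0_norm.
pose xi := x%:C / w; pose ze := w / x%:C.
have xiw : xi * w = x%:C by rewrite /xi divfK.
have xize : xi * ze = 1 by rewrite /xi /ze mulrA divfK// mulfV.
have xi1 : nc xi = 1 by rewrite /xi ncM ncV ncC gtr0_norm// mulfV// gt_eqF.
have [hp Ep] := energy_logpoly m xi1 xize.
have low : J ^+ 2 / 4 <= nc (logpoly xi (2 ^ m) w).
  rewrite (logpoly_real _ xiw) ncC; apply: le_trans (ler_norm _).
  rewrite -mJ; apply: (@rlog_dyadic x m m) => //; [exact: ltW|exact: ltW|].
  apply: (@le_trans _ _ ((1 - y) ^+ (2 ^ m))).
    apply: le_trans (bernoulli_le (2 ^ m) (ltW y0) y1).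
    by rewrite natrX /y invfM mulrCA mulfV ?gt_eqF// mulr1; lra.
  by apply: lerXn2r => //; rewrite nnegrE ?subr_ge0// ltW.
have J16 : 0 < 16 * J by lra.
have p0 : nc (logpoly xi (2 ^ m) 0) ^+ 2 <= 0.
  have x00 : xi * 0 = (0 : R)%:C by rewrite mulr0.
  rewrite (logpoly_real _ x00) ncC.
  have -> : rlog 0 (2 ^ m) = 0.
    by elim: (2 ^ m)%N => [//|n IH] /=; rewrite IH expr0n /= mul0r addr0.
  by rewrite normr0 expr0n.
have [Dp Np] : dirichlet (logpoly xi (2 ^ m)) /\ dirichlet_norm (logpoly xi (2 ^ m)) <= 16 * J.
  apply: (dirichlet_bound hp (ltW J16) p0 Ep).
  by rewrite add0r -[m.+1%:R]natr1 mJ; clear -J1; nra.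
have [Df Nf] := dirichletZ ((16 * J)^-1)%:C Dp.
have nJ : nc ((16 * J)^-1)%:C = (16 * J)^-1 by rewrite ncC gtr0_norm// invr_gt0.
exists (fun z => ((16 * J)^-1)%:C * logpoly xi (2 ^ m) z).
  split => //; apply: le_trans Nf _; rewrite nJ mulrC ler_pdivrMr// mul1r.
  exact: Np.
rewrite ncM nJ -/J [leRHS]mulrC ler_pdivlMr//; apply: le_trans low.
by rewrite le_eqVlt; apply/orP; left; apply/eqP; field.
Qed.

End UnboundedEvaluations.

(** * Geometric series in the Dirichlet space *)

Section GeometricSeries.
Variable R : realType.
Local Notation MR := (measurableTypeR R).
Implicit Types (f g u : R[i] -> R[i]) (r x b d e q : R) (z w h : R[i]) (n m i : nat).

(** The way in which limits are taken below: an error e q^n disappears. *)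
Lemma le_geo_limit q x y e : 0 <= q -> q <= 2^-1 -> 0 <= e ->
  (forall n, x <= y + e * q ^+ n) -> x <= y.
Proof.
move=> q0 q1 e0 H; rewrite leNgt; apply/negP => yx.
have xy0 : 0 < x - y by rewrite subr_gt0.
have [n Hn] := exp2_small e xy0.
have qn : q ^+ n <= (2 ^+ n)^-1 by rewrite -exprVn lerXn2r// nnegrE invr_ge0.
have := H n; rewrite -lerBlDl leNgt => /negP; apply.
exact: le_lt_trans (ler_wpM2l e0 qn) Hn.
Qed.

Lemma geo_limit (a : nat -> R) q x : 0 <= q -> q <= 2^-1 -> 0 <= x ->
  (forall n, `|a n.+1 - a n| <= x * q ^+ n) ->
  exists l, forall n, `|l - a n| <= 2 * x * q ^+ n.
Proof.
move=> q0 q1 x0 H.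
pose lo n := a n - 2 * (x * q ^+ n); pose hi n := a n + 2 * (x * q ^+ n).
have xq n : 0 <= x * q ^+ n by rewrite mulr_ge0// exprn_ge0.
have st n : x * q ^+ n.+1 <= 2^-1 * (x * q ^+ n).
  by rewrite exprS mulrCA ler_wpM2r.
have loS n : lo n <= lo n.+1.
  have := H n; have := st n; rewrite /lo ler_norml.
  by clear; move: (x * q ^+ n.+1) (x * q ^+ n) (a n.+1) (a n) => p1 p2 p3 p4; lra.
have hiS n : hi n.+1 <= hi n.
  have := H n; have := st n; rewrite /hi ler_norml.
  by clear; move: (x * q ^+ n.+1) (x * q ^+ n) (a n.+1) (a n) => p1 p2 p3 p4; lra.
have lohi n : lo n <= hi n.
  have := xq n; rewrite /lo /hi.
  by clear; move: (x * q ^+ n) (a n) => p1 p2; lra.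
have [l Hl] := nested_intervals loS hiS lohi.
by exists l => n; rewrite -mulrA ler_distl; exact: Hl.
Qed.

Lemma cgeo_limit (a : nat -> R[i]) q x : 0 <= q -> q <= 2^-1 -> 0 <= x ->
  (forall n, nc (a n.+1 - a n) <= x * q ^+ n) ->
  exists l, forall n, nc (l - a n) <= 4 * x * q ^+ n.
Proof.
move=> q0 q1 x0 H.
have [l1 H1] : exists l, forall n, `|l - Re (a n)| <= 2 * x * q ^+ n.
  apply: geo_limit => // n; apply: le_trans (H n).
  by rewrite -Re_opp -Re_add; exact: nc_geRe.
have [l2 H2] : exists l, forall n, `|l - Im (a n)| <= 2 * x * q ^+ n.
  apply: geo_limit => // n; apply: le_trans (H n).
  by rewrite -Im_opp -Im_add; exact: nc_geIm.
exists (l1 +i* l2) => n; apply: le_trans (nc_leReIm _) _.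
rewrite Re_add Re_opp Im_add Im_opp /=.
have -> : 4 * x * q ^+ n = 2 * x * q ^+ n + 2 * x * q ^+ n by ring.
exact: lerD.
Qed.

(** Monotone convergence for a function dominated by the pointwise supremum of an
    increasing sequence; the domination is expressed by real upper bounds, so the
    supremum may be infinite at some points. *)
Lemma integral_le_monotone (Q : nat -> MR * MR -> R) (G : MR * MR -> R) b :
  measurable_fun (@disc2 R) G -> (forall p, 0 <= G p) ->
  (forall n, measurable_fun (@disc2 R) (Q n)) -> (forall n p, 0 <= Q n p) ->
  (forall n p, Q n p <= Q n.+1 p) ->
  (forall n, (\int[area R]_(p in @disc2 R) (Q n p)%:E <= b%:E)%E) ->
  (forall p x, disc2 p -> (forall n, Q n p <= x) -> G p <= x) ->
  (\int[area R]_(p in @disc2 R) (G p)%:E <= b%:E)%E.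
Proof.
move=> mG G0 mQ Q0 QS Qb GQ.
have mD := @measurable_disc2 R.
have mQE n : measurable_fun (@disc2 R) (fun p => (Q n p)%:E) by exact/measurable_EFinP.
have ndQ p n m : (n <= m)%N -> Q n p <= Q m p.
  by move=> nm; exact: ((nondecreasing_seqP (fun n => Q n p)).1 (fun n => QS n p)).
have ndE p : nondecreasing_seq (fun n => (Q n p)%:E) by move=> n m nm; rewrite lee_fin ndQ.
have cv p : cvgn (fun n => (Q n p)%:E) by exact: ereal_nondecreasing_is_cvgn.
have M : (\int[area R]_(p in @disc2 R) (limn (fun n => (Q n p)%:E)) =
   limn (fun n => \int[area R]_(p in @disc2 R) (Q n p)%:E))%E.
  apply: monotone_convergence => //.
  - by move=> n p _; rewrite lee_fin.
apply: (@le_trans _ _ (\int[area R]_(p in @disc2 R) (limn (fun n => (Q n p)%:E)))%E).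
  apply: ge0_le_integral => //.
  - by move=> p _; rewrite lee_fin.
  - exact/measurable_EFinP.
  - by apply: emeasurable_fun_cvg mQE _ => p _; exact: cv.
  move=> p Dp; have ub n : ((Q n p)%:E <= limn (fun n => (Q n p)%:E))%E.
    apply: lime_ge; first exact: cv.
    by exists n => // m nm; rewrite lee_fin ndQ.
  case E : (limn _) => [x| |].
  - by rewrite lee_fin; apply: GQ => // n; rewrite -lee_fin -E.
  - exact: leey.
  - by have := ub 0%N; rewrite E.
rewrite M; apply: lime_le.
  apply: ereal_nondecreasing_is_cvgn => n m nm; apply: ge0_le_integral => //.
  - by move=> p _; rewrite lee_fin.
  - by move=> p _; rewrite lee_fin ndQ.
by apply: nearW.
Qed.

End GeometricSeries.

Section DirichletSeries.
Variable R : realType.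
Local Notation MR := (measurableTypeR R).
Implicit Types (f g u : R[i] -> R[i]) (r x b d e : R) (z w h : R[i]) (n m i : nat).

(** Partial sums of the series with terms q^i v_i(z); [rsum] is the real
    counterpart. *)
Fixpoint psum (q : R) (v : nat -> R[i] -> R[i]) n z : R[i] :=
  if n is m.+1 then psum q v m z + (q ^+ m)%:C * v m z else 0.

Fixpoint rsum (q : R) (x : nat -> R) n : R :=
  if n is m.+1 then rsum q x m + q ^+ m * x m else 0.

Section FixedRatio.
Variable q : R.
Hypotheses (q0 : 0 <= q) (q1 : q <= 2^-1).

Let qn0 n : 0 <= q ^+ n. Proof. exact: exprn_ge0. Qed.

Let nc_qn n : nc (q ^+ n)%:C = q ^+ n. Proof. by rewrite ncC ger0_norm. Qed.

Lemma psum_step v n z x : nc (v n z) <= x ->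
  nc (psum q v n.+1 z - psum q v n z) <= x * q ^+ n.
Proof. by move=> vx; rewrite /= addrAC subrr add0r ncM nc_qn mulrC ler_wpM2r. Qed.

Lemma rsum_ge0 (x : nat -> R) n : (forall i, 0 <= x i) -> 0 <= rsum q x n.
Proof. by move=> x0; elim: n => [//|n IH] /=; rewrite addr_ge0// mulr_ge0. Qed.

Lemma rsum_cst_le x n : 0 <= x -> rsum q (fun=> x) n <= 2 * x.
Proof.
move=> x0; suff H : rsum q (fun=> x) n <= 2 * x - 2 * (q ^+ n * x).
  by apply: le_trans H _; rewrite gerBl mulr_ge0// mulr_ge0.
elim: n => [|n IH] /=; first by rewrite expr0 mul1r subrr.
apply: le_trans (lerD IH (lexx _)) _.
have : q ^+ n.+1 * x <= 2^-1 * (q ^+ n * x).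
  by rewrite exprS -mulrA ler_wpM2r// mulr_ge0.
by move: (q ^+ n.+1 * x) (q ^+ n * x) => a c; lra.
Qed.

Lemma psum_le v n z (x : nat -> R) : (forall i, nc (v i z) <= x i) ->
  nc (psum q v n z) <= rsum q x n.
Proof.
move=> vx; elim: n => [|n IH]; first by rewrite [psum _ _ _ _]/= nc0.
rewrite /=.
by apply: le_trans (ncD _ _) _; rewrite ncM nc_qn lerD// ler_wpM2l.
Qed.

(** The Cauchy-Schwarz inequality for the weights q^i, whose total mass is at
    most 2. *)
Lemma rsum_sqr_le (x : nat -> R) n : (forall i, 0 <= x i) ->
  rsum q x n ^+ 2 <= 2 * rsum q (fun i => x i ^+ 2) n.
Proof.
move=> x0.
suff H : rsum q x n ^+ 2 <= rsum q (fun=> 1) n * rsum q (fun i => x i ^+ 2) n.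
  apply: le_trans H _; apply: ler_wpM2r; first by apply: rsum_ge0 => i; exact: sqr_ge0.
  by have := @rsum_cst_le 1 n ler01; rewrite mulr1.
elim: n => [|n IH] /=; first by rewrite expr0n mul0r.
set X := rsum q x n in IH *; set W := rsum q (fun=> 1) n in IH *.
set Q := rsum q (fun i => x i ^+ 2) n in IH *.
have W0 : 0 <= W by apply: rsum_ge0.
have Q0 : 0 <= Q by apply: rsum_ge0 => i; exact: sqr_ge0.
have X0 : 0 <= X by apply: rsum_ge0.
have a0 := qn0 n; have b0 := x0 n; move: (q ^+ n) (x n) a0 b0 => a y a0 b0.
have K : 2 * X * y <= W * y ^+ 2 + Q.
  have [W00|Wn0] := eqVneq W 0.
    rewrite W00 mul0r in IH.
    have X00 : X = 0 by apply/eqP; rewrite -sqrf_eq0 eq_le sqr_ge0 andbT.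
    by rewrite W00 X00 mulr0 !mul0r add0r.
  have W1 : 0 < W by rewrite lt_def Wn0.
  rewrite -(ler_pM2l W1) -subr_ge0.
  have -> : W * (W * y ^+ 2 + Q) - W * (2 * X * y) = (W * y - X) ^+ 2 + (W * Q - X ^+ 2) by ring.
  by rewrite addr_ge0 ?sqr_ge0// subr_ge0.
have -> : (X + a * y) ^+ 2 = X ^+ 2 + a * (2 * X * y) + a ^+ 2 * y ^+ 2 by ring.
have -> : (W + a * 1) * (Q + a * y ^+ 2) = W * Q + a * (W * y ^+ 2 + Q) + a ^+ 2 * y ^+ 2 by ring.
by rewrite lerD2r lerD// ler_wpM2l.
Qed.

Variable v : nat -> R[i] -> R[i].
Variable E : R[i] -> R.
Hypothesis Dv : forall i, dirichlet (v i) /\ dirichlet_norm (v i) <= 1.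
Hypothesis vE : forall z, nc z < 1 -> forall i, nc (v i z) <= E z.

Let dv i z := cderiv (v i) z.

Let E_ge0 z : nc z < 1 -> 0 <= E z.
Proof. by move=> z1; apply: le_trans (nc_ge0 (v 0 z)) (vE z1 0%N). Qed.

Let loc_bound r : 0 <= r -> r < 1 -> exists2 c, 0 <= c & forall i w, nc w <= r ->
  nc (v i w) <= c /\ nc (dv i w) <= c.
Proof.
move=> r0 r1; have [c c0 H] := point_eval_bound r0 r1; exists c => // i w wr.
have [Dvi Ni] := Dv i; have [h1 h2] := H (v i) w Dvi wr.
have cN : c * dirichlet_norm (v i) <= c by rewrite ler_piMr.
by split; [exact: le_trans h1 cN|exact: le_trans h2 cN].
Qed.

(** The constant of [taylor2_le] is the same for all terms, so the estimate sums. *)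
Lemma series_taylor r x s z h n : r < 1 -> 0 < s ->
  (forall i w, nc w <= r -> nc (v i w) <= x) ->
  nc z <= r - 4 * s -> nc (z + h) <= r - 4 * s ->
  nc (psum q v n (z + h) - psum q v n z - psum q dv n z * h) <=
    rsum q (fun=> 64 * (64 * x) / s ^+ 2 * nc h ^+ 2) n.
Proof.
move=> r1 s0 vx zr hr; elim: n => [|n IH]; first by rewrite ![psum _ _ 0 _]/= mul0r !subr0 nc0.
rewrite /=.
have -> : psum q v n (z + h) + (q ^+ n)%:C * v n (z + h) - (psum q v n z + (q ^+ n)%:C * v n z) -
    (psum q dv n z + (q ^+ n)%:C * dv n z) * h =
  (psum q v n (z + h) - psum q v n z - psum q dv n z * h) +
  (q ^+ n)%:C * (v n (z + h) - v n z - dv n z * h).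
  move: (psum q v n (z + h)) (psum q v n z) (psum q dv n z) (v n (z + h)) (v n z) (dv n z) ((q ^+ n)%:C).
  by move=> *; ring.
apply: le_trans (ncD _ _) _; apply: lerD => //.
rewrite ncM nc_qn ler_wpM2l//.
by apply: (taylor2_le (dirichlet_hol (Dv n).1) r1 s0 (vx n)).
Qed.

Let lim_v z : exists l, nc z < 1 -> forall n, nc (l - psum q v n z) <= 4 * E z * q ^+ n.
Proof.
have [z1|?] := pselect (nc z < 1); last by exists 0.
have [l Hl] := @cgeo_limit _ (fun n => psum q v n z) q _ q0 q1 (E_ge0 z1)
  (fun n => @psum_step v n z _ (vE z1 n)).
by exists l.
Qed.

Let lim_dv z : exists lx : R[i] * R, nc z < 1 ->
  0 <= lx.2 /\ forall n, nc (lx.1 - psum q dv n z) <= lx.2 * q ^+ n.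
Proof.
have [z1|?] := pselect (nc z < 1); last by exists (0, 0).
have [c c0 H] := loc_bound (nc_ge0 z) z1.
have [l Hl] := @cgeo_limit _ (fun n => psum q dv n z) q _ q0 q1 c0
  (fun n => @psum_step dv n z _ (H n z (lexx _)).2).
by exists (l, 4 * c) => _; split => //; rewrite mulr_ge0.
Qed.

(** The partial sums and their derivatives converge locally uniformly, because
    evaluations of functions and derivatives are locally bounded on the unit ball.
    The uniform Taylor estimate identifies the derivative of the sum, and its
    energy is finite by Cauchy-Schwarz and monotone convergence. *)
Lemma dirichlet_series : exists2 u, dirichlet u &
  forall z, nc z < 1 -> forall n, nc (u z - psum q v n z) <= 4 * E z * q ^+ n.
Proof.
have [u uE] := choice lim_v; have [G GE] := choice lim_dv.
exists u; last exact: uE.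
have ud z : nc z < 1 -> is_cder u z (G z).1.
  move=> z1; pose s := (1 - nc z) / 16; pose r := nc z + 8 * s.
  have s0 : 0 < s by rewrite divr_gt0// subr_gt0.
  have r1 : r < 1 by rewrite /r /s; move: z1; move: (nc z) => a; lra.
  have zr : nc z = r - 8 * s by rewrite /r addrK.
  have r0 : 0 <= r by rewrite /r addr_ge0 ?nc_ge0// mulr_ge0// ltW.
  clearbody r; clearbody s.
  have [c c0 H] := loc_bound r0 r1.
  pose L := 64 * (64 * c) / s ^+ 2.
  have L0 : 0 <= L by apply: divr_ge0; [do 2 apply: mulr_ge0 => //|exact: sqr_ge0].
  have L1 : 0 < 2 * L + 1 by rewrite ltr_wpDl// mulr_ge0.
  have [G0 Gz] := GE z z1.
  move=> e e0; exists (Num.min s (e / (2 * L + 1))); first by rewrite lt_min s0 divr_gt0.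
  move=> h; rewrite lt_min ltr_pdivlMr// => /andP[hs he].
  have zh : nc (z + h) <= r - 4 * s by apply: le_trans (ncD _ _) _; lra.
  have z4 : nc z <= r - 4 * s by lra.
  have zh1 : nc (z + h) < 1 by lra.
  have h0 := nc_ge0 h.
  suff K : nc (u (z + h) - u z - (G z).1 * h) <= 2 * (L * nc h ^+ 2).
    apply: le_trans K _; rewrite expr2 (mulrA L) (mulrA 2 (L * _)) (mulrA 2 L) ler_wpM2r//.
    by apply: le_trans (ltW he); rewrite mulrC ler_wpM2l// lerDl.
  apply: (@le_geo_limit _ q _ _ (4 * E (z + h) + 4 * E z + (G z).2 * nc h)) => //.
    by rewrite !addr_ge0// ?mulr_ge0// E_ge0.
  move=> n.
  have -> : u (z + h) - u z - (G z).1 * h =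
    (psum q v n (z + h) - psum q v n z - psum q dv n z * h) +
    ((u (z + h) - psum q v n (z + h)) - (u z - psum q v n z) - ((G z).1 - psum q dv n z) * h).
    move: (psum q v n (z + h)) (psum q v n z) (psum q dv n z) (u (z + h)) (u z) (G z).1.
    by move=> *; ring.
  apply: le_trans (ncD _ _) _; apply: lerD.
    apply: le_trans (series_taylor n r1 s0 (fun i w wr => (H i w wr).1) z4 zh) _.
    by apply: rsum_cst_le; rewrite mulr_ge0 ?sqr_ge0.
  rewrite (mulrDl (4 * E (z + h) + _)) (mulrDl (4 * E (z + h))).
  apply: le_trans (ncBle _ _) _; apply: lerD.
    by apply: le_trans (ncBle _ _) _; apply: lerD; [exact: (uE _ zh1 n)|exact: (uE _ z1 n)].
  by rewrite ncM mulrAC ler_wpM2r.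
have hu : holomorphic_on_disc u by apply: holomorphic_of_is_cder => z z1; eexists; exact: ud.
apply/dirichletP; split => //; apply: le_lt_trans (ltry 4).
have dvm i : measurable_fun (@disc2 R) (fun p => nc (dv i (p.1 +i* p.2)) ^+ 2).
  by apply: hol_measurable; apply: cderiv_hol; exact: dirichlet_hol (Dv i).1.
pose Q n (p : MR * MR) := 2 * rsum q (fun i => nc (dv i (p.1 +i* p.2)) ^+ 2) n.
have Q0 n p : 0 <= Q n p by rewrite mulr_ge0// rsum_ge0// => i; exact: sqr_ge0.
have mr n : measurable_fun (@disc2 R) (fun p : MR * MR => rsum q (fun i => nc (dv i (p.1 +i* p.2)) ^+ 2) n).
  elim: n => [|n IH] /=; first exact: measurable_cst.
  by apply: measurable_funD => //; apply: measurable_funM => //; exact: measurable_cst.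
apply: (@integral_le_monotone _ Q) => //.
- by apply: hol_measurable; exact: cderiv_hol.
- by move=> p; exact: sqr_ge0.
- by move=> n; apply: measurable_funM => //; exact: measurable_cst.
- by move=> n p; rewrite /Q /= mulrDr lerDl mulr_ge0// mulr_ge0// sqr_ge0.
- move=> n.
  pose S m (p : MR * MR) := rsum q (fun i => nc (dv i (p.1 +i* p.2)) ^+ 2) m.
  have S0 m p : 0 <= S m p by apply: rsum_ge0 => i; exact: sqr_ge0.
  have mD := @measurable_disc2 R.
  have step m : (\int[area R]_(p in @disc2 R) (S m.+1 p)%:E =
      \int[area R]_(p in @disc2 R) (S m p)%:E + (q ^+ m)%:E * energy (v m))%E.
    transitivity (\int[area R]_(p in @disc2 R)
      ((S m p)%:E + (q ^+ m)%:E * (nc (dv m (p.1 +i* p.2)) ^+ 2)%:E))%E; first by [].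
    have mm : measurable_fun (@disc2 R) (fun p => (nc (dv m (p.1 +i* p.2)) ^+ 2)%:E).
      exact/measurable_EFinP.
    rewrite ge0_integralD//.
    - by congr (_ + _)%E; apply: ge0_integralZl_EFin => // p _; rewrite lee_fin sqr_ge0.
    - by move=> p _; rewrite lee_fin.
    - by apply/measurable_EFinP; exact: mr.
    - by move=> p _; rewrite -EFinM lee_fin mulr_ge0// sqr_ge0.
    - exact: (measurable_funeM (q ^+ m)%:E mm).
  have e1 m : (energy (v m) <= 1%:E)%E.
    have [Dm Nm] := Dv m; rewrite dirichlet_energy// lee_fin.
    have := dirichlet_norm_sq Dm.
    have : dirichlet_norm (v m) ^+ 2 <= 1 by rewrite exprn_ile1// dirichlet_norm_ge0.
    have := sqr_ge0 (nc (v m 0)); lra.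
  have I m : (\int[area R]_(p in @disc2 R) (S m p)%:E <= (rsum q (fun=> 1) m)%:E)%E.
    elim: m => [|m IH]; first by rewrite integral0_eq.
    rewrite step /= EFinD; apply: leeD => //.
    by rewrite EFinM; apply: lee_wpmul2l; rewrite ?lee_fin.
  rewrite -[leLHS]/(\int[area R]_(p in @disc2 R) (2%:E * (S n p)%:E))%E.
  rewrite ge0_integralZl_EFin//; last 2 first.
  - by move=> p _; rewrite lee_fin.
  - by apply/measurable_EFinP; exact: mr.
  apply: (@le_trans _ _ (2%:E * (2 : R)%:E)%E).
    apply: lee_wpmul2l; first by rewrite lee_fin.
    apply: le_trans (I n) _; rewrite lee_fin.
    by have := @rsum_cst_le 1 n ler01; rewrite mulr1.
  by rewrite -EFinM lee_fin; lra.
move=> p x p1 Qx; set z := p.1 +i* p.2; have z1 : nc z < 1 by exact: p1.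
rewrite (is_cder_cderiv (ud z z1)).
have x0 : 0 <= x by apply: le_trans (Q0 0%N p) (Qx 0%N).
rewrite -[x]sqr_sqrtr// ler_pXn2r ?nnegrE ?nc_ge0 ?sqrtr_ge0//.
have [G0 Gz] := GE z z1.
apply: (le_geo_limit q0 q1 G0) => n.
rewrite -[(G z).1](subrK (psum q dv n z)) addrC; apply: le_trans (ncD _ _) _.
apply: lerD; last exact: Gz.
rewrite -(@ler_pXn2r _ 2)// ?nnegrE ?nc_ge0 ?sqrtr_ge0// sqr_sqrtr//.
apply: le_trans (Qx n).
have n0 i : 0 <= nc (dv i z) by exact: nc_ge0.
apply: le_trans (rsum_sqr_le n n0).
rewrite ler_pXn2r ?nnegrE ?nc_ge0 ?rsum_ge0//.
exact: psum_le.
Qed.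

End FixedRatio.
End DirichletSeries.

(** * The gliding hump *)

Section Necessity.
Variable R : realType.
Implicit Types (f g u phi : R[i] -> R[i]) (r x b d e : R) (z w h : R[i]) (n m i : nat).

Definition dirichlet_ball : set (R[i] -> R[i]) := [set v | dirichlet v /\ dirichlet_norm v <= 1].

(** The norm of the evaluation at z.  In the disc the set is nonempty and
    bounded ([eval_norm_has_sup]); outside, the value is immaterial. *)
Definition eval_norm z : R := sup [set nc (v z) | v in dirichlet_ball].

Lemma dirichlet_ball1 : dirichlet_ball (fun=> 1).
Proof.
apply: (@dirichlet_bound _ _ _ 1 0); [exact: hol_cst|exact: ler01| | |].
- by rewrite nc1 expr1n.
- rewrite /energy integral0_eq// => p _.
  by rewrite (is_cder_cderiv (is_cder_cst _ _)) nc0 expr0n.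
- by rewrite addr0 expr1n.
Qed.

Lemma eval_norm_has_sup z : nc z < 1 -> has_sup [set nc (v z) | v in dirichlet_ball].
Proof.
move=> z1; split; first by exists (nc (1 : R[i])); exists (fun=> 1) => //; exact: dirichlet_ball1.
have [c c0 H] := point_eval_bound (nc_ge0 z) z1.
exists c => _ [v [Dv Nv] <-]; apply: le_trans (H v z Dv (lexx _)).1 _.
by rewrite ler_piMr.
Qed.

Lemma eval_norm_ge z v : nc z < 1 -> dirichlet_ball v -> nc (v z) <= eval_norm z.
Proof.
by move=> z1 bv; apply: ub_le_sup; [exact: (eval_norm_has_sup z1).2|exists v].
Qed.

Lemma eval_norm_ge1 z : nc z < 1 -> 1 <= eval_norm z.
Proof. by move=> z1; have := eval_norm_ge z1 dirichlet_ball1; rewrite nc1. Qed.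

Lemma eval_norm_near z : nc z < 1 -> exists2 v, dirichlet_ball v & 3 / 4 * eval_norm z <= nc (v z).
Proof.
move=> z1; have E1 := eval_norm_ge1 z1.
have e0 : 0 < eval_norm z / 4 by rewrite divr_gt0// (lt_le_trans ltr01).
have [_ [v bv <-] H] := sup_adherent e0 (eval_norm_has_sup z1).
exists v => //; move: H; rewrite -/(eval_norm z); move: (eval_norm z) (nc (v z)) => p t; lra.
Qed.

Lemma eval_norm_scale g z x : nc z < 1 -> 0 < x -> dirichlet g -> dirichlet_norm g <= x ->
  nc (g z) <= x * eval_norm z.
Proof.
move=> z1 x0 Dg Ng; have [D1 N1] := dirichletZ (x^-1)%:C Dg.
have nx : nc (x^-1)%:C = x^-1 by rewrite ncC gtr0_norm// invr_gt0.
have B : dirichlet_ball (fun z => (x^-1)%:C * g z).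
  split; first exact: D1.
  by apply: le_trans N1 _; rewrite nx mulrC ler_pdivrMr// mul1r.
have := eval_norm_ge z1 B; rewrite ncM nx => H.
by rewrite -ler_pdivrMl.
Qed.

(** Contrapositive form of the growth of E at the boundary. *)
Lemma eval_norm_unbounded x : exists2 r, r < 1 & forall w, nc w < 1 ->
  eval_norm w <= x -> nc w <= r.
Proof.
have [r r1 H] := @unbounded_point_eval R (Num.bound `|64 * x|).
exists r => // w w1 wx; rewrite leNgt; apply/negP => rw.
have [f [Df Nf] fw] := H w (ltW rw) w1.
have := eval_norm_ge w1 (conj Df Nf); move/(le_trans fw)/le_trans/(_ wx).
rewrite ler_pdivrMr// leNgt => /negP; apply.
rewrite mulrC; apply: le_lt_trans (ler_norm _) _.
apply: lt_le_trans (archi_boundP (normr_ge0 _)) _.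
by rewrite ler_nat leqnSn.
Qed.

Let q : R := 16^-1.
Let q0 : 0 <= q. Proof. by rewrite invr_ge0. Qed.
Let q1 : q <= 2^-1. Proof. by rewrite lef_pV2 ?posrE//; lra. Qed.

Section Hump.
Variables (b : nat -> R[i] -> R[i]) (zz : nat -> R[i]).

(** Partial sums of the gliding hump.  The sign of the n-th term depends on the
    previous partial sum at the n-th point, and is chosen so that the new term is
    not cancelled there. *)
Fixpoint hump n z : R[i] :=
  if n is m.+1 then hump m z + (q ^+ m)%:C *
    ((if nc ((q ^+ m)%:C * b m (zz m)) <= nc (hump m (zz m) + (q ^+ m)%:C * b m (zz m))
      then 1 else -1) * b m z)
  else 0.

Definition hump_sign m : R[i] :=
  if nc ((q ^+ m)%:C * b m (zz m)) <= nc (hump m (zz m) + (q ^+ m)%:C * b m (zz m))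
  then 1 else -1.

Lemma nc_hump_sign m : nc (hump_sign m) = 1.
Proof. by rewrite /hump_sign; case: ifP => _; rewrite ?ncN nc1. Qed.

Lemma psum_hump n z : psum q (fun m z => hump_sign m * b m z) n z = hump n z.
Proof. by elim: n => [//|n IH] /=; rewrite IH. Qed.

(** One of a + c and a - c has modulus at least |c|, because their difference
    is 2c. *)
Lemma hump_ge n : q ^+ n * nc (b n (zz n)) <= nc (hump n.+1 (zz n)).
Proof.
have qn : q ^+ n = nc (q ^+ n)%:C by rewrite ncC ger0_norm// exprn_ge0.
rewrite {1}qn -ncM /=; set c := (q ^+ n)%:C * b n (zz n); set a := hump n (zz n).
have [ca|ca] := leP (nc c) (nc (a + c)); first by rewrite mul1r.
rewrite mulN1r mulrN -/c.
have := ncBle (a + c) (a - c).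
have -> : a + c - (a - c) = c + c by ring.
have : nc (c + c) = 2 * nc c by rewrite -mulr2n normcMn mulr_natl.
by move=> ->; move: ca; move: (nc c) (nc (a + c)) (nc (a - c)) => x y t; lra.
Qed.

End Hump.

(** The uniform boundedness principle by a gliding hump.  At z_n the sum u exceeds
    E(z_n) 16^-n / 2: the n-th partial sum exceeds 3/4 of E(z_n) 16^-n by the
    choice of signs, and the tail is at most a quarter of it.  Boundedness of the
    operator of u then gives E(phi(z_n)) <= 2 16^n K for all n, against the
    choice of z_n. *)
Lemma eval_norm_comp_bounded phi : analytic_self_map phi ->
  multipliers_of phi = dirichlet ->
  exists x, forall z, nc z < 1 -> eval_norm (phi z) <= x.
Proof.
move=> [hphi phi1] Mphi; apply: contrapT => nx.
have [zz zzP] : {zz : nat -> R[i] & forall n, nc (zz n) < 1 /\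
    2 * 16 ^+ n * n%:R < eval_norm (phi (zz n))}.
  apply: (@choice _ _ (fun n z => nc z < 1 /\ 2 * 16 ^+ n * n%:R < eval_norm (phi z))) => n.
  apply: contrapT => nz; apply: nx; exists (2 * 16 ^+ n * n%:R) => z z1.
  by rewrite leNgt; apply/negP => lt; apply: nz; exists z.
have [b bP] : {b : nat -> R[i] -> R[i] & forall n, dirichlet_ball (b n) /\
    3 / 4 * eval_norm (zz n) <= nc (b n (zz n))}.
  apply: (@choice _ _ (fun n v => dirichlet_ball v /\ 3 / 4 * eval_norm (zz n) <= nc (v (zz n)))) => n.
  by have [v bv vz] := eval_norm_near (zzP n).1; exists v.
pose v m z := hump_sign b zz m * b m z.
have bv m : dirichlet_ball (v m).
  have [[Db Nb] _] := bP m; have [D1 N1] := dirichletZ (hump_sign b zz m) Db.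
  by split; [exact: D1|apply: le_trans N1 _; rewrite nc_hump_sign mul1r].
(* the constant 4 in the error of the series against the ratio 1/16 leaves a tail of a quarter of the n-th term *)
have [u Du uE] := dirichlet_series q0 q1 bv (fun z hz m => eval_norm_ge hz (bv m)).
have [_ [K HK]] : multipliers_of phi u by rewrite Mphi.
pose K' := Num.max K 1.
have K0 : 0 < K' by rewrite lt_max ltr01 orbT.
have up n : eval_norm (phi (zz n)) <= 2 * 16 ^+ n * K'.
  have [z1 _] := zzP n; have p1 := phi1 _ z1.
  have E1 := eval_norm_ge1 z1; have E0 : 0 < eval_norm (zz n) by rewrite (lt_le_trans ltr01).
  have qn0 : 0 < q ^+ n by rewrite exprn_gt0// invr_gt0.
  have ulow : q ^+ n * eval_norm (zz n) / 2 <= nc (u (zz n)).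
    have h1 := hump_ge b zz n; have h2 := uE (zz n) z1 n.+1.
    rewrite psum_hump in h2.
    have h3 := ler_wpM2l (ltW qn0) (bP n).2.
    have h4 := ncDist (hump b zz n.+1 (zz n)) (u (zz n)); rewrite ncB in h4.
    have h5 : 4 * eval_norm (zz n) * q ^+ n.+1 = q ^+ n * eval_norm (zz n) / 4.
      by rewrite exprS /q; move: (_ ^+ n) => t; field.
    have h6 : q ^+ n * (3 / 4 * eval_norm (zz n)) = 3 / 4 * (q ^+ n * eval_norm (zz n)) by ring.
    rewrite h5 in h2; rewrite h6 in h3.
    have h7 := le_trans h3 h1; have h8 := le_trans h4 h2.
    move: h7 h8; move: (q ^+ n * eval_norm (zz n)) (nc (hump b zz n.+1 (zz n))) (nc (u (zz n))).
    by move=> x y t; lra.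
  apply: ge_sup; first exact: (eval_norm_has_sup p1).1.
  move=> _ [f [Df Nf] <-]; have [DW NW] := HK f Df.
  have NW' : dirichlet_norm (wcomp u phi f) <= K'.
    apply: le_trans NW _; apply: (@le_trans _ _ (K' * dirichlet_norm f)).
      by rewrite ler_wpM2r ?dirichlet_norm_ge0// /K' le_max lexx.
    by rewrite ler_piMr// ltW.
  have := eval_norm_scale z1 K0 DW NW'; rewrite /wcomp ncM => H.
  have {}H := le_trans (ler_wpM2r (nc_ge0 (f (phi (zz n)))) ulow) H.
  have qi : q ^+ n * 16 ^+ n = 1 by rewrite -exprMn /q mulVf// expr1n.
  have s0 : 0 < q ^+ n * eval_norm (zz n) / 2 by rewrite divr_gt0// mulr_gt0.
  rewrite -(ler_pM2l s0); apply: le_trans H _.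
  have -> : q ^+ n * eval_norm (zz n) / 2 * (2 * 16 ^+ n * K') =
    (q ^+ n * 16 ^+ n) * (K' * eval_norm (zz n)) by field.
  by rewrite qi mul1r.
pose n := Num.bound K'.
have nK : K' < n%:R by exact: archi_boundP (ltW K0).
have := lt_le_trans (zzP n).2 (up n); rewrite ltNge => /negP; apply.
by rewrite ler_wpM2l ?(ltW nK)// mulr_ge0// exprn_ge0.
Qed.

End Necessity.

Theorem theorem2p3 (R : realType) (phi : R[i] -> R[i])
    (hphi : analytic_self_map phi) :
  multipliers_of phi = dirichlet <->
  (sup_norm phi < 1%E)%E /\ multipliers phi.
Proof.
split=> [Mphi|[sphi mphi]].
- split.
    have [x Hx] := eval_norm_comp_bounded hphi Mphi.
    have [r r1 Hr] := eval_norm_unbounded x.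
    apply: (@le_lt_trans _ _ r%:E); last by rewrite lte_fin.
    apply: ge_ereal_sup => _ [z z1 <-]; rewrite lee_fin.
    by apply: Hr; [exact: hphi.2|exact: Hx].
  move=> f Df.
  have [_ [K /(_ _ (@dirichlet_id R))[DW _]]] : multipliers_of phi f by rewrite Mphi.
  by rewrite (_ : (fun z => phi z * f z) = wcomp f phi id)//; apply/funext => z; rewrite mulrC.
- apply/seteqP; split=> [u []//|u Du]; split => //.
  have s0 : ((nc (phi 0))%:E <= sup_norm phi)%E.
    apply: ereal_sup_ubound; exists 0 => //.
    by change (nc (0 : R[i]) < 1); rewrite nc0.
  have sfin : sup_norm phi = (fine (sup_norm phi))%:E.
    rewrite fineK// fin_numE; apply/andP; split; apply/eqP => E; rewrite E in s0 sphi => //.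
  apply: (@wcomp_bounded _ _ _ (fine (sup_norm phi)) Du _ hphi).
  + have -> : (fun z => u z * phi z) = (fun z => phi z * u z) by apply/funext => z; rewrite mulrC.
    exact: mphi.
  + by rewrite -lee_fin -sfin; apply: le_trans s0; rewrite lee_fin nc_ge0.
  + by rewrite -lte_fin -sfin.
  + move=> z z1; rewrite -lee_fin -sfin; apply: ereal_sup_ubound.
    by exists z.
Qed.
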